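(* Let $p,q>0$ be integers. The Griffiths period domain of weight two $SO(2p,q)/(U(p)\times SO(q))$ admits a symplectic form $\omega$ and an almost complex structure compatible with $\omega$ whose Chern-Ricci form satisfies $\rho=(2p-2q-2)\omega$.
   Context: $SO(2p,q)$ denotes the identity component of the group of endomorphisms of $\mathbf R^{2p+q}$ preserving a scalar product of signature $(2p,q)$. $U(p)\times SO(q)\subset SO(2p)\times SO(q)\subset SO(2p,q)$, where $U(p)\subset SO(2p)$ is the subgroup commuting with the standard complex structure of $\mathbf R^{2p}$. An almost complex structure $J$ on a symplectic manifold $(M,\omega)$ is compatible if $\omega(JX,JY)=\omega(X,Y)$ and $\omega(X,JX)>0$ for all nonzero $X$; put $g(X,Y)=\omega(X,JY)$ and $4N(X,Y)=[JX,JY]-J[JX,Y]-J[X,JY]-[X,Y]$. The Chern connection $\nabla$ is the unique connection preserving $g$ with torsion $N$, $R(X,Y)=\nabla_X\nabla_Y-\nabla_Y\nabla_X-\nabla_{[X,Y]}$ is its curvature, and the Chern-Ricci form is $\rho(X,Y)=\mathrm{tr}(JR(X,Y))$ (real trace). *)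

(* Defs.v *)
From HB Require Import structures.
From mathcomp Require Import all_boot all_order all_algebra.
From mathcomp Require Import all_classical all_reals all_analysis.
From mathcomp Require Import ring.
Set Implicit Arguments.
Unset Strict Implicit.
Unset Printing Implicit Defensive.
Import Order.TTheory GRing.Theory Num.Theory.
Import numFieldNormedType.Exports.
Local Open Scope classical_set_scope.
Local Open Scope ring_scope.

Section SmoothFunctions.
Variables (R : realType) (V : normedModType R).
Implicit Types (U : set V) (F : V -> R).

(* C^k on the open set U: the iterated directional derivatives up to order k
   exist and are continuous. *)
Fixpoint Ck (k : nat) U F : Prop :=
  match k with
  | 0 => forall x, U x -> {for x, continuous F}
  | k'.+1 => (forall x, U x -> differentiable F x) /\
             (forall v, Ck k' U (fun x => 'D_v F x))
  end.

Definition Cinfty U F := forall k, Ck k U F.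

Let near_open U (f g : V -> R) x : open U -> (forall x, U x -> f x = g x) ->
  U x -> {near x, f =1 g}.
Proof.
by move=> oU fg Ux; apply: filterS (open_nbhs_nbhs (conj oU Ux)) => y /fg.
Qed.

Let differentiable_near0 (f : V -> R) x : {near x, f =1 cst 0} ->
  differentiable f x.
Proof.
move=> f0; have f0' : (f \o shift x) =
    cst (f x) + (\0%R : {linear V -> R}) +o_ (0 : V) id.
  apply/eqaddoP => _/posnumP[e]; rewrite -nbhs_nearE near_simpl /=.
  have : \forall h \near (0 : V), f (h + x) = 0.
    move: f0; rewrite (near_shift 0)/= => f0.
    by near=> h; rewrite -[x](subr0); near: h.
  apply: filterS => h fh.
  rewrite -![(_ + _ : _ -> _) _]/(_ + _) -![(- _ : _ -> _) _]/(- _) /=.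
  rewrite fh (nbhs_singleton f0) /cst /= addr0 subrr normr0.
  by rewrite mulr_ge0.
have c0 : continuous (\0%R : {linear V -> R}) by move=> y; exact: cvg_cst.
have d0 := diff_unique c0 f0'.
by apply/diff_locallyP; rewrite d0.
Unshelve. all: by end_near. Qed.

Lemma near_eq_differentiable (f g : V -> R) x :
  {near x, f =1 g} -> differentiable f x -> differentiable g x.
Proof.
move=> fg df; rewrite (_ : g = f + (g - f)); last by rewrite addrC subrK.
apply: differentiableD => //; apply: differentiable_near0.
by apply: filterS fg => y fgy; rewrite -[LHS]/(g y - f y) fgy subrr.
Qed.

Lemma Ck_subset k U U' F : U' `<=` U -> Ck k U F -> Ck k U' F.
Proof.
elim: k F => [|k IHk] F sU /=; first by move=> cF x /sU /cF.
by move=> [dF cF]; split=> [x /sU /dF //|v]; apply: IHk (cF v).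
Qed.

Lemma Ck_eq k U F F' : open U -> (forall x, U x -> F x = F' x) ->
  Ck k U F -> Ck k U F'.
Proof.
move=> oU; elim: k F F' => [|k IHk] F F' FF' /=.
  move=> cF x Ux; have nFF' := near_open oU FF' Ux.
  rewrite /prop_for /continuous_at -(FF' _ Ux).
  by apply: cvg_trans (cF x Ux); apply: near_eq_cvg nFF'.
move=> [dF cF]; split=> [x Ux|v].
  exact: near_eq_differentiable (near_open oU FF' Ux) (dF _ Ux).
apply: IHk (cF v) => x Ux; apply: near_eq_derive; exact: near_open Ux.
Qed.

Lemma CkW k U F : Ck k.+1 U F -> Ck k U F.
Proof.
elim: k F => [|k IHk] F; last by move=> [dF cF]; split=> // v; exact/IHk/cF.
by move=> [dF _] x Ux; exact/differentiable_continuous/dF.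
Qed.

Lemma Ck_cst k U (c : R) : Ck k U (cst c).
Proof.
elim: k c => [|k IHk] c /=; first by move=> x _; exact: cvg_cst.
split=> [x _|v]; first exact: differentiable_cst.
by rewrite (_ : (fun _ => _) = cst 0) //; apply/funext => x; rewrite derive_cst.
Qed.

Lemma CkD k U F G : open U -> Ck k U F -> Ck k U G -> Ck k U (F + G).
Proof.
move=> oU; elim: k F G => [|k IHk] F G /=.
  by move=> cF cG x Ux; apply: cvgD; [exact: cF|exact: cG].
move=> [dF cF] [dG cG]; split=> [x Ux|v].
  by apply: differentiableD; [exact: dF|exact: dG].
apply: Ck_eq (IHk _ _ (cF v) (cG v)) => // x Ux.
by rewrite deriveD//; apply: diff_derivable; [exact: dF|exact: dG].
Qed.

Lemma CkM k U F G : open U -> Ck k U F -> Ck k U G -> Ck k U (F * G).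
Proof.
move=> oU; elim: k F G => [|k IHk] F G.
  by move=> cF cG x Ux; apply: cvgM; [exact: cF|exact: cG].
move=> CF CG; have [[dF cF] [dG cG]] := (CF, CG); split=> [x Ux|v].
  by apply: differentiableM; [exact: dF|exact: dG].
have := CkD oU (IHk _ _ (CkW CF) (cG v)) (IHk _ _ (CkW CG) (cF v)).
apply: Ck_eq => // x Ux.
by rewrite deriveM//; apply: diff_derivable; [exact: dF|exact: dG].
Qed.

End SmoothFunctions.

(* A smooth manifold M enters through its set of points and its algebra C^oo(M)
   of smooth functions, which determine its smooth structure: vector fields are
   the derivations of C^oo(M), and tensor fields are the C^oo(M)-multilinear
   maps on vector fields.  The record does not require M to be locally
   Euclidean; the manifold it is used for is homogeneous_space below. *)
Record smoothSpace (R : realType) := SmoothSpace {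
  carrier :> Type;
  smooth : {pred carrier -> R};
  smooth_subring : subring_closed smooth;
  smooth_submod : submod_closed smooth
}.

Section FunctionAlgebra.
Variables (R : realType) (M : smoothSpace R).

HB.instance Definition _ :=
  GRing.isSubringClosed.Build (M -> R) (@smooth R M) (@smooth_subring R M).
HB.instance Definition _ :=
  GRing.isSubmodClosed.Build R (M -> R) (@smooth R M)
    (GRing.submod_closed_semi (@smooth_submod R M)).

Record smoothFun := SmoothFun {
  smooth_fun :> M -> R;
  smooth_funP : smooth_fun \in @smooth R M
}.

HB.instance Definition _ := [isSub for smooth_fun].
HB.instance Definition _ := [Choice of smoothFun by <:].
HB.instance Definition _ :=
  GRing.SubChoice_isSubComPzRing.Build (M -> R) (@smooth R M) smoothFun
    (subringClosedP _).
HB.instance Definition _ := [SubZmodule_isSubLmodule of smoothFun by <:].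

Definition derivation_law (D : smoothFun -> smoothFun) :=
  linear D /\ (forall f g, D (f * g) = D f * g + f * D g).

(* The codomain is the regular module C^oo(M)^o, so that functions into it form
   a module over the ring C^oo(M). *)
Definition is_derivation : {pred smoothFun -> smoothFun^o} :=
  fun D => `[< derivation_law D >].

Lemma is_derivation_submod : submod_closed is_derivation.
Proof.
split=> [|a D E /asboolP[lD LD] /asboolP[lE LE]]; apply/asboolP.
  split=> [c f g|f g]; first by rewrite scaler0 addr0.
  by rewrite mul0r mulr0 addr0.
split=> [c f g|f g]; rewrite !fctE /=.
  rewrite lD lE -[a *: _]/(a * _) -[a *: D f]/(a * D f) -[a *: D g]/(a * D g).
  rewrite mulrDr scalerDr -!addrA; congr (_ + _).
    by apply/val_inj/funext => y; rewrite /= !fctE mulrCA.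
  by rewrite addrCA.
rewrite LD LE.
have ->// : a * (D f * g + f * D g) + (E f * g + f * E g) =
  (a * D f + E f) * g + f * (a * D g + E g) :> smoothFun by ring.
Qed.

HB.instance Definition _ :=
  GRing.isSubmodClosed.Build smoothFun (smoothFun -> smoothFun^o) is_derivation
    (GRing.submod_closed_semi is_derivation_submod).

Record vectorField := VectorField {
  derivation :> smoothFun -> smoothFun^o;
  derivationP : derivation \in is_derivation
}.

HB.instance Definition _ := [isSub for derivation].
HB.instance Definition _ := [Choice of vectorField by <:].
HB.instance Definition _ := [SubChoice_isSubZmodule of vectorField by <:].
HB.instance Definition _ := [SubZmodule_isSubLmodule of vectorField by <:].

Lemma bracket_subproof (X Y : vectorField) :
  (fun f => X (Y f) - Y (X f)) \in is_derivation.
Proof.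
have /asboolP[] := derivationP X; move: (derivation X) => {}X lX LX.
have /asboolP[] := derivationP Y; move: (derivation Y) => {}Y lY LY.
have DX (f g : smoothFun) : X (f + g) = X f + X g :> smoothFun.
  by have := lX 1 f g; rewrite !scale1r.
have DY (f g : smoothFun) : Y (f + g) = Y f + Y g :> smoothFun.
  by have := lY 1 f g; rewrite !scale1r.
apply/asboolP; split=> [c f g|f g].
  by rewrite [Y (_ + _)]lY [X (_ + _)]lX [X (c *: f + g)]lX [Y (_ + _)]lY
    scalerBr opprD addrACA.
rewrite [Y (f * g)]LY [X (f * g)]LX [X (_ + _)]DX [Y (_ + _)]DY.
rewrite [X (Y f * g)]LX [X (f * Y g)]LX [Y (X f * g)]LY [Y (f * X g)]LY.
by ring.
Qed.

Definition bracket (X Y : vectorField) : vectorField :=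
  VectorField (bracket_subproof X Y).

End FunctionAlgebra.

Section AlmostKaehlerGeometry.
Variables (R : realType) (M : smoothSpace R).
Local Notation C := (smoothFun M).
Local Notation vf := (vectorField M).
Implicit Types (w : vf -> vf -> C) (J : vf -> vf) (nabla : vf -> vf -> vf)
  (X Y Z : vf) (x : M).

(* X_x <> 0; pointwise conditions on tangent vectors are stated on the values of
   vector fields, since every tangent vector is such a value. *)
Definition nonzero_at X x := exists f : C, X f x != 0.

Definition two_form w :=
  (forall X Y, w X Y = - w Y X) /\ (forall X, scalar (w X)).

(* dw = 0, by the invariant formula for the exterior derivative. *)
Definition closed_form w := forall X Y Z,
  X (w Y Z) + Y (w Z X) + Z (w X Y)
  - w (bracket X Y) Z - w (bracket Y Z) X - w (bracket Z X) Y = 0.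

Definition nondegenerate_form w :=
  forall X x, nonzero_at X x -> exists Y, w X Y x != 0.

Definition symplectic w :=
  [/\ two_form w, closed_form w & nondegenerate_form w].

Definition almost_complex J := linear J /\ (forall X, J (J X) = - X).

Definition compatible w J :=
  (forall X Y, w (J X) (J Y) = w X Y) /\
  (forall X x, nonzero_at X x -> 0 < w X (J X) x).

Definition metric w J X Y : C := w X (J Y).

Definition nijenhuis J X Y : vf :=
  (4^-1 *: (1 : C)) *:
    (bracket (J X) (J Y) - J (bracket (J X) Y) - J (bracket X (J Y))
     - bracket X Y).

Definition connection nabla :=
  [/\ forall Y, linear (nabla^~ Y),
      forall X Y Z, nabla X (Y + Z) = nabla X Y + nabla X Z &
      forall X (f : C) Y, nabla X (f *: Y) = (X f : C) *: Y + f *: nabla X Y].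

Definition torsion nabla X Y : vf := nabla X Y - nabla Y X - bracket X Y.

Definition preserves_metric (g : vf -> vf -> C) nabla :=
  forall X Y Z, X (g Y Z) = g (nabla X Y) Z + g Y (nabla X Z).

Definition chern_connection w J nabla :=
  [/\ connection nabla, preserves_metric (metric w J) nabla &
      forall X Y, torsion nabla X Y = nijenhuis J X Y].

Definition curvature nabla X Y Z : vf :=
  nabla X (nabla Y Z) - nabla Y (nabla X Z) - nabla (bracket X Y) Z.

Definition tangent_at x (v : C -> R) :=
  scalar v /\ (forall f g : C, v (f * g) = v f * g x + f x * v g).

(* The values of the E i at x form a basis of the tangent space T_x M. *)
Definition frame_at x n (E : 'I_n -> vf) :=
  forall v, tangent_at x v ->
  exists! c : 'rV[R]_n, forall f : C, v f = \sum_i c 0 i * (E i f : C) x.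

(* t is the trace of the endomorphism of T_x M induced by L, for L linear over
   C^oo(M); A is the matrix of this endomorphism in the basis (E i)_x. *)
Definition trace_at x (L : vf -> vf) (t : R) :=
  exists n (E : 'I_n -> vf) (A : 'M[R]_n),
  [/\ frame_at x E,
      forall j (f : C), (L (E j) f : C) x = \sum_i A i j * (E i f : C) x &
      t = \tr A].

Definition chern_ricci_form J nabla (rho : vf -> vf -> C) :=
  forall X Y x, trace_at x (fun Z => J (curvature nabla X Y Z)) (rho X Y x).

End AlmostKaehlerGeometry.

Section HomogeneousSpace.
Variables (R : realType) (n : nat) (G H : set 'M[R]_n).

Definition left_cosets :=
  {x : set 'M[R]_n | exists2 g, G g & x = [set g *m h | h in H]}.

(* The quotient smooth structure, for G a closed subgroup of GL_n(R) and H a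
   closed subgroup of G: f is smooth on G/H iff its pull-back to G is smooth,
   i.e. is near each point of G the restriction to G of a smooth function on an
   open set of matrices. *)
Definition coset_smooth : {pred left_cosets -> R} :=
  fun f => `[< forall g0, G g0 -> exists U F,
    [/\ open_nbhs g0 U, Cinfty U F &
        forall (x : left_cosets) g, G g -> U g -> sval x g -> F g = f x] >].

Let coset_smoothD : {in coset_smooth &, forall f g, f + g \in coset_smooth}.
Proof.
move=> f f' /asboolP sf /asboolP sf'; apply/asboolP => g0 Gg0.
have [U [F [[oU Ug0] cF Ff]]] := sf _ Gg0.
have [U' [F' [[oU' Ug0'] cF' Ff']]] := sf' _ Gg0.
have oUU' := openI oU oU'.
exists (U `&` U'), (F + F'); split=> // [k|x g Gg [Ug Ug'] xg].
  by apply: CkD => //;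
    [apply: Ck_subset (cF k)|apply: Ck_subset (cF' k)] => ? [].
by rewrite fctE (Ff x) ?(Ff' x).
Qed.

Let coset_smoothM : {in coset_smooth &, forall f g, f * g \in coset_smooth}.
Proof.
move=> f f' /asboolP sf /asboolP sf'; apply/asboolP => g0 Gg0.
have [U [F [[oU Ug0] cF Ff]]] := sf _ Gg0.
have [U' [F' [[oU' Ug0'] cF' Ff']]] := sf' _ Gg0.
have oUU' := openI oU oU'.
exists (U `&` U'), (F * F'); split=> // [k|x g Gg [Ug Ug'] xg].
  by apply: CkM => //;
    [apply: Ck_subset (cF k)|apply: Ck_subset (cF' k)] => ? [].
by rewrite fctE (Ff x) ?(Ff' x).
Qed.

Let coset_smooth_cst (c : R) : cst c \in coset_smooth.
Proof.
apply/asboolP => g0 _; exists setT, (cst c); split=> //.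
- by split=> //; exact: openT.
- by move=> k; exact: Ck_cst.
Qed.

Lemma coset_smooth_subring : subring_closed coset_smooth.
Proof.
split=> [|f g sf sg|]; [exact: coset_smooth_cst| |exact: coset_smoothM].
rewrite (_ : f - g = f + cst (-1) * g); last first.
  by apply/funext => x; rewrite !fctE mulN1r.
by apply: coset_smoothD => //; apply: coset_smoothM.
Qed.

Lemma coset_smooth_submod : submod_closed coset_smooth.
Proof.
split=> [|c f g sf sg]; first exact: coset_smooth_cst.
rewrite (_ : c *: f = cst c * f) //.
by apply: coset_smoothD => //; apply: coset_smoothM.
Qed.

Definition homogeneous_space : smoothSpace R :=
  SmoothSpace coset_smooth_subring coset_smooth_submod.

End HomogeneousSpace.

Definition signature_form (R : realType) (m q : nat) : 'M[R]_(m + q) :=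
  block_mx 1%:M 0 0 (- 1%:M).

Definition indefinite_O (R : realType) (m q : nat) : set 'M[R]_(m + q) :=
  [set A | A^T *m signature_form R m q *m A = signature_form R m q].
Arguments indefinite_O : clear implicits.

Definition indefinite_SO0 (R : realType) (m q : nat) : set 'M[R]_(m + q) :=
  connected_component (indefinite_O R m q) 1%:M.
Arguments indefinite_SO0 : clear implicits.

Definition special_orthogonal (R : realType) (m : nat) : set 'M[R]_m :=
  [set A | A^T *m A = 1%:M /\ \det A = 1].
Arguments special_orthogonal : clear implicits.

(* R^(2p) = R^p (+) R^p, as column vectors, with J (x, y) = (- y, x). *)
Definition standard_J (R : realType) (p : nat) : 'M[R]_(p + p) :=
  block_mx 0 (- 1%:M) 1%:M 0.

Definition unitary_in_SO (R : realType) (p : nat) : set 'M[R]_(p + p) :=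
  [set A | special_orthogonal R (p + p) A /\
           A *m standard_J R p = standard_J R p *m A].
Arguments unitary_in_SO : clear implicits.

Definition isotropy (R : realType) (p q : nat) : set 'M[R]_(p + p + q) :=
  [set B | exists A1 A2, [/\ unitary_in_SO R p A1, special_orthogonal R q A2 &
                             B = block_mx A1 0 0 A2]].
Arguments isotropy : clear implicits.

Definition period_domain (R : realType) (p q : nat) : smoothSpace R :=
  homogeneous_space (indefinite_SO0 R (p + p) q) (isotropy R p q).

(* Main.v *)
Require Import Defs.
From HB Require Import structures.
From mathcomp Require Import all_boot all_order all_algebra.
From mathcomp Require Import all_classical all_reals all_analysis.
From mathcomp Require Import complex ring lra.
Set Implicit Arguments.
Unset Strict Implicit.
Unset Printing Implicit Defensive.
Import Order.TTheory GRing.Theory Num.Theory.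
Import numFieldNormedType.Exports.
Local Open Scope classical_set_scope.
Local Open Scope ring_scope.

(* Let sigma_0 be the rotation by 2 pi / 3 on R^2p, extended by the identity of
   R^q.  Its centralizer in SO_0(2p,q) is U(p) x SO(q), so that a point gH of
   the domain is the same thing as sigma = g sigma_0 g^-1, an element of order
   three: the domain is a 3-symmetric space.  Write rot for the conjugation by
   sigma and m for the complement {B | B + rot B + rot^2 B = 0} of the isotropy
   algebra.  A vector field X corresponds to the function theta X with values in
   m such that X sigma = [theta X, sigma], and
     theta (J X) = (rot - rot^2) (theta X) / sqrt 3,
     omega (X, Y) = tr (I [theta X, theta Y]) / 2,  I = (sigma - sigma^2) / sqrt 3,
     theta (nabla_X Y) = X (theta Y) - [theta X, theta Y].
   The torsion of nabla is - [theta X, theta Y]_m, which is the Nijenhuis tensor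
   because [J x, y]_m = - J [x, y]_m, and its curvature is
     theta (R (X, Y) Z) = - [h, theta Z],  h = the isotropy part of [theta X, theta Y].
   The trace of J o ad h over m is (tr sigma + 1) tr (I h) = (q - p + 1) tr (I h)
   and tr (I h) = 2 omega (X, Y), whence rho = (2p - 2q - 2) omega.  A Koszul
   argument shows that the Chern connection is unique. *)

(** The manifold is known only through the algebra [C^oo(M)], without charts, so the obstacle is to
    prove that a tangent vector is determined by its values on the entries of sigma. This is what
    the analysis serves: a smooth local section of g |-> g sigma_0 g^-1 makes every smooth function
    locally a smooth function of sigma, and Hadamard's lemma with a cutoff then shows that a tangent
    vector killing the entries of sigma is zero. Beyond that point the geometry is matrix algebra
    over the commutative ring [C^oo(M)]. This algebra stays short because nabla is d - ad theta, for
    which sigma is parallel; hence so is all that is built from sigma: rot, J, I and the pairing tr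
    (I [a, b]). Preservation of the metric is then immediate, closedness of omega reduces to the
    Jacobi identity, and only brackets survive in the torsion and the curvature. Up to sign
    conventions omega is half the Kirillov-Kostant-Souriau form of the orbit of I. As rho depends on
    J and nabla alone, the factor 1/2 is what fixes the constant. *)

Section Entries.
Variables (C : pzRingType) (m n : nat).
Implicit Types A B : 'M[C]_(m, n).

Lemma entryD A B i j : (A + B) i j = A i j + B i j. Proof. by rewrite mxE. Qed.
Lemma entryN A i j : (- A) i j = - A i j. Proof. by rewrite mxE. Qed.
Lemma entryZ a A i j : (a *: A) i j = a * A i j. Proof. by rewrite mxE. Qed.
Lemma entryMn A k i j : (A *+ k) i j = A i j *+ k.
Proof. by elim: k => [|k IHk]; rewrite ?mulr0n ?mulrS ?mxE// IHk. Qed.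
Lemma entry0 i j : (0 : 'M[C]_(m, n)) i j = 0. Proof. by rewrite mxE. Qed.

(** Unlike [mxE], this set leaves the entries of products folded, so that [ring] treats each of them
    as a letter. *)
Definition entryE := (entryD, entryN, entryZ, entryMn, entry0).

End Entries.

Section Evaluation.
Variables (R : realType) (M : smoothSpace R).
Local Notation C := (smoothFun M).
Implicit Types (f g : C) (y : M).

Lemma ev1 y : (1 : C) y = 1. Proof. by []. Qed.
Lemma evD f g y : (f + g) y = f y + g y. Proof. by []. Qed.
Lemma evN f y : (- f) y = - f y. Proof. by []. Qed.
Lemma evM f g y : (f * g) y = f y * g y. Proof. by []. Qed.
Lemma evZ c f y : (c *: f) y = c * f y. Proof. by []. Qed.
Lemma ev_sum (I : Type) (r : seq I) (P : pred I) (F : I -> C) y :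
  (\sum_(i <- r | P i) F i) y = \sum_(i <- r | P i) F i y.
Proof. by apply: (big_morph (fun f : C => f y)). Qed.

Lemma ev_nat m y : (m%:R : C) y = m%:R.
Proof. by elim: m => // m IHm; rewrite !mulrS evD ev1 IHm. Qed.

End Evaluation.

(** * Smooth functions on normed modules *)

Section SmoothCalculus.
Variables (R : realType) (V : normedModType R).
Implicit Types (U : set V) (F G : V -> R).

Lemma Cinfty_differentiable U F x : Cinfty U F -> U x -> differentiable F x.
Proof. by move=> sF; have [+ _] := sF 1; apply. Qed.

Lemma Cinfty_derive U F v : Cinfty U F -> Cinfty U (fun x => 'D_v F x).
Proof. by move=> sF k; have [_] := sF k.+1; apply. Qed.

Lemma Cinfty_continuous U F x : Cinfty U F -> U x -> {for x, continuous F}.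
Proof. by move=> sF Ux; exact: differentiable_continuous (Cinfty_differentiable sF Ux). Qed.

Lemma Cinfty_subset U U' F : U' `<=` U -> Cinfty U F -> Cinfty U' F.
Proof. by move=> sU sF k; exact: Ck_subset (sF k). Qed.

Lemma Cinfty_eq U F G : open U -> (forall x, U x -> F x = G x) ->
  Cinfty U F -> Cinfty U G.
Proof. by move=> oU FG sF k; exact: Ck_eq (sF k). Qed.

Lemma Cinfty_cst U (c : R) : Cinfty U (fun=> c).
Proof. by move=> k; exact: Ck_cst. Qed.

Lemma CinftyD U F G : open U -> Cinfty U F -> Cinfty U G ->
  Cinfty U (fun x => F x + G x).
Proof. by move=> oU sF sG k; exact: CkD. Qed.

Lemma CinftyM U F G : open U -> Cinfty U F -> Cinfty U G ->
  Cinfty U (fun x => F x * G x).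
Proof. by move=> oU sF sG k; exact: CkM. Qed.

Lemma CinftyN U F : open U -> Cinfty U F -> Cinfty U (fun x => - F x).
Proof.
move=> oU sF; apply: (@Cinfty_eq _ (fun x => -1 * F x)) => //.
  by move=> x _; rewrite mulN1r.
by apply: CinftyM => //; exact: Cinfty_cst.
Qed.

Lemma Cinfty_sum U (I : Type) (r : seq I) (F : I -> V -> R) : open U ->
  (forall i, Cinfty U (F i)) -> Cinfty U (fun x => \sum_(i <- r) F i x).
Proof.
move=> oU sF; elim: r => [|i r IHr].
  by apply: Cinfty_eq (Cinfty_cst U 0) => // x _; rewrite big_nil.
apply: Cinfty_eq (CinftyD oU (sF i) IHr) => // x _.
by rewrite big_cons.
Qed.

Lemma Ck_sum k U (I : Type) (r : seq I) (F : I -> V -> R) : open U ->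
  (forall i, Ck k U (F i)) -> Ck k U (fun x => \sum_(i <- r) F i x).
Proof.
move=> oU sF; elim: r => [|i r IHr].
  by apply: Ck_eq (Ck_cst k U 0) => // x _; rewrite big_nil.
apply: Ck_eq (CkD oU (sF i) IHr) => // x _.
by rewrite big_cons.
Qed.

Lemma Cinfty_linear U (f : {linear V -> R}) : continuous f -> Cinfty U f.
Proof.
move=> cf [|k] /=; first by move=> x _; exact: cf.
split=> [x _|v]; first exact: linear_differentiable.
rewrite (_ : (fun _ => _) = cst (f v)); first exact: Ck_cst.
by apply/funext => x; rewrite deriveE ?diff_lin//; exact: linear_differentiable.
Qed.

(** [Ck] imposes conditions point by point on derivatives that are defined globally, so smoothness
    glues. Serves to extend a product with a cutoff by 0. *)
Lemma CinftyU U U' F : Cinfty U F -> Cinfty U' F -> Cinfty (U `|` U') F.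
Proof.
move=> sU sU' k; move: (sU k) (sU' k) => {sU sU'}.
elim: k F => [|k IHk] F /=; first by move=> cU cU' x [/cU|/cU'].
by move=> [dU cU] [dU' cU']; split=> [x [/dU|/dU']//|v]; exact: IHk.
Qed.

Section Composition.
Variables (W : normedModType R) (I : finType) (e : I -> W) (Phi : I -> V -> R).

Lemma differentiable_lincomb (r : seq I) x :
  (forall i, differentiable (Phi i) x) ->
  differentiable (fun y => \sum_(i <- r) Phi i y *: e i) x /\
  forall v, 'd (fun y => \sum_(i <- r) Phi i y *: e i) x v =
            \sum_(i <- r) 'd (Phi i) x v *: e i.
Proof.
move=> dPhi; elim: r => [|i r [IH1 IH2]].
  rewrite (_ : (fun _ => _) = cst 0); last by apply/funext => y; rewrite big_nil.
  by split=> [|v]; [exact: differentiable_cst|rewrite diff_cst big_nil].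
rewrite (_ : (fun _ => _) =
    (fun y => Phi i y *: e i) + (fun y => \sum_(j <- r) Phi j y *: e j)); last first.
  by apply/funext => y; rewrite big_cons.
have di : differentiable (fun y => Phi i y *: e i) x.
  exact: (@differentiableZl _ _ _ (Phi i) (e i)).
split=> [|v]; first exact: differentiableD.
rewrite diffD// -[LHS]/('d _ x v + 'd _ x v) IH2 big_cons; congr (_ + _).
by rewrite (@diffZl _ _ _ (Phi i) (e i)).
Qed.

(** [Ck] speaks of real functions only, so the inner map into [W] is given by coordinates [Phi i]
    along vectors [e i]. By the chain rule the derivative is a sum of products of derivatives of
    [Phi i] with composites of ['D_(e i) F], to which the induction hypothesis applies with the same
    [Phi]. *)
Lemma Ck_comp k U (U' : set W) (F : W -> R) : open U ->
  (forall i, Ck k U (Phi i)) -> Ck k U' F ->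
  (forall x, U x -> U' (\sum_i Phi i x *: e i)) ->
  Ck k U (fun x => F (\sum_i Phi i x *: e i)).
Proof.
move=> oU; elim: k F => [|k IHk] F sPhi sF UU'.
  move=> x Ux; apply: (@continuous_comp _ _ _ (fun x => \sum_i Phi i x *: e i) F).
    by apply: cvg_big => [|i _]; [exact: add_continuous|apply: cvgZr_tmp; exact: sPhi].
  by apply: sF; exact: UU'.
have dPhi x : U x -> forall i, differentiable (Phi i) x.
  by move=> Ux i; have [+ _] := sPhi i; apply.
have [dF cF] := sF.
split=> [x Ux|v].
  apply: (@differentiable_comp _ _ _ _ (fun x => \sum_i Phi i x *: e i) F).
    by have [] := differentiable_lincomb (index_enum I) (dPhi x Ux).
  exact/dF/UU'.
have sPhi' i : Ck k U (Phi i) by exact: CkW.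
apply: (@Ck_eq _ _ k _ (fun x => \sum_i
  'D_v (Phi i) x * 'D_(e i) F (\sum_i Phi i x *: e i))) => //; last first.
  apply: Ck_sum => // i.
  apply: CkM => //; first by have [_ +] := sPhi i; exact.
  exact: (IHk _ sPhi' (cF (e i)) UU').
move=> x Ux.
have [dS dSE] := differentiable_lincomb (index_enum I) (dPhi x Ux).
have dFx := dF _ (UU' _ Ux).
rewrite [RHS]deriveE; last exact: (@differentiable_comp _ _ _ _ (fun x => \sum_i Phi i x *: e i) F).
rewrite (@diff_comp _ _ _ _ (fun x => \sum_i Phi i x *: e i) F)//= dSE.
rewrite linear_sum; apply: eq_bigr => i _.
by rewrite linearZ/= !deriveE//; exact: dPhi.
Qed.

Lemma Cinfty_comp U (U' : set W) (F : W -> R) : open U ->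
  (forall i, Cinfty U (Phi i)) -> Cinfty U' F ->
  (forall x, U x -> U' (\sum_i Phi i x *: e i)) ->
  Cinfty U (fun x => F (\sum_i Phi i x *: e i)).
Proof. by move=> oU sPhi sF UU' k; exact: (Ck_comp oU (fun i => sPhi i k) (sF k) UU'). Qed.

End Composition.

Lemma Cinfty_comp1 U (D : set R) F (f : R -> R) : open U ->
  Cinfty U F -> Cinfty (D : set R^o) (f : R^o -> R) ->
  (forall x, U x -> D (F x)) ->
  Cinfty U (fun x => f (F x)).
Proof.
move=> oU sF sf UD.
have sumE x : \sum_(i : 'I_1) F x *: (1 : R^o) = F x.
  by rewrite big_ord1 /GRing.scale/= mulr1.
apply: (@Cinfty_eq _ (fun x => f (\sum_(i : 'I_1) F x *: (1 : R^o)))) => //.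
  by move=> x Ux; rewrite sumE.
apply: (@Cinfty_comp R^o _ (fun=> 1 : R^o) (fun=> F) U D) => // x Ux.
by rewrite sumE; exact: UD.
Qed.

End SmoothCalculus.

(** * Integration over the unit interval *)

Section UnitIntervalIntegral.
Variable R : realType.
Implicit Types (f g : R -> R).
Local Notation mu := (@lebesgue_measure R).
Local Notation I01 f := (\int[mu]_(t in `[0, 1]) f t).

Lemma integrable_unit f : continuous f ->
  mu.-integrable `[0, 1] (EFin \o f).
Proof.
move=> cf; apply: continuous_compact_integrable; first exact: segment_compact.
exact: continuous_subspaceT.
Qed.

Lemma unit_integralD f g : continuous f -> continuous g ->
  I01 (fun t => f t + g t) = I01 f + I01 g.
Proof. by move=> cf cg; rewrite RintegralD//; exact: integrable_unit. Qed.

Lemma unit_integralZ f c : continuous f -> I01 (fun t => c * f t) = c * I01 f.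
Proof. by move=> cf; rewrite RintegralZl//; exact: integrable_unit. Qed.

Lemma unit_integral_sum (I : Type) (r : seq I) (c : I -> R) (f : I -> R -> R) :
  (forall i, continuous (f i)) ->
  I01 (fun t => \sum_(i <- r) c i * f i t) = \sum_(i <- r) c i * I01 (f i).
Proof.
move=> cf; have cs s : continuous (fun t => \sum_(i <- s) c i * f i t).
  move=> t; apply: cvg_big => [|i _]; first exact: add_continuous.
  by apply: cvgM; [exact: cvg_cst|exact: cf].
elim: r => [|i r IHr].
  under eq_Rintegral do rewrite big_nil.
  by rewrite Rintegral_cst//= big_nil mul0r.
under eq_Rintegral do rewrite big_cons.
rewrite unit_integralD//; last by move=> t; apply: cvgM; [exact: cvg_cst|exact: cf].
by rewrite IHr unit_integralZ// big_cons.
Qed.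

Lemma unit_integral_bound f c : continuous f ->
  (forall t, 0 <= t <= 1 -> `|f t| <= c) -> `|I01 f| <= c.
Proof.
move=> cf fc; apply: le_trans (le_normr_Rintegral _ (integrable_unit cf)) _ => //.
have cnf : continuous (fun t => `|f t|).
  by move=> t; apply: (cvg_norm (cf t)).
apply: le_trans (le_Rintegral _ (integrable_unit cnf)
  (integrable_unit (fun=> cvg_cst c)) _) _ => //.
rewrite Rintegral_cst//= lebesgue_measure_itv/= lte_fin ltr01/= oppr0 addr0.
by rewrite mulr1.
Qed.

Lemma unit_integral_FTC (F f : R -> R) : continuous f ->
  (forall t, is_derive (t : R^o) (1 : R^o) (F : R^o -> R^o) (f t : R^o)) -> I01 f = F 1 - F 0.
Proof.
move=> cf dF; have cF : continuous F.
  move=> t; apply: differentiable_continuous; apply/derivable1_diffP.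
  by have [] := dF t.
rewrite /Rintegral (@continuous_FTC2 _ _ F) ?fineB//=.
- exact: continuous_subspaceT.
- split.
  + by move=> x _; have [] := dF x.
  + exact/cvg_at_right_filter/cF.
  + exact/cvg_at_left_filter/cF.
- by move=> x _; rewrite derive1E; have [_ ->] := dF x.
Qed.

End UnitIntervalIntegral.

(** * Differentiation under the integral and Hadamard's lemma *)

Section Hadamard.
Variables (R : realType) (m n : nat).
Local Notation V := 'M[R]_(m, n).
Implicit Types (F : V -> R) (x y h v : V).
Local Notation e i j := (delta_mx i j : V).

Lemma le_coord_norm h i j : `|h i j| <= `|h|.
Proof.
rewrite {2}/Num.norm/= mx_normrE.
exact: (le_bigmax _ (fun ij => `|h ij.1 ij.2|) (i, j)).
Qed.

Lemma derive_coord F x h : differentiable F x ->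
  'D_h F x = \sum_i \sum_j h i j * 'D_(e i j) F x.
Proof.
move=> dF; rewrite deriveE// {1}[h]matrix_sum_delta linear_sum.
apply: eq_bigr => i _; rewrite linear_sum; apply: eq_bigr => j _.
by rewrite linearZ/= deriveE.
Qed.

Local Notation mu := (@lebesgue_measure R).

(** The base point [y] varies together with the increment; differentiation under the integral needs
    this uniformity. The mean value theorem on the segment from y to y + h reduces it to the
    continuity of the partial derivatives. *)
Lemma C1_strict_differentiable F x (eps : R) : Ck 1 setT F -> 0 < eps ->
  \forall y \near x & h \near (0 : V),
    `|F (y + h) - F y - 'D_h F y| <= eps * `|h|.
Proof.
move=> [dF cF] eps0.
(* Each of the m n partial derivatives is compared at two points through its value at [x], at a cost
   of [2 * eta]; the successor keeps the denominator nonzero for empty matrices. *)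
pose eta := eps / (2 * (m * n).+1%:R).
have eta0 : 0 < eta by rewrite divr_gt0// mulr_gt0.
have [r r0 rP] : exists2 r : R, 0 < r & forall z, `|z - x| < r ->
    forall i j, `|'D_(e i j) F z - 'D_(e i j) F x| < eta.
  have : \forall z \near x, forall i j, `|'D_(e i j) F z - 'D_(e i j) F x| < eta.
    apply: (@filter_forall _ _ (fun i z => forall j, `|'D_(e i j) F z - 'D_(e i j) F x| < eta) (nbhs x)) => i.
    apply: (@filter_forall _ _ (fun j z => `|'D_(e i j) F z - 'D_(e i j) F x| < eta) (nbhs x)) => j.
    have /cvgrPdist_lt/(_ _ eta0) := cF (e i j) x I.
    by apply: filterS => z; rewrite distrC.
  move=> /nbhs_ballP[r r0 rP]; exists r => // z zx; apply: rP.
  by rewrite -ball_normE /ball_/= distrC.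
have r20 : 0 < r / 2 by rewrite divr_gt0.
near=> y h.
have yx : `|y - x| < r / 2.
  near: y; apply/nbhs_ballP; exists (r / 2) => //= z.
  by rewrite -ball_normE /ball_/= distrC.
have h0 : `|h| < r / 2.
  near: h; apply/nbhs_ballP; exists (r / 2) => //= z.
  by rewrite -ball_normE /ball_/= sub0r normrN.
have dphi (t : R) : is_derive (t : R^o) (1 : R^o) (fun t : R^o => F (y + t *: h) : R^o) ('D_h F (y + t *: h)).
  have dl : is_derive (t : R^o) (1 : R^o) (fun t : R^o => y + t *: h) h.
    have dd : differentiable (fun t : R^o => t *: h) (t : R^o).
      exact: (@differentiableZl _ _ _ (fun t : R^o => t : R^o) h).
    have dz : is_derive (t : R^o) (1 : R^o) (fun t : R^o => t *: h) h.
      apply: DeriveDef; first exact: diff_derivable.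
      by rewrite deriveE// (@diffZl _ _ _ (fun t : R^o => t : R^o) h)// diff_val/= scale1r.
    by have := is_deriveD (is_derive_cst y (t : R^o) (1 : R^o)) dz; rewrite add0r.
  have dft : differentiable (fun t : R^o => y + t *: h) (t : R^o).
    by apply/derivable1_diffP; have [] := dl.
  apply: DeriveDef.
    apply/diff_derivable/(@differentiable_comp _ _ _ _ (fun t : R^o => y + t *: h) F) => //.
    exact: dF.
  rewrite deriveE; last by apply: (@differentiable_comp _ _ _ _ (fun t : R^o => y + t *: h) F) => //; exact: dF.
  rewrite (@diff_comp _ _ _ _ (fun t : R^o => y + t *: h) F)//=; last exact: dF.
  have -> : 'd (fun t : R^o => y + t *: h) (t : R^o) (1 : R^o) = h.
    by rewrite -deriveE//; have [_ ->] := dl.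
  by rewrite deriveE//; exact: dF.
have cphi : {within `[0, 1], continuous (fun t : R => F (y + t *: h))}.
  apply: continuous_subspaceT => s; apply: differentiable_continuous.
  by apply/derivable1_diffP; have [] := dphi s.
have [c c01] := MVT_segment ler01 (fun s _ => dphi s) cphi.
rewrite scale1r scale0r addr0 subr0 mulr1 => cE.
have /andP[c0 c1] : 0 <= c <= 1 by move: c01; rewrite in_itv.
rewrite cE !derive_coord; [|exact: dF|exact: dF].
rewrite -sumrB.
have zx : `|y + c *: h - x| < r.
  rewrite addrAC (splitr r); apply: le_lt_trans (ler_normD _ _) _.
  rewrite ltrD// normrZ ger0_norm//; apply: le_lt_trans h0.
  by rewrite ler_piMl.
have yx' : `|y - x| < r by apply: lt_trans yx _; rewrite ltr_pdivrMr// ltr_pMr// ltr1n.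
have bnd i j : `|h i j * 'D_(e i j) F (y + c *: h) - h i j * 'D_(e i j) F y| <= `|h| * (2 * eta).
  rewrite -mulrBr normrM ler_pM ?le_coord_norm//.
  rewrite -['D_(e i j) F (y + c *: h)](subrK ('D_(e i j) F x)) -addrA.
  apply: le_trans (ler_normD _ _) _; rewrite mulr2n mulrDl mul1r lerD//.
    by apply/ltW/rP.
  by rewrite distrC; apply/ltW/rP.
apply: (@le_trans _ _ (\sum_(i < m) \sum_(j < n) `|h| * (2 * eta))).
  apply: le_trans (ler_norm_sum _ _ _) _; apply: ler_sum => i _.
  rewrite -sumrB; apply: le_trans (ler_norm_sum _ _ _) _.
  by apply: ler_sum => j _; exact: bnd.
rewrite !sumr_const !card_ord -mulrnA -[leLHS]mulr_natr -mulrA [leLHS]mulrC ler_wpM2r//.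
rewrite /eta invfM mulrCA mulVKf//.
by rewrite mulrAC ler_pdivrMr// ler_wpM2l ?(ltW eps0)// ler_nat mulnC leqnSn.
Unshelve. all: by end_near. Qed.

(* Differentiation under the integral turns the weight t^k into t^(k+1). *)
Definition radial_mean k F x : R := \int[mu]_(t in `[0, 1]) (t ^+ k * F (t *: x)).

Lemma radial_continuous F x k : Ck 0 setT F ->
  continuous (fun t : R => t ^+ k * F (t *: x)).
Proof.
move=> cF t; apply: cvgM; first exact: exprn_continuous.
apply: (@continuous_comp _ _ _ (fun t : R => t *: x) F); last exact: cF.
by apply: cvgZr_tmp; exact: cvg_id.
Qed.

Lemma radial_mean_diff k F x : Ck 1 setT F ->
  differentiable (radial_mean k F) x /\
  forall v, 'D_v (radial_mean k F) x = radial_mean k.+1 (fun y => 'D_v F y) x.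
Proof.
move=> sF; have [dF cF] := sF.
have c0 := CkW sF.
pose c i j := radial_mean k.+1 (fun y => 'D_(e i j) F y) x.
pose L h : R := \sum_i \sum_j h i j * c i j.
have LE h : L h = radial_mean k.+1 (fun y => 'D_h F y) x.
  rewrite /radial_mean; under [RHS]eq_Rintegral.
    move=> t _; rewrite derive_coord; last exact: dF.
    rewrite mulr_sumr; under eq_bigr do rewrite mulr_sumr.
    rewrite pair_big/=; under eq_bigr do rewrite mulrCA.
    over.
  rewrite unit_integral_sum; first by rewrite /L pair_big.
  move=> ij. by exact: (@radial_continuous (fun y => 'D_(e ij.1 ij.2) F y) x k.+1 (cF (e ij.1 ij.2))).
have Llin : linear L.
  move=> a u v; rewrite /L scaler_sumr -big_split; apply: eq_bigr => i _ /=.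
  by rewrite scaler_sumr -big_split; apply: eq_bigr => j _ /=; rewrite !mxE mulrDl scalerAl.
pose Lm := GRing.isLinear.Build R V R _ L Llin.
pose Ll : {linear V -> R} := HB.pack L Lm.
have cL : Ck 0 setT (fun h : V => \sum_i \sum_j h i j * c i j).
  apply: Ck_sum => [|i]; first exact: openT.
  apply: Ck_sum => [|j]; first exact: openT.
  apply: (@CkM _ _ 0 setT (fun h : V => h i j) (cst (c i j))); first exact: openT.
    by move=> y _; exact: coord_continuous.
  exact: Ck_cst.
have {}cL : continuous (Ll : V -> R) by move=> y; exact: cL.
have fL : (radial_mean k F \o shift x) = cst (radial_mean k F x) + Ll +o_ (0 : V) id.
  apply/eqaddoP => _/posnumP[eps]; rewrite -nbhs_nearE near_simpl /=.
  (* Compactness of [0, 1] turns strict differentiability at each point [t *: x] into one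
     neighbourhood of 0 for [h] that serves all [t] at once. *)
  have : \forall h \near (0 : V), `[0, 1] `<=`
      (fun t : R => `|F (t *: x + t *: h) - F (t *: x) - 'D_(t *: h) F (t *: x)| <= eps%:num * `|t *: h|).
    move: (@segment_compact R 0 1); rewrite compact_near_coveringP.
    move=> /(_ V (nbhs (0 : V)) (fun h t => `|F (t *: x + t *: h) - F (t *: x) - 'D_(t *: h) F (t *: x)| <= eps%:num * `|t *: h|)); apply => t _.
    have [[A B] /= [Ax B0] AB] := C1_strict_differentiable (t *: x) sF (gt0 eps).
    have tA : \forall t' \near t & h \near (0 : V), A (t' *: x).
      have : (fun z : R * V => z.1 *: x) @ (t, 0 : V) --> t *: x.
        by apply: cvgZr_tmp; exact: cvg_fst.
      by move=> /(_ _ Ax).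
    have tB : \forall t' \near t & h \near (0 : V), B (t' *: h).
      have : (fun z : R * V => z.1 *: z.2) @ (t, 0 : V) --> t *: (0 : V).
        by apply: cvgZ; [exact: cvg_fst|exact: cvg_snd].
      by rewrite scaler0 => /(_ _ B0).
    by apply: filterS (filterI tA tB) => -[t' h] [/= At Bt]; exact: (AB (t' *: x, t' *: h)).
  apply: filterS => h hP.
  rewrite -![(_ + _ : _ -> _) _]/(_ + _) -![(- _ : _ -> _) _]/(- _) /=.
  rewrite opprD addrA.
  have -> : radial_mean k F (h + x) - cst (radial_mean k F x) h - L h =
      \int[mu]_(t in `[0, 1]) (t ^+ k * (F (t *: x + t *: h) - F (t *: x) - 'D_(t *: h) F (t *: x))).
    rewrite LE /radial_mean /cst.
    rewrite -RintegralB//; [|by apply/integrable_unit/radial_continuous..].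
    rewrite -RintegralB//; last 2 first.
    - by apply: integrable_unit => t; apply: cvgB; exact: radial_continuous.
    - exact/integrable_unit/(@radial_continuous (fun y => 'D_h F y) x k.+1 (cF h)).
    apply: eq_Rintegral => t _; rewrite -mulrBr scalerDr [_ *: h + _]addrC.
    have -> : 'D_(t *: h) F (t *: x) = t * 'D_h F (t *: x).
      by rewrite !deriveE ?linearZ//; exact: dF.
    by rewrite exprSr -mulrA -mulrBr.
  apply: unit_integral_bound.
    have cD : continuous (fun t : R => t ^+ k * F (t *: (x + h)) - t ^+ k * F (t *: x) - t ^+ k.+1 * 'D_h F (t *: x)).
      move=> t; apply: cvgB; [apply: cvgB; exact: radial_continuous|exact: (@radial_continuous (fun y => 'D_h F y) x k.+1 (cF h))].
    rewrite (_ : (fun _ => _) = (fun t : R => t ^+ k * F (t *: (x + h)) - t ^+ k * F (t *: x) - t ^+ k.+1 * 'D_h F (t *: x))) //.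
    apply/funext => t; rewrite scalerDr.
    have -> : 'D_(t *: h) F (t *: x) = t * 'D_h F (t *: x).
      by rewrite !deriveE ?linearZ//; exact: dF.
    by rewrite exprSr -mulrA -!mulrBr.
  move=> t t01; have /andP[t0 t1] := t01.
  rewrite normrM ger0_norm ?exprn_ge0//.
  apply: (@le_trans _ _ (1 * (eps%:num * `|t *: h|))).
    apply: ler_pM => //; first exact: exprn_ge0.
      exact: exprn_ile1.
    by apply: hP; rewrite /= in_itv.
  rewrite mul1r ler_wpM2l// normrZ ger0_norm// ler_piMl//.
have dE := diff_unique cL fL.
have dd : differentiable (radial_mean k F) x by apply/diff_locallyP; rewrite dE.
split=> // v; rewrite deriveE//.
by move: (congr1 (fun f => f v) dE) => /= ->; rewrite -LE.
Qed.

Lemma radial_mean_smooth k F : Cinfty setT F -> Cinfty setT (radial_mean k F).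
Proof.
move=> sF l; elim: l k F sF => [|l IHl] k F sF.
  by move=> x _; apply: differentiable_continuous; have [] := @radial_mean_diff k F x (sF 1).
split=> [x _|v]; first by have [] := @radial_mean_diff k F x (sF 1).
apply: (@Ck_eq _ _ l setT (radial_mean k.+1 (fun y => 'D_v F y))); first exact: openT.
  by move=> x _; have [_ ->] := @radial_mean_diff k F x (sF 1).
exact/IHl/Cinfty_derive.
Qed.

Lemma Cinfty_coord (U : set V) i j : Cinfty U (fun x : V => x i j).
Proof.
pose f : V -> R := fun x => x i j.
have lf : linear f by move=> c u v; rewrite /f !mxE.
pose fm := GRing.isLinear.Build R V R _ f lf.
pose fl : {linear V -> R} := HB.pack f fm.
apply: (@Cinfty_linear _ _ U fl) => x; exact: coord_continuous.
Qed.

Lemma Cinfty_compmx (W : normedModType R) (U : set W) (U' : set V)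
    (Phi : W -> V) F : open U ->
  (forall i j, Cinfty U (fun w => Phi w i j)) -> Cinfty U' F ->
  (forall w, U w -> U' (Phi w)) -> Cinfty U (fun w => F (Phi w)).
Proof.
move=> oU sPhi sF UU'.
have PhiE w : \sum_(ij : 'I_m * 'I_n) Phi w ij.1 ij.2 *: e ij.1 ij.2 = Phi w.
  by rewrite [RHS]matrix_sum_delta pair_big.
apply: (@Cinfty_eq _ _ U (fun w => F (\sum_(ij : 'I_m * 'I_n) Phi w ij.1 ij.2 *: e ij.1 ij.2))) => //.
  by move=> w _; rewrite PhiE.
apply: (@Cinfty_comp _ _ _ _ (fun ij => e ij.1 ij.2) (fun ij w => Phi w ij.1 ij.2) U U') => //.
by move=> w Ux; rewrite PhiE; exact: UU'.
Qed.

Lemma derive_line F h t : differentiable F (t *: h) ->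
  is_derive (t : R^o) (1 : R^o) (fun t : R^o => F (t *: h) : R^o) ('D_h F (t *: h)).
Proof.
move=> dF; have dd : differentiable (fun t : R^o => t *: h) (t : R^o).
  exact: (@differentiableZl _ _ _ (fun t : R^o => t : R^o) h).
apply: DeriveDef.
  exact/diff_derivable/(@differentiable_comp _ _ _ _ (fun t : R^o => t *: h) F).
rewrite deriveE; last exact: (@differentiable_comp _ _ _ _ (fun t : R^o => t *: h) F).
rewrite (@diff_comp _ _ _ _ (fun t : R^o => t *: h) F)//=.
rewrite (@diffZl _ _ _ (fun t : R^o => t : R^o) h)// diff_val/= scale1r.
by rewrite deriveE.
Qed.

(** [K i j] is the mean over [0, 1] of the partial derivative at a + t (x - a); the identity is the
    fundamental theorem of calculus along the segment from [a] to [x]. *)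
Lemma Hadamard F a : Cinfty setT F -> exists K : 'I_m -> 'I_n -> V -> R,
  (forall i j, Cinfty setT (K i j)) /\
  forall x, F x - F a = \sum_i \sum_j (x i j - a i j) * K i j x.
Proof.
move=> sF; pose G y := F (y + a).
have sG : Cinfty setT G.
  apply: (@Cinfty_compmx _ setT setT (fun y : V => y + a)) => //; first exact: openT.
  move=> i j; apply: (@Cinfty_eq _ _ setT (fun y : V => y i j + a i j)); first exact: openT.
    by move=> y _; rewrite mxE.
  by apply: CinftyD; [exact: openT|exact: Cinfty_coord|exact: Cinfty_cst].
exists (fun i j x => radial_mean 0 (fun y => 'D_(e i j) G y) (x - a)); split.
  move=> i j; apply: (@Cinfty_compmx _ setT setT (fun x : V => x - a)); [exact: openT| | |by []].
    move=> k l; apply: (@Cinfty_eq _ _ setT (fun x : V => x k l + - a k l)); first exact: openT.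
      by move=> x _; rewrite !mxE.
    by apply: CinftyD; [exact: openT|exact: Cinfty_coord|exact: Cinfty_cst].
  exact/radial_mean_smooth/Cinfty_derive.
move=> x; pose h := x - a.
have dG y : differentiable G y by exact: (Cinfty_differentiable sG).
have cG v : Ck 0 setT (fun y => 'D_v G y) by exact: (Cinfty_derive v sG 0).
have cont ij := @radial_continuous (fun y => 'D_(e ij.1 ij.2) G y) h 0 (cG (e ij.1 ij.2)).
have -> : F x - F a = G (1 *: h) - G (0 *: h).
  by rewrite /G /h scale1r scale0r subrK add0r.
have cD : continuous (fun t : R => 'D_h G (t *: h)).
  have := @radial_continuous (fun y => 'D_h G y) h 0 (cG h).
  by rewrite (_ : (fun t => _) = (fun t : R => 'D_h G (t *: h)))//; apply/funext => t; rewrite expr0 mul1r.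
rewrite -(unit_integral_FTC cD (fun t => derive_line (dG (t *: h)))).
under eq_Rintegral.
  move=> t _; rewrite derive_coord// pair_big/=.
  under eq_bigr do rewrite -[X in _ * X]mul1r -[X in _ * (X * _)](expr0 t).
  over.
rewrite (@unit_integral_sum R _ _ (fun ij => h ij.1 ij.2)
    (fun ij (t : R) => t ^+ 0 * 'D_(e ij.1 ij.2) G (t *: h)))//.
rewrite pair_big; apply: eq_bigr => -[i j] _ /=.
by rewrite /h !mxE.
Qed.

End Hadamard.

(** * Smooth functions of one real variable *)

Section RealLine.
Variable R : realType.
Implicit Types (D : set R) (f g : R -> R) (u : R).

(** Smoothness by bootstrapping: the inverse, the inverse square root and the functions [flat n]
    have derivatives that are polynomials in functions of the same kind, so each order of
    differentiability yields the next. *)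
Lemma Ck_antiderivative k D f g : open D ->
  (forall u, D u -> is_derive (u : R^o) (1 : R^o) (f : R^o -> R^o) (g u)) ->
  Ck k (D : set R^o) (g : R^o -> R) -> Ck k.+1 (D : set R^o) (f : R^o -> R).
Proof.
move=> oD df cg; split=> [u Du|v].
  by apply/derivable1_diffP; have [] := df u Du.
apply: (@Ck_eq _ R^o k D (fun u => v * g u)) => //.
  move=> u Du; have [dfu <-] := df u Du.
  have dif : differentiable (f : R^o -> R^o) (u : R^o) by apply/derivable1_diffP.
  rewrite !(@deriveE _ R^o R^o)// -[in RHS](mulr1 v).
  by rewrite -[v * 1]/(v *: (1 : R^o)) linearZ.
apply: (@CkM _ R^o k D (cst v) g) => //; exact: Ck_cst.
Qed.

Lemma is_derive_inv u : u != 0 ->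
  is_derive (u : R^o) (1 : R^o) (fun u : R^o => u^-1 : R^o) (- (u^-1 * u^-1)).
Proof.
move=> u0; apply: DeriveDef; first exact: (@derivableV R R^o id).
by rewrite (@deriveV R R^o id)// derive_id /GRing.scale/= mulr1 expr2 invfM.
Qed.

Lemma Cinfty_inv : Cinfty ([set u | u != 0] : set R^o) (fun u : R^o => u^-1 : R).
Proof.
have oD : open ([set u | u != 0] : set R^o) by exact: open_neq.
elim=> [|k IHk] //.
  by move=> u u0; exact: cvgV.
apply: (@Ck_antiderivative k _ (fun u => u^-1) (fun u => - 1 * (u^-1 * u^-1))) => //.
  by move=> u u0; rewrite mulN1r; exact: is_derive_inv.
apply: (@CkM _ R^o k _ (cst (-1)) (fun u => u^-1 * u^-1)) => //; first exact: Ck_cst.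
exact: (@CkM _ R^o k _ (fun u => u^-1) (fun u => u^-1)).
Qed.

Lemma Cinfty_inv_sqrt : Cinfty ([set u | 0 < u] : set R^o) (fun u : R^o => (Num.sqrt u)^-1 : R).
Proof.
have oD : open ([set u | 0 < u] : set R^o) by exact: open_gt.
have der u : 0 < u -> is_derive (u : R^o) (1 : R^o) (fun u => (Num.sqrt u)^-1 : R^o)
    (- (2^-1) * ((Num.sqrt u)^-1 * ((Num.sqrt u)^-1 * (Num.sqrt u)^-1))).
  move=> u0; have s0 : Num.sqrt u != 0 by rewrite gt_eqF// sqrtr_gt0.
  have := @is_derive1_comp R GRing.inv Num.sqrt u _ _ (is_derive_inv s0) (is_derive1_sqrt u0).
  by move=> H; apply: (is_derive_eq H); rewrite invfM; ring.
elim=> [|k IHk].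
  by move=> u u0; apply: differentiable_continuous; apply/derivable1_diffP; have [] := der u u0.
apply: (@Ck_antiderivative k _ _ (fun u => - (2^-1) * ((Num.sqrt u)^-1 * ((Num.sqrt u)^-1 * (Num.sqrt u)^-1)))) => //.
apply: (@CkM _ R^o k _ (cst (- (2^-1)))) => //; first exact: Ck_cst.
apply: (@CkM _ R^o k _ (fun u => (Num.sqrt u)^-1)) => //.
exact: (@CkM _ R^o k _ (fun u => (Num.sqrt u)^-1)).
Qed.

(** The standard function exp (- 1 / u), flat at 0, with factors u^-n added so that the family is
    closed under differentiation. *)
Definition flat n u : R := if 0 < u then (u^-1) ^+ n * expR (- u^-1) else 0.

(** The exponential at 1 / u exceeds its Taylor term of order n + 1. Used at index [n.+1], the bound
    makes the difference quotient of [flat n] at 0 tend to 0. *)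
Lemma flat_bound n u : 0 <= u -> flat n u <= n.+1`!%:R * u.
Proof.
rewrite le_eqVlt /flat => /predU1P[<-|u0]; first by rewrite ltxx mulr0.
rewrite u0 expRN ler_pdivrMr ?expR_gt0// mulrAC -ler_pdivrMr//.
rewrite -exprSr.
have := @expR_ge1Dxn R u^-1 n; rewrite invr_ge0 (ltW u0) => /(_ isT).
move=> /(le_trans _) H; rewrite mulrC -ler_pdivrMr ?ltr0n ?fact_gt0//.
by apply: H; rewrite lerDr.
Qed.

Lemma flat_ge0 n u : 0 <= flat n u.
Proof. by rewrite /flat; case: ifPn => // u0; rewrite mulr_ge0 ?expR_ge0// exprn_ge0// invr_ge0 ltW. Qed.

Lemma is_derive_flat n u :
  is_derive (u : R^o) (1 : R^o) (flat n : R^o -> R^o) (flat n.+2 u - n%:R * flat n.+1 u).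
Proof.
have [u0|u0|->] := ltgtP u 0.
- have f0 m : flat m u = 0 by rewrite /flat ltNge ltW.
  rewrite !f0 mulr0 subr0.
  have H : \forall x \near (u : R^o), (cst 0 : R^o -> R^o) x = flat n x.
    have : \forall x \near u, x < 0 by exact: lt_nbhsl.
    by apply: filterS => x x0; rewrite /flat ltNge ltW.
  exact: (near_eq_is_derive H (is_derive_cst (0 : R^o) (u : R^o) (1 : R^o))).
- have H : \forall x \near (u : R^o), ((fun x => (x^-1) ^+ n * expR (- x^-1)) : R^o -> R^o) x = flat n x.
    have : \forall x \near u, 0 < x by exact: lt_nbhsr.
    by apply: filterS => x x0; rewrite /flat x0.
  apply: (near_eq_is_derive H).
  have un0 : u != 0 by rewrite gt_eqF.
  have dV : is_derive (u : R^o) (1 : R^o) (fun x : R^o => x^-1 : R^o) (- u ^- 2).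
    by rewrite expr2 invfM; exact: is_derive_inv.
  have dE : is_derive (u : R^o) (1 : R^o) (fun x : R^o => expR (- x^-1) : R^o) (u ^- 2 * expR (- u^-1)).
    have := @is_derive1_comp R expR (fun x => - x^-1) u _ _ (is_derive_expR (- u^-1)) (is_deriveN dV).
    by rewrite opprK mulrC.
  have dX m : is_derive (u : R^o) (1 : R^o) (fun x : R^o => (x^-1) ^+ m : R^o) (- m%:R * (u^-1) ^+ m.+1).
    have := @is_deriveX R R^o (fun x : R^o => x^-1) m u 1 _ dV.
    rewrite exprfctE; case: m => [|m] H'; apply: (is_derive_eq H'); first by rewrite !mul0r oppr0 mul0r scale0r.
    by rewrite /GRing.scale/= -!exprVn !exprS; ring.
  have := @is_deriveM R R^o _ _ u 1 _ _ (dX n) dE.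
  move=> H'; apply: (is_derive_eq H'); rewrite /GRing.scale/= /flat u0 -!exprVn !exprS; ring.
- have f0 m : flat m 0 = 0 by rewrite /flat ltxx.
  rewrite !f0 mulr0 subr0.
  suff H : (fun h => h^-1 *: (((flat n : R^o -> R^o) \o shift 0) (h *: (1 : R^o)) - flat n 0)) @ 0^' --> (0 : R^o).
    apply: DeriveDef; first by apply/cvg_ex; exists 0.
    exact: cvg_lim H.
  apply/cvgrPdist_le => /= eps eps0.
  have c0 : 0 < n.+2`!%:R :> R by rewrite ltr0n fact_gt0.
  near=> h.
  have h0 : h != 0 by near: h; exact: nbhs_dnbhs_neq.
  rewrite /= f0 subr0 addr0 sub0r normrN /GRing.scale/= mulr1.
  have [hp|hn] := ltP 0 h; last by rewrite /flat ltNge hn/= mulr0 normr0 ltW.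
  have -> : h^-1 * flat n h = flat n.+1 h by rewrite /flat hp mulrA exprS.
  rewrite ger0_norm ?flat_ge0//; apply: le_trans (flat_bound _ (ltW hp)) _.
  rewrite mulrC -ler_pdivlMr//; apply: le_trans (ler_norm h) _.
  near: h; apply: nbhs_dnbhs; exact: (@nbhs0_le R R^o (eps / n.+2`!%:R) (divr_gt0 eps0 c0)).
Unshelve. all: by end_near. Qed.

Lemma Cinfty_flat n : Cinfty (setT : set R^o) (flat n : R^o -> R).
Proof.
move=> k; elim: k n => [|k IHk] n.
  by move=> u _; apply: differentiable_continuous; apply/derivable1_diffP; have [] := is_derive_flat n u.
have oT : open (setT : set R^o) by exact: openT.
apply: (@Ck_antiderivative k setT (flat n) (fun u => flat n.+2 u + - n%:R * flat n.+1 u)) => //.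
  by move=> u _; rewrite mulNr; exact: is_derive_flat.
apply: (@CkD _ R^o k setT (flat n.+2)) => //.
by apply: (@CkM _ R^o k setT (cst (- n%:R))) => //; exact: Ck_cst.
Qed.

End RealLine.

(** * Cutoff functions *)

Section Cutoff.
Variables (R : realType) (m n : nat).
Local Notation V := 'M[R]_(m, n).

Lemma Cinfty_cutoff (F : V -> R) (a : V) r : 0 < r -> Cinfty (ball a r) F ->
  exists chi : V -> R, [/\ Cinfty setT chi, chi a = 1,
    Cinfty setT (fun x => chi x * F x) &
    forall x, ~ ball a r x -> chi x = 0].
Proof.
move=> r0 sF; have oT : open (setT : set V) by exact: openT.
(* The norm is the maximum norm, which is not smooth; the squared Euclidean distance [q] is smooth
   and dominates its square. Hence [chi] vanishes wherever the norm of x - a is at least r / 2, well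
   inside the ball. *)
pose rho : R := (r / 2) ^+ 2.
have r20 : 0 < r / 2 by rewrite divr_gt0.
have rho0 : 0 < rho by rewrite exprn_gt0.
pose q (x : V) : R := \sum_i \sum_j (x i j - a i j) * (x i j - a i j).
have sq : Cinfty setT q.
  apply: Cinfty_sum => // i; apply: Cinfty_sum => // j.
  by apply: CinftyM => //; (apply: CinftyD => //; [exact: Cinfty_coord|exact: Cinfty_cst]).
pose c := (flat 0 rho)^-1.
have frho : flat 0 rho != 0 by rewrite /flat rho0 expr0 mul1r gt_eqF// expR_gt0.
pose chi x := c * flat 0 (rho - q x).
have schi : Cinfty setT chi.
  apply: CinftyM => //; first exact: Cinfty_cst.
  apply: (@Cinfty_comp1 _ _ setT setT (fun x => rho + - q x) (flat 0)) => //.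
    by apply: CinftyD => //; [exact: Cinfty_cst|exact: CinftyN].
  exact: Cinfty_flat.
have q_ge (x : V) : r / 2 <= `|x - a| -> rho <= q x.
  rewrite {1}/Num.norm/= mx_normrE => H.
  have [[i j] _ ij] : exists2 ij : 'I_m * 'I_n, true & r / 2 <= `|(x - a) ij.1 ij.2|.
    apply: contrapT => nex; move: H; rewrite leNgt => /negP; apply.
    apply: bigmax_lt => // ij _; rewrite ltNge; apply/negP => H; apply: nex.
    by exists ij.
  rewrite /= !mxE in ij.
  have sq0 i' j' : 0 <= (x i' j' - a i' j') * (x i' j' - a i' j') by rewrite -expr2 sqr_ge0.
  rewrite /q (bigD1 i)//= (bigD1 j)//= -addrA ler_wpDr//.
    by rewrite addr_ge0// ?sumr_ge0// => k _; rewrite ?sumr_ge0.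
  by rewrite -expr2 -[leRHS]real_normK ?num_real// /rho lerXn2r// nnegrE ?ltW// (le_trans (ltW r20)).
have chi_out (x : V) : r / 2 <= `|x - a| -> chi x = 0.
  by move=> /q_ge qr; rewrite /chi /flat subr_gt0 ltNge qr mulr0.
exists chi; split=> //.
- rewrite /chi (_ : q a = 0) ?subr0 ?mulVf// /q big1// => i _.
  by rewrite big1// => j _; rewrite subrr mulr0.
- have -> : setT = ball a r `|` [set x : V | r / 2 < `|x - a|].
    apply/esym/seteqP; split=> // x _.
    have [xr|xr] := ltP `|x - a| r; [left|right].
      by rewrite -ball_normE /ball_/= distrC.
    by rewrite /=; apply: lt_le_trans xr; rewrite ltr_pdivrMr// ltr_pMr// ltr1n.
  have oB : open (ball a r) by exact: ball_open.
  apply: CinftyU.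
    by apply: CinftyM => //; exact: (@Cinfty_subset _ _ setT).
  apply: (@Cinfty_eq _ _ _ (fun=> 0)); last exact: Cinfty_cst.
    rewrite (_ : [set x : V | _] = (fun x => `|x - a|) @^-1` [set u : R | r / 2 < u])//.
    apply: open_comp; last exact: open_gt.
    move=> x _; have H : (fun y : V => y - a) @ x --> x - a.
      apply: (@cvgD R V _ (nbhs x) _ id (fun=> - a)); first exact: cvg_id.
      exact: cvg_cst.
    exact: (cvg_norm H).
  by move=> x /= xr; rewrite chi_out ?mul0r// ltW.
- move=> x; rewrite -ball_normE /ball_/= distrC => /negP; rewrite -leNgt => rx.
  by apply: chi_out; apply: le_trans rx; rewrite ler_pdivrMr// ler_pMr// ler1n.
Qed.

End Cutoff.

(** * Smooth matrix-valued maps *)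

Section SmoothMatrices.
Variables (R : realType) (V : normedModType R).
Implicit Types U : set V.

Definition Cinfty_mx m n U (Phi : V -> 'M[R]_(m, n)) :=
  forall i j, Cinfty U (fun x => Phi x i j).

Lemma Cinfty_mx_cst m n U (A : 'M[R]_(m, n)) : Cinfty_mx U (fun=> A).
Proof. by move=> i j; exact: Cinfty_cst. Qed.

Lemma Cinfty_mx_eq m n U (Phi Psi : V -> 'M[R]_(m, n)) : open U ->
  (forall x, U x -> Phi x = Psi x) -> Cinfty_mx U Phi -> Cinfty_mx U Psi.
Proof.
by move=> oU e sPhi i j; apply: Cinfty_eq (sPhi i j) => // x Ux; rewrite e.
Qed.

Lemma Cinfty_mx_subset m n U U' (Phi : V -> 'M[R]_(m, n)) : U' `<=` U ->
  Cinfty_mx U Phi -> Cinfty_mx U' Phi.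
Proof. by move=> sU sPhi i j; exact: Cinfty_subset (sPhi i j). Qed.

Lemma Cinfty_mxD m n U (Phi Psi : V -> 'M[R]_(m, n)) : open U ->
  Cinfty_mx U Phi -> Cinfty_mx U Psi -> Cinfty_mx U (fun x => Phi x + Psi x).
Proof.
move=> oU sPhi sPsi i j; apply: Cinfty_eq (CinftyD oU (sPhi i j) (sPsi i j)) => //.
by move=> x _; rewrite mxE.
Qed.

Lemma Cinfty_mxN m n U (Phi : V -> 'M[R]_(m, n)) : open U ->
  Cinfty_mx U Phi -> Cinfty_mx U (fun x => - Phi x).
Proof.
move=> oU sPhi i j; apply: Cinfty_eq (CinftyN oU (sPhi i j)) => //.
by move=> x _; rewrite mxE.
Qed.

Lemma Cinfty_mxZ m n U (f : V -> R) (Phi : V -> 'M[R]_(m, n)) : open U ->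
  Cinfty U f -> Cinfty_mx U Phi -> Cinfty_mx U (fun x => f x *: Phi x).
Proof.
move=> oU sf sPhi i j; apply: Cinfty_eq (CinftyM oU sf (sPhi i j)) => //.
by move=> x _; rewrite mxE.
Qed.

Lemma Cinfty_mxM m n k U (Phi : V -> 'M[R]_(m, n)) (Psi : V -> 'M[R]_(n, k)) :
  open U -> Cinfty_mx U Phi -> Cinfty_mx U Psi ->
  Cinfty_mx U (fun x => Phi x *m Psi x).
Proof.
move=> oU sPhi sPsi i j.
apply: (@Cinfty_eq _ _ U (fun x => \sum_k Phi x i k * Psi x k j)) => //.
  by move=> x _; rewrite mxE.
by apply: Cinfty_sum => // l; exact: CinftyM.
Qed.

Lemma Cinfty_mx_tr m n U (Phi : V -> 'M[R]_(m, n)) : open U ->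
  Cinfty_mx U Phi -> Cinfty_mx U (fun x => (Phi x)^T).
Proof.
move=> oU sPhi i j; apply: Cinfty_eq (sPhi j i) => //.
by move=> x _; rewrite mxE.
Qed.

Lemma Cinfty_prod U (I : Type) (r : seq I) (F : I -> V -> R) : open U ->
  (forall i, Cinfty U (F i)) -> Cinfty U (fun x => \prod_(i <- r) F i x).
Proof.
move=> oU sF; elim: r => [|i r IHr].
  by apply: Cinfty_eq (Cinfty_cst U 1) => // x _; rewrite big_nil.
apply: Cinfty_eq (CinftyM oU (sF i) IHr) => // x _.
by rewrite big_cons.
Qed.

Lemma Cinfty_det n U (Phi : V -> 'M[R]_n) : open U ->
  Cinfty_mx U Phi -> Cinfty U (fun x => \det (Phi x)).
Proof.
move=> oU sPhi; apply: Cinfty_sum => // s.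
by apply: CinftyM => //; [exact: Cinfty_cst|apply: Cinfty_prod => // i].
Qed.

Lemma Cinfty_invmx n U (Phi : V -> 'M[R]_n) : open U ->
  (forall x, U x -> \det (Phi x) != 0) ->
  Cinfty_mx U Phi -> Cinfty_mx U (fun x => invmx (Phi x)).
Proof.
move=> oU dPhi sPhi.
apply: (@Cinfty_mx_eq _ _ U (fun x => (\det (Phi x))^-1 *: \adj (Phi x))) => //.
  by move=> x Ux; rewrite /invmx unitmxE unitfE dPhi.
apply: Cinfty_mxZ => //.
  by apply: (@Cinfty_comp1 _ _ U [set u | u != 0]) => //;
    [exact: Cinfty_det|exact: Cinfty_inv].
move=> i j; apply: (@Cinfty_eq _ _ U (fun x => (-1) ^+ (j + i) * \det (row' j (col' i (Phi x))))) => //.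
  by move=> x _; rewrite !mxE.
apply: CinftyM => //; first exact: Cinfty_cst.
apply: Cinfty_det => // k l; apply: Cinfty_eq (sPhi (lift j k) (lift i l)) => //.
by move=> x _; rewrite !mxE.
Qed.

Lemma Cinfty_mx_continuous m n U (Phi : V -> 'M[R]_(m, n)) x :
  Cinfty_mx U Phi -> U x -> {for x, continuous Phi}.
Proof.
move=> sPhi Ux.
rewrite (_ : Phi = fun x => \sum_(ij : 'I_m * 'I_n) Phi x ij.1 ij.2 *: delta_mx ij.1 ij.2).
  have [] := @differentiable_lincomb _ V 'M[R]_(m, n) _
    (fun ij : 'I_m * 'I_n => delta_mx ij.1 ij.2)
    (fun ij x => Phi x ij.1 ij.2) (index_enum _) x.
    by move=> ij; exact: Cinfty_differentiable (sPhi ij.1 ij.2) Ux.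
  by move=> d _; exact: differentiable_continuous.
by apply/funext => y; rewrite [LHS]matrix_sum_delta pair_big.
Qed.

End SmoothMatrices.

Lemma Cinfty_mx_id (R : realType) m n (U : set 'M[R]_(m, n)) : Cinfty_mx U id.
Proof. by move=> i j; exact: Cinfty_coord. Qed.

(** * The indefinite orthogonal group and the isotropy group *)

Section Adjoint.
Variables (C : comPzRingType) (n : nat) (S : 'M[C]_n).
Hypotheses (Str : S^T = S) (SS : S *m S = 1%:M).
Implicit Types A B : 'M[C]_n.

(** The adjoint for the bilinear form [S], which is its own inverse; on the orthogonal group of [S]
    it is the inversion. The lock keeps conversion from unfolding the products. *)
Fact adjointmx_key : unit. Proof. exact: tt. Qed.
Definition adjointmx := locked_with adjointmx_key (fun B => S *m B^T *m S).

Lemma adjointmxE B : adjointmx B = S *m B^T *m S.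
Proof. by rewrite /adjointmx unlock. Qed.

Lemma adjointmxK B : adjointmx (adjointmx B) = B.
Proof.
rewrite !adjointmxE !trmx_mul trmxK Str !mulmxA SS mul1mx -mulmxA SS.
by rewrite mulmx1.
Qed.

Lemma adjointmx_is_linear : linear adjointmx.
Proof. by move=> c A B; rewrite !adjointmxE linearP/= mulmxDr mulmxDl -scalemxAr -scalemxAl. Qed.

HB.instance Definition _ := GRing.isLinear.Build C 'M[C]_n 'M[C]_n _ adjointmx adjointmx_is_linear.

Lemma adjointmxM A B : adjointmx (A *m B) = adjointmx B *m adjointmx A.
Proof.
rewrite !adjointmxE trmx_mul !mulmxA.
by rewrite -[in RHS](mulmxA _ S S) SS mulmx1.
Qed.

Lemma adjointmx1 : adjointmx 1%:M = 1%:M.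
Proof. by rewrite !adjointmxE trmx1 mulmx1. Qed.

Lemma mxtrace_adjoint B : \tr (adjointmx B) = \tr B.
Proof. by rewrite !adjointmxE mxtrace_mulC mulmxA SS mul1mx mxtrace_tr. Qed.

End Adjoint.

Section IndefiniteOrthogonalGroup.
Variables (R : realType) (m q : nat).
Local Notation V := 'M[R]_(m + q).
Local Notation S := (signature_form R m q).
Local Notation O := (indefinite_O R m q).
Local Notation G := (indefinite_SO0 R m q).
Local Notation adj := (adjointmx S).
Implicit Types (g h B : V).

Lemma signature_form_tr : S^T = S.
Proof. by rewrite /signature_form tr_block_mx !trmx0 linearN/= !trmx1. Qed.

Lemma signature_formK : S *m S = 1%:M.
Proof.
rewrite /signature_form mulmx_block !mul0mx !mulmx0 !addr0 !add0r mulmx1.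
by rewrite mulNmx mulmxN opprK mulmx1 -scalar_mx_block.
Qed.
Local Notation Str := signature_form_tr.
Local Notation SS := signature_formK.

Lemma indefinite_OP g : O g <-> adj g *m g = 1%:M.
Proof.
rewrite /indefinite_O !adjointmxE /=; split=> [Og|Og].
  by rewrite -!mulmxA (mulmxA g^T) Og SS.
by have := congr1 (mulmx S) Og; rewrite !mulmxA SS mul1mx mulmx1.
Qed.

Lemma indefinite_O1 : O 1%:M.
Proof. by apply/indefinite_OP; rewrite adjointmx1 ?SS// mulmx1. Qed.

Lemma indefinite_OM g h : O g -> O h -> O (g *m h).
Proof.
move=> /indefinite_OP Og /indefinite_OP Oh; apply/indefinite_OP.
by rewrite adjointmxM ?SS// -mulmxA (mulmxA _ g) Og mul1mx.
Qed.

Lemma SO0_O g : G g -> O g. Proof. exact: connected_component_sub. Qed.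

Lemma SO0_1 : G 1%:M. Proof. exact: connected_component_refl indefinite_O1. Qed.

Lemma SO0_adjK g : G g -> g *m adj g = 1%:M.
Proof. by move=> /SO0_O/indefinite_OP Og; exact: mulmx1C. Qed.

Definition cayley B : V := invmx (1%:M - B) *m (1%:M + B).

(** For a skew B, [adj] exchanges 1 - B and 1 + B, and these commute. *)
Lemma cayley_O B : adj B = - B -> \det (1%:M - B) != 0 -> O (cayley B).
Proof.
move=> Bs dB; apply/indefinite_OP.
have uP : 1%:M - B \in unitmx by rewrite unitmxE unitfE.
have PQ : (1%:M - B) *m (1%:M + B) = (1%:M + B) *m (1%:M - B).
  by rewrite !(mulmxDl, mulmxDr, mulmxN, mulNmx, mul1mx, mulmx1) addrACA.
have aP : adj (1%:M - B) = 1%:M + B by rewrite linearB/= adjointmx1 ?SS// Bs opprK.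
have aQ : adj (1%:M + B) = 1%:M - B by rewrite linearD/= adjointmx1 ?SS// Bs.
set P := 1%:M - B in PQ aP aQ uP *; set Q := 1%:M + B in PQ aP aQ *.
have QW : Q *m adj (invmx P) = 1%:M.
  by rewrite -aP -adjointmxM ?SS// mulVmx// adjointmx1 ?SS.
rewrite /cayley -/P -/Q adjointmxM ?SS// aQ.
have WQ := mulmx1C QW; set W := adj _ in QW WQ *.
have PW : P *m W = W *m P.
  by rewrite -[LHS]mul1mx -WQ -!mulmxA (mulmxA Q P) -PQ -(mulmxA P) QW mulmx1.
by rewrite PW -mulmxA (mulmxA P) mulmxV// mul1mx.
Qed.

Lemma det_near1 : exists2 r : R, 0 < r &
  forall B : V, `|B| < r -> \det (1%:M - B) != 0.
Proof.
have sd : Cinfty setT (fun B : V => \det (1%:M - B)).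
  apply: Cinfty_det; first exact: openT.
  apply: (@Cinfty_mxD _ _ _ _ _ (cst 1%:M)); [exact: openT|exact: Cinfty_mx_cst|].
  by apply: (@Cinfty_mxN _ _ _ _ _ id); [exact: openT|exact: Cinfty_mx_id].
have cd : {for (0 : V), continuous (fun B : V => \det (1%:M - B))}.
  exact: (Cinfty_continuous sd).
have : \forall B \near (0 : V), \det (1%:M - B) != 0.
  apply: (cd [set u | u != 0]); apply: open_nbhs_nbhs; split; first exact: open_neq.
  by rewrite /= subr0 det1 oner_eq0.
move=> /nbhs_ballP[r r0 rP]; exists r => // B Br; apply: rP.
by rewrite -ball_normE /ball_/= sub0r normrN.
Qed.

Lemma Cinfty_cayley : Cinfty_mx [set B : V | \det (1%:M - B) != 0] cayley.
Proof.
have s1B (U : set V) (f : V -> V) : open U -> Cinfty_mx U f -> Cinfty_mx U (fun B : V => 1%:M + f B).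
  by move=> oU sf; apply: (@Cinfty_mxD _ _ _ _ _ (cst 1%:M)) => //; exact: Cinfty_mx_cst.
have sN U : open U -> Cinfty_mx U (fun B : V => 1%:M - B).
  by move=> oU; apply: s1B => //; apply: (@Cinfty_mxN _ _ _ _ _ id) => //; exact: Cinfty_mx_id.
have oU : open [set B : V | \det (1%:M - B) != 0].
  rewrite (_ : [set B : V | _] = (fun B : V => \det (1%:M - B)) @^-1` [set u | u != 0])//.
  apply: open_comp; last exact: open_neq.
  move=> B _; apply: (@Cinfty_continuous _ _ setT) => //.
  by apply: Cinfty_det; [exact: openT|apply: sN; exact: openT].
apply: Cinfty_mxM => //; first by apply: Cinfty_invmx => //; exact: sN.
by apply: (s1B _ id) => //; exact: Cinfty_mx_id.
Qed.

(** The path t |-> [cayley (t *: B) *m g] over [0, 1] stays in [O] and starts at [g], so its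
    endpoint lies in the same component. *)
Lemma cayley_SO0 : exists2 r : R, 0 < r & forall B g, `|B| < r ->
  adj B = - B -> G g -> G (cayley B *m g).
Proof.
have [r r0 rP] := det_near1; exists r => // B g Br Bs Gg.
apply: (connected_component_trans Gg).
pose f (t : R^o) : V := cayley (t *: B) *m g.
have tBr (t : R) : t \in `[0, 1] -> `|t *: B| < r.
  rewrite in_itv => /andP[t0 t1]; rewrite normrZ ger0_norm//.
  by apply: le_lt_trans Br; rewrite ler_piMl.
have Og := SO0_O Gg.
exists (f @` `[0, 1]); last first.
  by exists 1; rewrite /= ?in_itv/= ?ler01 ?lexx// /f scale1r.
split.
- exists 0; rewrite /= ?in_itv/= ?ler01 ?lexx// /f scale0r /cayley.
  by rewrite subr0 addr0 invmx1 !mul1mx.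
- move=> _ [t t01 <-]; apply: indefinite_OM Og; apply: cayley_O.
    by rewrite linearZ/= Bs scalerN.
  exact/rP/tBr.
apply: connected_continuous_connected; first exact: segment_connected.
apply: continuous_in_subspaceT => t; rewrite inE => t01.
have cB : {for t *: B, continuous cayley}.
  by apply: Cinfty_mx_continuous Cinfty_cayley _; exact/rP/tBr.
have cs : {for t, continuous (fun t : R^o => t *: B)}.
  by apply: cvgZr_tmp; exact: cvg_id.
have cc : {for t, continuous (fun t : R^o => cayley (t *: B))}.
  exact: (@continuous_comp _ _ _ (fun t : R^o => t *: B) cayley).
have cg : continuous (fun A : V => A *m g).
  move=> A; apply: (@Cinfty_mx_continuous _ _ _ _ setT) => //.
  by apply: (@Cinfty_mxM _ _ _ _ _ _ id); [exact: openT|exact: Cinfty_mx_id|exact: Cinfty_mx_cst].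
exact: (continuous_comp cc (cg _)).
Qed.

Lemma cayley_inv h : \det (1%:M + h) != 0 ->
  cayley ((h - 1%:M) *m invmx (1%:M + h)) = h.
Proof.
move=> d; have u : 1%:M + h \in unitmx by rewrite unitmxE unitfE.
set B := _ *m _; set Q := invmx _ in B *.
have e1 : (1%:M - B) *m (1%:M + h) = 2%:M.
  rewrite mulmxBl mul1mx /B -mulmxA mulVmx// mulmx1 opprB addrACA subrr addr0.
  by rewrite -raddfD.
have e2 : (1%:M + B) *m (1%:M + h) = 2 *: h.
  rewrite mulmxDl mul1mx /B -mulmxA mulVmx// mulmx1 [h - _]addrC addrACA subrr add0r.
  by rewrite -mulr2n scaler_nat.
have u2 : 1%:M - B \in unitmx.
  suff : (1%:M - B) *m (2^-1 *: (1%:M + h)) = 1%:M by move=> /mulmx1_unit[].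
  by rewrite -scalemxAr e1 scale_scalar_mx mulVf.
have e3 : 1%:M + B = (1%:M - B) *m h.
  have hQ : h *m (1%:M + h) = (1%:M + h) *m h by rewrite mulmxDr mulmxDl mulmx1 mul1mx.
  by apply: (can_inj (mulmxK u)); rewrite e2 -mulmxA hQ mulmxA e1 mul_scalar_mx.
by rewrite /cayley e3 mulmxA mulVmx// mul1mx.
Qed.

Lemma cayley_inv_skew h : O h -> \det (1%:M + h) != 0 ->
  adj ((h - 1%:M) *m invmx (1%:M + h)) = - ((h - 1%:M) *m invmx (1%:M + h)).
Proof.
move=> /indefinite_OP h'h d.
have u : 1%:M + h \in unitmx by rewrite unitmxE unitfE.
set Q := 1%:M + h in d u *; set h' := adj h in h'h.
have hh' := mulmx1C h'h.
have aQ : adj Q = h' *m Q.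
  by rewrite /Q linearD/= adjointmx1 ?SS// mulmxDr h'h mulmx1 addrC.
have WE : adj (invmx Q) = invmx Q *m h.
  have : adj Q *m (invmx Q *m h) = 1%:M by rewrite aQ mulmxA mulmxK.
  move=> /mulmx1C; have : adj (invmx Q) *m adj Q = 1%:M.
    by rewrite -adjointmxM ?SS// mulmxV// adjointmx1 ?SS.
  move=> e1 /mulmx1C e2.
  by rewrite -[LHS]mulmx1 -e2 mulmxA e1 mul1mx.
have cQ : invmx Q *m (h - 1%:M) = (h - 1%:M) *m invmx Q.
  apply: (can_inj (mulKmx u)); rewrite mulKVmx// mulmxA.
  have -> : Q *m (h - 1%:M) = (h - 1%:M) *m Q.
    by rewrite /Q mulmxDl mul1mx mulmxBr mulmx1 mulmxDr mulmx1 mulmxBl mul1mx.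
  by rewrite mulmxK.
rewrite adjointmxM ?SS// WE linearB/= adjointmx1 ?SS// -/h' -mulmxA mulmxBr hh' mulmx1.
by rewrite -cQ -mulmxN opprB.
Qed.

(** Near [g0] the matrix g g0^-1 is close to 1, hence the Cayley transform of a small skew matrix,
    and [cayley_SO0] applies. This is how the local section, built in [O], is seen to take values in
    [G]. *)
Lemma SO0_open g0 : G g0 -> \forall g \near g0, O g -> G g.
Proof.
move=> Gg0; have [r r0 rP] := cayley_SO0.
pose Q (g : V) := 1%:M + g *m adj g0.
pose B (g : V) := (g *m adj g0 - 1%:M) *m invmx (Q g).
have sg : Cinfty_mx setT (fun g : V => g *m adj g0).
  by apply: (@Cinfty_mxM _ _ _ _ _ _ id); [exact: openT|exact: Cinfty_mx_id|exact: Cinfty_mx_cst].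
have sQ : Cinfty_mx setT Q.
  by apply: Cinfty_mxD => //; [exact: openT|exact: Cinfty_mx_cst].
have cQ g : {for g, continuous (fun g : V => \det (Q g))}.
  apply: (@Cinfty_continuous _ _ setT) => //.
  by apply: Cinfty_det => //; exact: openT.
pose U := [set g : V | \det (Q g) != 0].
have oU : open U.
  rewrite (_ : U = (fun g : V => \det (Q g)) @^-1` [set u | u != 0])//.
  by apply: open_comp; [move=> g _; exact: cQ|exact: open_neq].
have Ug0 : U g0.
  rewrite /U /= /Q SO0_adjK// -raddfD/= det_scalar.
  by apply/expf_neq0/lt0r_neq0; rewrite addr_gt0.
have sB : Cinfty_mx U B.
  apply: Cinfty_mxM => //.
    apply: Cinfty_mxD => //; last exact: Cinfty_mx_cst.
    exact: (@Cinfty_mx_subset _ _ _ _ setT).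
  by apply: Cinfty_invmx => //; exact: (@Cinfty_mx_subset _ _ _ _ setT).
have B0 : B g0 = 0 by rewrite /B SO0_adjK// subrr mul0mx.
have cB : {for g0, continuous B} by exact: Cinfty_mx_continuous sB Ug0.
have nB : \forall g \near g0, `|B g| < r.
  have : \forall g \near g0, ball (0 : V) r (B g).
    by apply: cB; rewrite B0; exact: nbhsx_ballx.
  apply: filterS => g.
  by rewrite /= -ball_normE /ball_/= sub0r normrN.
have nU : \forall g \near g0, U g by exact: open_nbhs_nbhs.
apply: filterS (filterI nB nU) => g [Bg Ug] Og.
have -> : g = cayley (B g) *m g0.
  by rewrite /B cayley_inv// -mulmxA ((indefinite_OP g0).1 (SO0_O Gg0)) mulmx1.
apply: rP => //.
apply: cayley_inv_skew => //; apply: indefinite_OM => //.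
apply/indefinite_OP; rewrite adjointmxK ?SS ?Str//; exact: SO0_adjK.
Qed.

End IndefiniteOrthogonalGroup.

(** Conjugation by the unipotent block matrix with corner [i] makes the matrix block lower
    triangular. *)
Lemma det_complex_block (C : comPzRingType) p (i : C) (a c : 'M[C]_p) : i * i = -1 ->
  \det (block_mx a (- c) c a) = \det (a + i *: c) * \det (a - i *: c).
Proof.
move=> ii.
have e : block_mx 1%:M i%:M 0 1%:M *m block_mx a (- c) c a
   *m block_mx 1%:M (- i%:M) 0 1%:M = block_mx (a + i *: c) 0 c (a - i *: c).
  rewrite !mulmx_block; congr block_mx.
  - by rewrite mulmx0 addr0 mulmx1 mul1mx mul_scalar_mx.
  - rewrite mulmx1 !mul1mx !mul_scalar_mx mulmxN mul_mx_scalar scalerDr scalerA ii.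
    by apply/matrixP => k l; rewrite !mxE; ring.
  - by rewrite mul0mx mul1mx add0r mulmx0 addr0 mulmx1.
  - by rewrite !mul0mx !mul1mx !add0r mulmx1 mulmxN mul_mx_scalar addrC.
by rewrite -(det_lblock _ c) -e !det_mulmx !det_ublock !det1 !mul1r mulr1.
Qed.

Section Determinants.
Variable R : realType.

(** A matrix commuting with J is a complex matrix z = a + i c, and its real determinant is |det
    z|^2. *)
Lemma det_commute_J_ge0 p (A : 'M[R]_(p + p)) :
  A *m standard_J R p = standard_J R p *m A -> 0 <= \det A.
Proof.
rewrite -[A]submxK; move: (ulsubmx A) (ursubmx A) (dlsubmx A) (drsubmx A) => a b c d.
rewrite /standard_J !mulmx_block !mulmx0 !mul0mx !mulmx1 !mul1mx !add0r !addr0.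
rewrite !mulmxN !mulNmx !mulmx1 !mul1mx => /eq_block_mx[bE _ dE _].
rewrite bE dE; pose f := real_complex R.
pose ac := map_mx f a; pose cc := map_mx f c.
pose z : 'M[R[i]]_p := ac + 'i%C *: cc; pose w : 'M[R[i]]_p := ac - 'i%C *: cc.
have ii : 'i%C * 'i%C = -1 :> R[i] by rewrite -expr2 sqr_i.
have dw : \det w = (\det z)^*%C.
  rewrite -[RHS](det_map_mx (@conjc R)); congr (\det _); apply/matrixP => i j.
  rewrite !mxE rmorphD rmorphM /=; simpc.
  by rewrite /f /=; simpc.
have : f (\det (block_mx a (- c) c a)) = \det z * \det w.
  by rewrite -(det_complex_block _ _ ii) -map_mxN -map_block_mx det_map_mx.
rewrite dw; case: (\det z) => x y; rewrite /f; simpc => -[-> _].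
by rewrite addr_ge0 // -expr2 sqr_ge0.
Qed.

End Determinants.

Section DetSO0.
Variables (R : realType) (m q : nat).
Local Notation V := 'M[R]_(m + q).

Lemma det_indefinite_O (g : V) : indefinite_O R m q g -> \det g = 1 \/ \det g = -1.
Proof.
move=> /indefinite_OP/(congr1 determinant); rewrite det1 adjointmxE !det_mulmx det_tr.
have /(congr1 determinant) := signature_formK R m q; rewrite det_mulmx det1 => dS.
rewrite -mulrA mulrACA dS mul1r -expr2 => /eqP.
by rewrite sqrf_eq1 => /orP[]/eqP ->; [left|right].
Qed.

(** The determinant is 1 or -1 on [O]; on a connected set where it took both values it would also
    take the value 0. *)
Lemma det_SO0 (g : V) : indefinite_SO0 R m q g -> \det g = 1.
Proof.
move=> Gg; have [//|dg] := det_indefinite_O (SO0_O Gg).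
have cdet : continuous (fun g : V => \det g : R).
  move=> h; apply: (@Cinfty_continuous _ _ setT) => //.
  by apply: Cinfty_det; [exact: openT|exact: Cinfty_mx_id].
have cG : connected (indefinite_SO0 R m q) by exact: component_connected.
have := connected_continuous_connected cG (continuous_subspaceT cdet).
move=> /connected_intervalP/(_ (-1) 1).
move=> /(_ (ex_intro2 _ _ g Gg dg) (ex_intro2 _ _ 1%:M (SO0_1 R m q) (det1 _ _)) 0).
rewrite oppr_le0 ler01 => /(_ isT)[h Gh /= h0].
have n1 : (1 : R) != 0 := oner_neq0 R.
by have [d1|d1] := det_indefinite_O (SO0_O Gh); move: n1;
  [rewrite -d1 h0 eqxx|rewrite -oppr_eq0 -d1 h0 eqxx].
Qed.

End DetSO0.

(** * The isotropy group as a centralizer *)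

Section Isotropy.
Variables (R : realType) (p q : nat).
Local Notation V := 'M[R]_(p + p + q).
Local Notation S := (signature_form R (p + p) q).
Local Notation J := (standard_J R p).
Local Notation O := (indefinite_O R (p + p) q).
Local Notation H := (isotropy R p q).
Local Notation adj := (adjointmx S).
Implicit Types (g h : V).

Lemma standard_J_sqr : J *m J = - 1%:M.
Proof.
rewrite /standard_J mulmx_block !mulmx0 !mul0mx !mulmx1 !mul1mx !add0r !addr0.
by rewrite scalar_mx_block opp_block_mx !oppr0.
Qed.

Lemma standard_J_tr : J^T = - J.
Proof. by rewrite /standard_J tr_block_mx opp_block_mx !trmx0 linearN/= trmx1 oppr0 opprK. Qed.

Definition sqrt3 : R := Num.sqrt 3.

Lemma sqrt3_sqr : sqrt3 * sqrt3 = 3.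
Proof. by rewrite -expr2 sqr_sqrtr. Qed.

Lemma sqrt3_neq0 : sqrt3 != 0.
Proof. by rewrite gt_eqF// sqrtr_gt0. Qed.

(** The coefficients are the cosine and the sine of 2 pi / 3. *)
Definition rot3 : 'M[R]_(p + p) := (- 2^-1)%:M + (sqrt3 / 2) *: J.

Lemma rot3_tr : rot3^T = (- 2^-1)%:M - (sqrt3 / 2) *: J.
Proof.
by rewrite [LHS]linearD /= tr_scalar_mx [X in _ + X]linearZ /= standard_J_tr scalerN.
Qed.

Lemma rot3_sqr : rot3 *m rot3 = rot3^T.
Proof.
rewrite rot3_tr /rot3 mulmxDl !mulmxDr.
rewrite -!scalemxAl -!scalemxAr standard_J_sqr !mul_scalar_mx !mul_mx_scalar.
rewrite !scale_scalar_mx !scalerA !scalerN; apply/matrixP => i j; rewrite !mxE.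
have := sqrt3_sqr; move: sqrt3 => s ss.
have -> : s / 2 * (s / 2) = 3 / 4 by rewrite mulrACA ss; field.
by case: (i == j); rewrite ?mulr1n ?mulr0n; field.
Qed.

Lemma rot3_unitary : rot3 *m rot3^T = 1%:M.
Proof.
rewrite rot3_tr /rot3 mulmxDl !mulmxDr !mulmxN.
rewrite -!scalemxAl -!scalemxAr standard_J_sqr !mul_scalar_mx !mul_mx_scalar.
rewrite !scale_scalar_mx !scalerA !scalerN; apply/matrixP => i j; rewrite !mxE.
have := sqrt3_sqr; move: sqrt3 => s ss.
have -> : s / 2 * (s / 2) = 3 / 4 by rewrite mulrACA ss; field.
by case: (i == j); rewrite ?mulr1n ?mulr0n; field.
Qed.

(* The rotation by 2 pi / 3 on R^2p, extended by the identity of R^q: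
   M is identified with its conjugacy class. *)
Definition sigma0 : V := block_mx rot3 0 0 1%:M.

Lemma sigma0_adj : adj sigma0 = sigma0 *m sigma0.
Proof.
rewrite adjointmxE /sigma0 /signature_form tr_block_mx !mulmx_block.
rewrite !trmx0 !mulmx0 !mul0mx !mulmx1 !mul1mx !add0r !addr0 trmx1 ?mulmx0 ?oppr0.
by rewrite !(mul0mx, mulNmx, mulmxN, mul1mx, mulmx1, opprK) rot3_sqr.
Qed.

Lemma sigma0_cube : sigma0 *m sigma0 *m sigma0 = 1%:M.
Proof.
rewrite /sigma0 !mulmx_block !mulmx0 !mul0mx !mulmx1 !add0r !addr0.
by rewrite ?mulmx0 ?mul0mx ?mulmx1 rot3_sqr (mulmx1C rot3_unitary) -scalar_mx_block.
Qed.

Lemma tr_sigma0 : \tr sigma0 = q%:R - p%:R.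
Proof.
rewrite /sigma0 mxtrace_block mxtrace1 /rot3 linearD/= linearZ/= mxtrace_scalar.
rewrite /standard_J mxtrace_block !mxtrace0 addr0 mulr0 addr0 addrC; congr (_ + _).
by rewrite -[LHS]mulr_natr natrD; field.
Qed.

Lemma isotropy_O h : H h -> O h.
Proof.
move=> [A1 [A2 [[[oA1 _] _] [oA2 _] ->]]].
rewrite /indefinite_O /= /signature_form tr_block_mx !mulmx_block.
rewrite !trmx0 !mulmx0 !mul0mx !add0r !addr0 !mulmx1 !mulmxN !mulmx1 !mulNmx ?mulmx0 ?mul0mx ?oppr0.
by rewrite oA1 oA2.
Qed.

Lemma isotropy_comm h : H h -> h *m sigma0 = sigma0 *m h.
Proof.
move=> [A1 [A2 [[_ cJ] _ ->]]]; rewrite /sigma0 !mulmx_block.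
rewrite !mulmx0 !mul0mx !add0r !addr0 !mulmx1 !mul1mx; congr block_mx.
by rewrite /rot3 mulmxDl mulmxDr mul_scalar_mx mul_mx_scalar -scalemxAl -scalemxAr cJ.
Qed.

Lemma isotropyM h h' : H h -> H h' -> H (h *m h').
Proof.
move=> [A1 [A2 [[[oA1 dA1] cA1] [oA2 dA2] ->]]] [B1 [B2 [[[oB1 dB1] cB1] [oB2 dB2] ->]]].
have o n (X Y : 'M[R]_n) : X^T *m X = 1%:M -> Y^T *m Y = 1%:M -> (X *m Y)^T *m (X *m Y) = 1%:M.
  by move=> oX oY; rewrite trmx_mul -mulmxA (mulmxA X^T) oX mul1mx.
exists (A1 *m B1), (A2 *m B2); split; last by rewrite mulmx_block !mulmx0 !mul0mx !add0r !addr0.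
  split; first by split; [exact: o|rewrite det_mulmx dA1 dB1 mulr1].
  by rewrite -mulmxA cB1 mulmxA cA1 mulmxA.
by split; [exact: o|rewrite det_mulmx dA2 dB2 mulr1].
Qed.

Lemma isotropyV h : H h -> H (adj h).
Proof.
move=> [A1 [A2 [[[oA1 dA1] cA1] [oA2 dA2] ->]]].
exists A1^T, A2^T; split.
- split; first by split; rewrite ?det_tr// trmxK; exact: mulmx1C.
  have := congr1 trmx cA1; rewrite !trmx_mul standard_J_tr mulNmx mulmxN.
  by move/oppr_inj => ->.
- by split; rewrite ?det_tr// trmxK; exact: mulmx1C.
rewrite adjointmxE /signature_form tr_block_mx !mulmx_block.
rewrite !trmx0 !mulmx0 !mul0mx !mulmx1 !mul1mx !add0r !addr0 ?mulmx0 ?mul0mx ?oppr0.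
by rewrite !(mul0mx, mulNmx, mulmxN, mul1mx, mulmx1, opprK).
Qed.

(** The off-diagonal blocks are fixed by [rot3], which has no eigenvalue 1, so they vanish. The
    upper diagonal block is orthogonal and commutes with J, so its determinant, 1 or -1, is
    nonnegative; [\det h = 1] then settles the lower one. *)
Lemma isotropy_centralizer h : O h -> \det h = 1 -> h *m sigma0 = sigma0 *m h -> H h.
Proof.
rewrite -[h]submxK; move: (ulsubmx h) (ursubmx h) (dlsubmx h) (drsubmx h) => a b c d.
rewrite /sigma0 !mulmx_block !mulmx0 !mul0mx !add0r !addr0 !mulmx1 !mul1mx.
move=> Oh dh /eq_block_mx[ac bE cE _].
have aJ : a *m J = J *m a.
  move: ac; rewrite /rot3 mulmxDl mulmxDr mul_scalar_mx mul_mx_scalar.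
  move=> /addrI; rewrite -scalemxAl -scalemxAr; apply: scalerI.
  by rewrite mulf_neq0// ?sqrt3_neq0// invr_neq0.
(* The inverse comes from (rot3 - 1) (rot3^T - 1) = 2 - (rot3 + rot3^T) = 3. *)
have u : (rot3 - 1%:M) *m ((3%:R)^-1 *: (rot3^T - 1%:M)) = 1%:M.
  rewrite -scalemxAr mulmxBl !mulmxBr rot3_unitary !mulmx1 !mul1mx.
  rewrite rot3_tr /rot3.
  apply/matrixP => i j; rewrite !mxE.
  by case: (i == j); rewrite ?mulr1n ?mulr0n; field.
have b0 : b = 0.
  have : (rot3 - 1%:M) *m b = 0 by rewrite mulmxBl mul1mx -bE subrr.
  by move=> /(congr1 (mulmx ((3%:R)^-1 *: (rot3^T - 1%:M)))); rewrite mulmxA (mulmx1C u) mul1mx mulmx0.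
have c0 : c = 0.
  have : c *m (rot3 - 1%:M) = 0 by rewrite mulmxBr mulmx1 cE subrr.
  by move=> /(congr1 (mulmx^~ ((3%:R)^-1 *: (rot3^T - 1%:M)))); rewrite -mulmxA u mulmx1 mul0mx.
move: Oh dh; rewrite b0 c0 det_ublock /indefinite_O /= /signature_form tr_block_mx !mulmx_block.
rewrite !trmx0 !mulmx0 !mul0mx !add0r !addr0 !mulmx1 !mulmxN !mulmx1 !mulNmx ?mulmx0 ?mul0mx ?oppr0.
move=> /eq_block_mx[oa _ _ /oppr_inj od] dad.
have da : \det a = 1.
  have := congr1 determinant oa; rewrite det_mulmx det_tr det1 -expr2 => /eqP.
  rewrite sqrf_eq1 => /orP[/eqP//|/eqP da].
  by have := det_commute_J_ge0 aJ; rewrite da oppr_ge0 ler10.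
by exists a, d; split=> //; split=> //; move: dad; rewrite da mul1r.
Qed.

End Isotropy.

(** * Local sections of the orbit map *)

Section ProjectorStep.
Variables (R : realType) (n : nat) (S : 'M[R]_n).
Hypotheses (Str : S^T = S) (SS : S *m S = 1%:M).
Local Notation adj := (adjointmx S).
Implicit Types (Pi A K : 'M[R]_n) (s : 'cV[R]_n).

(** The final alternative lets one induction serve both factors: in the complex part, [A] squares to
    -1 and vectors come in pairs s, A s; in the fixed part, [A] is zero and the procedure is the
    ordinary one. *)
Definition compatible_projector Pi A :=
  [/\ Pi *m Pi = Pi, adj Pi = Pi, adj A = - A, A *m Pi = Pi *m A &
      A *m A *m Pi = - Pi \/ A *m Pi = 0].

Lemma adjoint_form A m k (X : 'M[R]_(n, m)) (Y : 'M[R]_(n, k)) :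
  X^T *m S *m A *m Y = (adj A *m X)^T *m S *m Y.
Proof.
rewrite adjointmxE !trmx_mul trmxK Str !mulmxA.
by rewrite -(mulmxA _ S S) SS mulmx1.
Qed.

Lemma skew_form_eq0 A s : adj A = - A -> s^T *m S *m A *m s = 0.
Proof.
move=> As; apply/matrixP => i j; rewrite !ord1 [RHS]mxE.
have e : (s^T *m S *m A *m s)^T = - (s^T *m S *m A *m s).
  by rewrite [in RHS]adjoint_form As mulNmx linearN/= !mulNmx opprK !trmx_mul Str trmxK !mulmxA.
have := congr1 (fun M : 'M[R]_1 => M 0 0) e; rewrite !mxE => /eqP.
by rewrite -addr_eq0 -mulr2n mulrn_eq0 => /eqP.
Qed.

(* Pi' is the projector onto the orthogonal complement of s and A s inside the
   image of Pi. *)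
Lemma compatible_projector_step Pi A s (eps : R) (K := eps *: (s *m s^T *m S))
    (Pi' := Pi - (K - A *m K *m A)) :
  eps * eps = 1 -> compatible_projector Pi A -> Pi *m s = s ->
  s^T *m S *m s = eps%:M ->
  [/\ compatible_projector Pi' A, Pi *m Pi' = Pi', Pi' *m s = 0 &
      Pi' *m (A *m s) = 0].
Proof.
move=> ee [PP aP aA AP AAP] Ps ss.
have sAs := skew_form_eq0 s aA.
have Ks : K *m s = s.
  by rewrite /K -scalemxAl -2!mulmxA (mulmxA s^T) ss mul_mx_scalar scalerA ee scale1r.
have KAs : K *m A *m s = 0.
  by rewrite /K -!scalemxAl -!mulmxA (mulmxA s^T) (mulmxA _ A) sAs mulmx0 scaler0.
have KK : K *m K = K.
  by rewrite {2}/K -scalemxAr !mulmxA Ks.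
have KAK : K *m A *m K = 0.
  by rewrite {2}/K -scalemxAr !mulmxA KAs !mul0mx scaler0.
have PK : Pi *m K = K by rewrite /K -scalemxAr !mulmxA Ps.
have aK : adj K = K.
  rewrite /K linearZ/= adjointmxE !trmx_mul trmxK Str !mulmxA SS mul1mx.
  by [].
have KP : K *m Pi = K by rewrite -{1}aK -{1}aP -adjointmxM ?SS// PK.
have aAKA : adj (A *m K *m A) = A *m K *m A.
  by rewrite !adjointmxM ?SS// aK aA !(mulmxN, mulNmx) opprK mulmxA.
(* [K] projects onto s and, [A] being skew, [- A *m K *m A] projects onto A s; the latter is 0 when
   [A] kills the image of [Pi]. *)
pose p := K - A *m K *m A.
have ap : adj p = p by rewrite linearB/= aK aAKA.
have Pp : Pi *m p = p by rewrite mulmxBr PK !mulmxA -AP -(mulmxA A Pi) PK.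
have pP : p *m Pi = p by rewrite -{1}ap -{1}aP -adjointmxM ?SS// Pp.
have AAK : A *m A *m K = - K /\ K *m A *m A = - K \/ A *m K = 0 /\ K *m A = 0.
  have aAK : K *m A = - adj (A *m K) by rewrite adjointmxM ?SS// aK aA mulmxN opprK.
  have aAAK : K *m A *m A = adj (A *m A *m K).
    by rewrite !adjointmxM ?SS// aK aA !(mulmxN, mulNmx) opprK mulmxA.
  case: AAP => e; [left|right].
    have e' : A *m A *m K = - K by rewrite -PK mulmxA e mulNmx.
    by rewrite aAAK e' linearN/= aK.
  have e' : A *m K = 0 by rewrite -PK mulmxA e mul0mx.
  by rewrite aAK e' linear0 oppr0.
have pA : A *m p = p *m A.
  rewrite /p mulmxBr mulmxBl !mulmxA; case: AAK => -[e1 e2].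
    by rewrite e1 -(mulmxA A K A) -(mulmxA A (K *m A)) e2 mulmxN mulNmx !opprK addrC.
  by rewrite -(mulmxA A A K) e1 e2 mulmx0 !mul0mx.
have pp : p *m p = p.
  have Kp : K *m p = K.
    by rewrite /p mulmxBr KK !mulmxA KAK mul0mx subr0.
  have AKAp : A *m K *m A *m p = A *m K *m A.
    rewrite -mulmxA pA mulmxA -(mulmxA A K p) Kp.
    by [].
  by rewrite {1}/p mulmxBl Kp AKAp.
have p's : p *m s = s.
  rewrite /p mulmxBl Ks -!mulmxA (mulmxA K) KAs mulmx0 subr0.
  by [].
have -> : Pi' = Pi - p by [].
clearbody p; split.
- split.
  + by rewrite mulmxBl !mulmxBr PP Pp pP pp subrr subr0.
  + by rewrite linearB/= aP ap.
  + by [].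
  + by rewrite mulmxBr mulmxBl AP pA.
  + have e : Pi - p = Pi *m (Pi - p) by rewrite mulmxBr PP Pp.
    rewrite e !mulmxA; case: AAP => ->; [left|right]; last by rewrite mul0mx.
    by rewrite mulNmx.
- by rewrite mulmxBr PP Pp.
- by rewrite mulmxBl Ps p's subrr.
- have PAs : Pi *m (A *m s) = A *m s by rewrite mulmxA -AP -mulmxA Ps.
  by rewrite mulmxBl PAs mulmxA -pA -mulmxA p's subrr.
Qed.

End ProjectorStep.

Section GramSchmidt.
Variables (R : realType) (n : nat) (S : 'M[R]_n).
Hypotheses (Str : S^T = S) (SS : S *m S = 1%:M).
Local Notation V := 'M[R]_n.
Variables (T : set V) (A : V -> V) (eps : R).
Hypotheses (epsK : eps * eps = 1).

Lemma Cinfty_row_mx (W : normedModType R) (U : set W) m k l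
    (X : W -> 'M[R]_(m, k)) (Y : W -> 'M[R]_(m, l)) :
  open U -> Cinfty_mx U X -> Cinfty_mx U Y -> Cinfty_mx U (fun x => row_mx (X x) (Y x)).
Proof.
move=> oU sX sY i j; case: (split_ordP j) => j' ->.
  by apply: Cinfty_eq (sX i j') => // x _; rewrite row_mxEl.
by apply: Cinfty_eq (sY i j') => // x _; rewrite row_mxEr.
Qed.

(** Smoothness holds on open sets of all matrices, but the relations only on [T], where [Pi P] and
    [A P] are compatible. As [a] is already orthonormal at [P0], the procedure changes nothing
    there, whence [X P0 = a]; shrinking [U] keeps the norms that are inverted positive. *)
Lemma Gram_Schmidt k (a : 'M[R]_(n, k)) (U : set V) (Pi : V -> V) (P0 : V) :
  open U -> U P0 -> T P0 -> Cinfty_mx U Pi -> Cinfty_mx U A ->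
  (forall P, U P -> T P -> compatible_projector S (Pi P) (A P)) ->
  Pi P0 *m a = a -> a^T *m S *m a = eps%:M -> a^T *m S *m A P0 *m a = 0 ->
  exists U' (X : V -> 'M[R]_(n, k)),
    [/\ open U' /\ U' `<=` U, U' P0, Cinfty_mx U' X, X P0 = a &
     forall P, U' P -> T P ->
      [/\ Pi P *m X P = X P, (X P)^T *m S *m X P = eps%:M &
          (X P)^T *m S *m A P *m X P = 0]].
Proof.
move=> oU UP0 TP0; elim: k a U Pi oU UP0 => [|k IHk] a U Pi oU UP0 sPi sA comp Pa aa aAa.
  exists U, (fun=> a); split; [by split|by []|exact: Cinfty_mx_cst|by []|].
  by move=> P UP TP; split; [apply/matrixP => i []|apply/matrixP => -[]|apply/matrixP => -[]].
move: (a) Pa aa aAa; rewrite -[k.+1]/(1 + k)%N => {}a Pa aa aAa.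
pose b := lsubmx a; pose c := rsubmx a.
have aE : a = row_mx b c by rewrite hsubmxK.
have [Pb Pc] : Pi P0 *m b = b /\ Pi P0 *m c = c.
  by move: Pa; rewrite aE mul_mx_row => /eq_row_mx.
have [bb bc _ cc] : [/\ b^T *m S *m b = eps%:M, b^T *m S *m c = 0,
    c^T *m S *m b = 0 & c^T *m S *m c = eps%:M].
  move: aa; rewrite aE tr_row_mx mul_col_mx mul_col_row scalar_mx_block.
  by move=> /eq_block_mx[].
have [bAb bAc _ cAc] : [/\ b^T *m S *m A P0 *m b = 0, b^T *m S *m A P0 *m c = 0,
    c^T *m S *m A P0 *m b = 0 & c^T *m S *m A P0 *m c = 0].
  move: aAa; rewrite aE tr_row_mx 2!mul_col_mx mul_col_row -[RHS]block_mx0.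
  by move=> /eq_block_mx[].
pose u P := Pi P *m b.
have su : Cinfty_mx U u by apply: Cinfty_mxM => //; exact: Cinfty_mx_cst.
(* The sign [eps] makes this square equal to 1 at [P0], hence positive nearby. *)
pose nu P : R := eps * ((u P)^T *m S *m u P) 0 0.
have snu : Cinfty U nu.
  apply: CinftyM => //; first exact: Cinfty_cst.
  apply: Cinfty_mxM => //; apply: Cinfty_mxM => //; last exact: Cinfty_mx_cst.
  exact: Cinfty_mx_tr.
have nu0 : nu P0 = 1 by rewrite /nu /u Pb bb mxE mulr1n.
have [U1 [oU1 U1U U1P0 nuU1]] : exists U1, [/\ open U1, U1 `<=` U, U1 P0 & forall P, U1 P -> 0 < nu P].
  have : \forall P \near P0, 0 < nu P.
    have cnu := Cinfty_continuous snu UP0.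
    apply: (cnu [set v | 0 < v]); apply: open_nbhs_nbhs; split; first exact: open_gt.
    by rewrite /= nu0.
  rewrite -nbhs_nearE nbhsE => -[U1 [oU1 U1P0] U1P].
  exists (U `&` U1); split; [exact: openI|by move=> P []|by split|by move=> P [_ /U1P]].
pose s P := (Num.sqrt (nu P))^-1 *: u P.
have ss : Cinfty_mx U1 s.
  apply: Cinfty_mxZ => //; last exact: (@Cinfty_mx_subset _ _ _ _ U).
  apply: (@Cinfty_comp1 _ _ U1 [set v | 0 < v] nu (fun v => (Num.sqrt v)^-1)) => //.
    exact: (@Cinfty_subset _ _ U).
  exact: Cinfty_inv_sqrt.
have s0 : s P0 = b by rewrite /s nu0 sqrtr1 invr1 scale1r /u Pb.
pose K P := eps *: (s P *m (s P)^T *m S).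
pose Pi' P := Pi P - (K P - A P *m K P *m A P).
have sA1 : Cinfty_mx U1 A by exact: (@Cinfty_mx_subset _ _ _ _ U).
have sPi1 : Cinfty_mx U1 Pi by exact: (@Cinfty_mx_subset _ _ _ _ U).
have sK : Cinfty_mx U1 K.
  apply: Cinfty_mxZ => //; first exact: Cinfty_cst.
  apply: Cinfty_mxM => //; last exact: Cinfty_mx_cst.
  by apply: Cinfty_mxM => //; exact: Cinfty_mx_tr.
have sPi' : Cinfty_mx U1 Pi'.
  apply: Cinfty_mxD => //; apply: Cinfty_mxN => //; apply: Cinfty_mxD => //.
  apply: Cinfty_mxN => //; apply: Cinfty_mxM => //; exact: Cinfty_mxM.
have step P : U1 P -> T P -> [/\ compatible_projector S (Pi' P) (A P), Pi P *m Pi' P = Pi' P,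
    Pi' P *m s P = 0 & Pi' P *m (A P *m s P) = 0]
   /\ (Pi P *m s P = s P /\ (s P)^T *m S *m s P = eps%:M).
  move=> U1P TP; have cP := comp P (U1U _ U1P) TP.
  have Ps : Pi P *m s P = s P.
    by rewrite /s -scalemxAr /u mulmxA; have [-> _ _ _ _] := cP.
  have sS : (s P)^T *m S *m s P = eps%:M.
    have -> : (s P)^T = (Num.sqrt (nu P))^-1 *: (u P)^T by rewrite /s [LHS]linearZ.
    rewrite -!scalemxAl /s -scalemxAr scalerA -invfM -expr2 sqr_sqrtr ?ltW ?nuU1//.
    rewrite [X in _ *: X]mx11_scalar scale_scalar_mx; congr (_%:M).
    have n0 : nu P != 0 by rewrite gt_eqF// nuU1.
    by rewrite -[X in _ * X]mul1r -epsK -mulrA -/(nu P) mulrCA mulVf// mulr1.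
  split=> //; exact: compatible_projector_step.
have U1c P : U1 P -> T P -> compatible_projector S (Pi' P) (A P).
  by move=> U1P TP; have [[]] := step P U1P TP.
have Pc' : Pi' P0 *m c = c.
  rewrite /Pi' mulmxBl Pc mulmxBl /K s0 -!scalemxAr -!scalemxAl -!mulmxA.
  rewrite !(mulmxA b^T) (mulmxA (b^T *m S)) bc bAc !mulmx0 scaler0 ?mulmx0 !subr0.
  by rewrite ?scaler0 ?subr0.
have [U2 [X [[oU2 U21] U2P0 sX X0 HX]]] := IHk c U1 Pi' oU1 U1P0 sPi' sA1 U1c Pc' cc cAc.
have U2U : U2 `<=` U by move=> P /U21/U1U.
exists U2, (fun P => row_mx (s P) (X P)); split=> //.
- by apply: Cinfty_row_mx => //; exact: (@Cinfty_mx_subset _ _ _ _ U1).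
- by rewrite s0 X0 -aE.
move=> P U2P TP; have [[cP PP' P's P'As] [Ps sS]] := step P (U21 _ U2P) TP.
have [P'X XX XAX] := HX P U2P TP.
have [P'P' aP' aA AP' _] := cP.
have sX0 : (s P)^T *m S *m X P = 0.
  rewrite -P'X mulmxA adjoint_form// aP' P's trmx0 !mul0mx.
  by [].
have sAX0 : (s P)^T *m S *m A P *m X P = 0.
  rewrite -P'X mulmxA -(mulmxA _ (A P)) AP' mulmxA -(mulmxA _ (A P)) adjoint_form// aP' P's.
  by rewrite trmx0 !mul0mx.
have Xs0 : (X P)^T *m S *m s P = 0.
  by have := congr1 trmx sX0; rewrite !trmx_mul Str trmxK mulmxA trmx0.
have XAs0 : (X P)^T *m S *m A P *m s P = 0.
  have SA : (A P)^T *m S = - (S *m A P).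
    rewrite -[LHS]mul1mx -SS -mulmxA (mulmxA S _ S) -adjointmxE aA.
    by rewrite mulmxN.
  have -> : (X P)^T *m S *m A P *m s P = - ((s P)^T *m S *m A P *m X P)^T.
    rewrite !trmx_mul trmxK Str -!mulmxA (mulmxA (A P)^T) SA mulNmx mulmxN opprK.
    by rewrite !mulmxA.
  by rewrite sAX0 trmx0 oppr0.
split.
- by rewrite mul_mx_row Ps -P'X mulmxA PP'.
- rewrite tr_row_mx mul_col_mx mul_col_row sX0 Xs0 sS XX.
  by rewrite -scalar_mx_block.
- rewrite tr_row_mx 2!mul_col_mx mul_col_row sAX0 XAs0 XAX skew_form_eq0//.
  by rewrite block_mx0.
Qed.

End GramSchmidt.

Section LocalSection.
Variables (R : realType) (p q : nat).
Local Notation V := 'M[R]_(p + p + q).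
Local Notation S := (signature_form R (p + p) q).
Local Notation J := (standard_J R p).
Local Notation O := (indefinite_O R (p + p) q).
Local Notation G := (indefinite_SO0 R (p + p) q).
Local Notation adj := (adjointmx S).
Local Notation sigma0 := (sigma0 R p q).
Local Notation Str := (signature_form_tr R (p + p) q).
Local Notation SS := (signature_formK R (p + p) q).
Local Notation s3 := (sqrt3 R).
Implicit Types (g h P : V).

(** These equations hold along the orbit of sigma_0 and are all that the construction of frames uses
    about its points. *)
Definition order3_unitary : set V := [set P | P *m P *m P = 1%:M /\ adj P = P *m P].

Definition cpx P : V := s3^-1 *: (P - P *m P).
Definition projE P : V := 3^-1 *: (2%:M - P - P *m P).

Let kk : s3^-1 * s3^-1 = 3^-1.
Proof. by rewrite -invfM sqrt3_sqr. Qed.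

Lemma cpx_sqr P : P *m P *m P = 1%:M -> cpx P *m cpx P = - projE P.
Proof.
move=> P3; rewrite /cpx -scalemxAl -scalemxAr scalerA kk /projE -scalerN; congr (_ *: _).
rewrite mulmxBl !mulmxBr !mulmxA P3 mul1mx.
by apply/matrixP => i j; rewrite !mxE; case: (i == j); rewrite ?mulr1n ?mulr0n; ring.
Qed.

Lemma cpx_projE P : P *m P *m P = 1%:M -> cpx P *m projE P = cpx P.
Proof.
move=> P3; rewrite /cpx /projE -scalemxAl -scalemxAr; congr (_ *: _).
rewrite mulmxBl !mulmxBr !mulmxA P3 mul1mx !mul_mx_scalar.
by apply/matrixP => i j; rewrite !mxE; case: (i == j); rewrite ?mulr1n ?mulr0n; field.
Qed.

Lemma projE_cpx P : P *m P *m P = 1%:M -> projE P *m cpx P = cpx P.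
Proof.
move=> P3; rewrite -[projE P]opprK -cpx_sqr// mulNmx -mulmxA cpx_sqr// mulmxN opprK.
exact: cpx_projE.
Qed.

Lemma projE_idem P : P *m P *m P = 1%:M -> projE P *m projE P = projE P.
Proof.
move=> P3; rewrite -{1}[projE P]opprK -cpx_sqr// mulNmx -mulmxA cpx_projE//.
by rewrite cpx_sqr// opprK.
Qed.

(** Reduces the action of P on a frame to those of [projE P] and [cpx P]: rotation by 2 pi / 3 on
    the image of [projE P], the identity on its complement. *)
Lemma order3E P : P *m P *m P = 1%:M ->
  P = 1%:M - (3 / 2) *: projE P + (s3 / 2) *: cpx P.
Proof.
move=> P3; rewrite /projE /cpx !scalerA.
have -> : s3 / 2 * s3^-1 = 2^-1 by field; exact: sqrt3_neq0.
apply/matrixP => i j; rewrite !mxE.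
by case: (i == j); rewrite ?mulr1n ?mulr0n; field.
Qed.

Lemma adj_cpx P : order3_unitary P -> adj (cpx P) = - cpx P.
Proof.
move=> [P3 aP]; rewrite /cpx linearZ/= linearB/= adjointmxM ?SS// aP.
by rewrite !mulmxA P3 mul1mx -scalerN opprB.
Qed.

Lemma adj_projE P : order3_unitary P -> adj (projE P) = projE P.
Proof.
move=> [P3 aP]; have a2 : adj 2%:M = 2%:M.
  by rewrite adjointmxE tr_scalar_mx mul_mx_scalar -scalemxAl SS scalemx1.
rewrite /projE [LHS]linearZ /=; congr (_ *: _).
by rewrite 2!linearB /= adjointmxM ?SS// a2 aP !mulmxA P3 mul1mx addrAC.
Qed.

Lemma projE_compatible P : order3_unitary P -> compatible_projector S (projE P) (cpx P).
Proof.
move=> TP; have [P3 aP] := TP; split; rewrite ?adj_projE ?adj_cpx ?projE_idem//.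
  by rewrite cpx_projE ?projE_cpx.
by left; rewrite cpx_sqr// mulNmx projE_idem.
Qed.

Lemma projE_compatibleC P : order3_unitary P -> compatible_projector S (1%:M - projE P) (cpx P).
Proof.
move=> TP; have [P3 aP] := TP.
split; rewrite ?adj_cpx//.
- by rewrite mulmxBl !mulmxBr projE_idem// mul1mx mulmx1 mul1mx subrr subr0.
- by rewrite linearB/= adj_projE// adjointmx1 ?SS.
- by rewrite mulmxBl mulmxBr cpx_projE ?projE_cpx// mul1mx mulmx1.
- by right; rewrite mulmxBr mulmx1 cpx_projE// subrr.
Qed.

Lemma cpx_sigma0 : cpx sigma0 = block_mx J 0 0 0.
Proof.
rewrite /cpx -sigma0_adj // adjointmxE /sigma0 tr_block_mx !mulmx_block.
rewrite !trmx0 !mulmx0 !mul0mx !mulmx1 !mul1mx !add0r !addr0 trmx1.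
rewrite !(mul0mx, mulNmx, mulmxN, mul1mx, mulmx1, opprK).
rewrite opp_block_mx add_block_mx !subrr scale_block_mx !scaler0 rot3_tr /rot3.
congr block_mx; rewrite opprD opprK addrACA subrr add0r -scalerDl scalerA -splitr mulVf ?scale1r//.
exact: sqrt3_neq0.
Qed.

Definition conj_point g : V := g *m sigma0 *m adj g.

Lemma conj_pointM g A B : O g -> (g *m A *m adj g) *m (g *m B *m adj g) = g *m (A *m B) *m adj g.
Proof. by move=> /indefinite_OP Og; rewrite !mulmxA -(mulmxA _ (adj g)) Og mulmx1. Qed.

Lemma conj_point_order3 g : O g -> order3_unitary (conj_point g).
Proof.
move=> Og; have gg := mulmx1C ((indefinite_OP g).1 Og).
split; first by rewrite /conj_point !conj_pointM// sigma0_cube mulmx1.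
by rewrite /conj_point conj_pointM// !adjointmxM ?SS// adjointmxK ?SS ?Str// sigma0_adj !mulmxA.
Qed.

Lemma cpx_conj_point g : O g -> cpx (conj_point g) = g *m cpx sigma0 *m adj g.
Proof.
move=> Og; rewrite /cpx /conj_point conj_pointM// -scalemxAr -scalemxAl.
by rewrite mulmxBr mulmxBl.
Qed.

(* projE P projects onto the sum of the eigenspaces of P for the two primitive
   cube roots of unity, on which cpx P is a complex structure: the columns of g0
   projected there, and to the fixed space of P, undergo Gram-Schmidt. *)
Lemma local_section g0 : G g0 -> exists U (Psi : V -> V),
  [/\ open U, U (conj_point g0), Cinfty_mx U Psi, Psi (conj_point g0) = g0 &
   forall P, U P -> order3_unitary P -> O (Psi P) /\ P *m Psi P = Psi P *m sigma0].
Proof.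
move=> Gg0; have Og0 := SO0_O Gg0; have g0a := SO0_adjK Gg0.
have ag0 := (indefinite_OP g0).1 Og0.
set P0 := conj_point g0; have TP0 : order3_unitary P0 by exact: conj_point_order3.
(* [W1] is a basis of R^2p over the complex numbers, to be completed by J W1; [W2] is a basis of
   R^q. *)
pose W1 : 'M[R]_(p + p + q, p) := col_mx (col_mx 1%:M 0) 0.
pose W2 : 'M[R]_(p + p + q, q) := col_mx 0 1%:M.
have gS k (W : 'M[R]_(p + p + q, k)) : (g0 *m W)^T *m S = W^T *m S *m adj g0.
  by rewrite trmx_mul adjointmxE !mulmxA -(mulmxA _ S S) SS mulmx1.
have cP0 : cpx P0 = g0 *m block_mx J 0 0 0 *m adj g0 by rewrite cpx_conj_point// cpx_sigma0.
have EP0 : projE P0 = g0 *m block_mx 1%:M 0 0 0 *m adj g0.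
  apply: oppr_inj; rewrite -cpx_sqr; last by have [] := TP0.
  rewrite cP0 conj_pointM// mulmx_block !mul0mx !mulmx0 !addr0 standard_J_sqr.
  rewrite -mulNmx -mulmxN opp_block_mx !oppr0.
  by [].
have oT : open (setT : set V) by exact: openT.
have sid : Cinfty_mx setT (@id V) by exact: Cinfty_mx_id.
have sPP : Cinfty_mx setT (fun P : V => P *m P) by exact: Cinfty_mxM.
have sc : Cinfty_mx setT cpx.
  apply: Cinfty_mxZ => //; first exact: Cinfty_cst.
  by apply: Cinfty_mxD => //; exact: Cinfty_mxN.
have sE : Cinfty_mx setT projE.
  apply: Cinfty_mxZ => //; first exact: Cinfty_cst.
  apply: Cinfty_mxD => //; last exact: Cinfty_mxN.
  apply: Cinfty_mxD => //; last exact: Cinfty_mxN.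
  exact: Cinfty_mx_cst.
have sE' : Cinfty_mx setT (fun P => 1%:M - projE P).
  by apply: Cinfty_mxD => //; [exact: Cinfty_mx_cst|exact: Cinfty_mxN].
have mkE k (W : 'M[R]_(p + p + q, k)) B : g0 *m B *m adj g0 *m (g0 *m W) = g0 *m (B *m W).
  by rewrite !mulmxA -(mulmxA _ (adj g0)) ag0 mulmx1.
have W1E : (block_mx 1%:M 0 0 0 : V) *m W1 = W1.
  by rewrite /W1 mul_block_col !mul0mx mul1mx !addr0.
have W2E : (block_mx 1%:M 0 0 0 : V) *m W2 = 0.
  by rewrite /W2 mul_block_col !mul0mx mulmx0 !addr0 col_mx0.
have W1S : W1^T *m S *m W1 = 1%:M.
  rewrite /W1 !tr_col_mx mul_row_block !trmx0 !mul0mx !addr0 mulmx1 mulmx0 mul_row_col.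
  by rewrite mul_row_col !(mul0mx, mulmx0, addr0, add0r, trmx1, mulmx1).
have W1J : (block_mx J 0 0 0 : V) *m W1 = col_mx (col_mx 0 1%:M) 0.
  rewrite /W1 mul_block_col !(mul0mx, mulmx0, addr0) /standard_J mul_block_col.
  by rewrite !(mul0mx, mulmx0, addr0, add0r, mulmx1).
have W1A : W1^T *m S *m ((block_mx J 0 0 0 : V) *m W1) = 0.
  rewrite W1J /W1 !tr_col_mx mul_row_block !trmx0 !mul0mx !addr0 mulmx1 mulmx0 mul_row_col.
  by rewrite mul_row_col !(mul0mx, mulmx0, addr0, add0r).
have W2S : W2^T *m S *m W2 = (-1)%:M.
  rewrite /W2 !tr_col_mx mul_row_block mul_row_col.
  by rewrite !(trmx0, trmx1, mul0mx, mulmx0, addr0, add0r, mul1mx, mulmx1) -raddfN.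
have W2A : W2^T *m S *m ((block_mx J 0 0 0 : V) *m W2) = 0.
  by rewrite /W2 mul_block_col !(mul0mx, mulmx0, addr0) col_mx0 mulmx0.
have sS k (W W' : 'M[R]_(p + p + q, k)) : (g0 *m W)^T *m S *m (g0 *m W') = W^T *m S *m W'.
  by rewrite gS -mulmxA (mulmxA (adj g0)) ag0 mul1mx.
have E1 : projE P0 *m (g0 *m W1) = g0 *m W1 by rewrite EP0 mkE W1E.
have E2 : (1%:M - projE P0) *m (g0 *m W2) = g0 *m W2.
  by rewrite mulmxBl mul1mx EP0 mkE W2E mulmx0 subr0.
have S1 : (g0 *m W1)^T *m S *m (g0 *m W1) = 1%:M by rewrite sS W1S.
have S2 : (g0 *m W2)^T *m S *m (g0 *m W2) = (-1)%:M by rewrite sS W2S.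
have A1 : (g0 *m W1)^T *m S *m cpx P0 *m (g0 *m W1) = 0.
  by rewrite -mulmxA cP0 mkE sS W1A.
have A2 : (g0 *m W2)^T *m S *m cpx P0 *m (g0 *m W2) = 0.
  by rewrite -mulmxA cP0 mkE sS W2A.
have N1 : -1 * -1 = 1 :> R by rewrite mulrNN mulr1.
have [U1 [X1 [[oU1 _] U1P0 sX1 X1P0 HX1]]] := Gram_Schmidt Str SS (mulr1 1) oT I TP0 sE sc
  (fun P _ => @projE_compatible P) E1 S1 A1.
have [U2 [X2 [[oU2 _] U2P0 sX2 X2P0 HX2]]] := Gram_Schmidt Str SS N1 oT I TP0 sE' sc
  (fun P _ => @projE_compatibleC P) E2 S2 A2.
pose U := U1 `&` U2.
have oU : open U by exact: openI.
(* Taking [cpx P *m X1 P] for the second half of the complex frame makes P act on the columns as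
   sigma_0 acts on the standard basis. *)
pose Psi P : V := row_mx (row_mx (X1 P) (cpx P *m X1 P)) (X2 P).
have sX1' : Cinfty_mx U X1 by apply: (@Cinfty_mx_subset _ _ _ _ U1) => // P [].
exists U, Psi; split=> //.
- apply: Cinfty_row_mx => //; last by apply: (@Cinfty_mx_subset _ _ _ _ U2) => // P [].
  apply: Cinfty_row_mx => //; apply: Cinfty_mxM => //; exact: (@Cinfty_mx_subset _ _ _ _ setT).
- rewrite /Psi X1P0 X2P0 cP0 mkE -!mul_mx_row -[RHS]mulmx1; congr (_ *m _).
  rewrite W1J /W1 /W2 -block_mxEh block_mxEv row_mx0 -!block_mxEh.
  by rewrite -!scalar_mx_block.
move=> P [U1P U2P] TP; have [P3 aP] := TP.
have [EX1 X1X1 X1A] := HX1 P U1P TP; have [EX2 X2X2 _] := HX2 P U2P TP.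
have {EX2} : projE P *m X2 P = 0.
  have := congr1 (mulmx (projE P)) EX2; rewrite mulmxA mulmxBr mulmx1 projE_idem// subrr mul0mx.
  by [].
move=> EX2.
have AX2 : cpx P *m X2 P = 0 by rewrite -(cpx_projE P3) -mulmxA EX2 mulmx0.
have AAX1 : cpx P *m (cpx P *m X1 P) = - X1 P by rewrite mulmxA cpx_sqr// mulNmx EX1.
have PX k (X : 'M[R]_(_, k)) : P *m X = X - (3 / 2) *: (projE P *m X) + (s3 / 2) *: (cpx P *m X).
  by rewrite {1}(order3E P3) mulmxDl mulmxBl mul1mx -!scalemxAl.
split; last first.
  rewrite /Psi /sigma0 mul_mx_row mul_row_block !mulmx0 mulmx1 addr0 add0r mul_mx_row.
  congr row_mx; last by rewrite PX EX2 AX2 !scaler0 subr0 addr0.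
  rewrite /rot3 /standard_J scalar_mx_block scale_block_mx add_block_mx mul_row_block.
  rewrite !(scaler0, addr0, add0r, scalerN, mulmxN) -!scalemxAr !mulmx1.
  rewrite !mul_mx_scalar !PX EX1 AAX1 mulmxA projE_cpx//.
  by congr row_mx; apply/matrixP => i j; rewrite !mxE; field.
have AS : (cpx P)^T *m S = - (S *m cpx P).
  rewrite -[LHS]mul1mx -SS -mulmxA (mulmxA S _ S) -adjointmxE adj_cpx//.
  by rewrite mulmxN.
have ES : (projE P)^T *m S = S *m projE P.
  by rewrite -[LHS]mul1mx -SS -mulmxA (mulmxA S _ S) -adjointmxE adj_projE.
have X12 : (X1 P)^T *m S *m X2 P = 0.
  by rewrite -EX1 trmx_mul -(mulmxA _ _ S) ES -!mulmxA EX2 !mulmx0.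
have trs k l (Y : 'M[R]_(_, k)) (Z : 'M[R]_(_, l)) : Y^T *m S *m Z = 0 -> Z^T *m S *m Y = 0.
  by move=> /(congr1 trmx); rewrite !trmx_mul trmxK Str mulmxA trmx0.
have AYS k l (Y : 'M[R]_(_, k)) (Z : 'M[R]_(_, l)) : (cpx P *m Y)^T *m S *m Z = - (Y^T *m S *m (cpx P *m Z)).
  by rewrite trmx_mul -(mulmxA _ _ S) AS mulmxN mulNmx !mulmxA.
have AX1X1 : (cpx P *m X1 P)^T *m S *m X1 P = 0 by rewrite AYS mulmxA X1A oppr0.
have AX1AX1 : (cpx P *m X1 P)^T *m S *m (cpx P *m X1 P) = 1%:M.
  by rewrite AYS AAX1 mulmxN opprK.
have AX1X2 : (cpx P *m X1 P)^T *m S *m X2 P = 0 by rewrite AYS AX2 mulmx0 oppr0.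
have X1AX1 : (X1 P)^T *m S *m (cpx P *m X1 P) = 0 by rewrite mulmxA.
rewrite /indefinite_O /= /Psi tr_row_mx mul_col_mx mul_col_row.
have -> : (row_mx (X1 P) (cpx P *m X1 P))^T *m S = col_mx ((X1 P)^T *m S) ((cpx P *m X1 P)^T *m S).
  by rewrite tr_row_mx mul_col_mx.
rewrite mul_col_row mul_col_mx mul_mx_row.
rewrite X1X1 AX1X1 X1AX1 AX1AX1 X2X2.
by rewrite X12 AX1X2 (trs _ _ _ _ X12) (trs _ _ _ _ AX1X2) col_mx0 row_mx0 -scalar_mx_block raddfN.
Qed.

End LocalSection.

(** * Vector fields and tangent vectors of the period domain *)

Section Cosets.
Variables (R : realType) (p q : nat).
Local Notation V := 'M[R]_(p + p + q).
Local Notation S := (signature_form R (p + p) q).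
Local Notation G := (indefinite_SO0 R (p + p) q).
Local Notation H := (isotropy R p q).
Local Notation adj := (adjointmx S).
Local Notation Str := (signature_form_tr R (p + p) q).
Local Notation SS := (signature_formK R (p + p) q).
Local Notation M := (period_domain R p q).
Local Notation C := (smoothFun M).
Implicit Types (g h b : V) (x : M) (f : M -> R).

Lemma isotropy1 : H 1%:M.
Proof.
exists 1%:M, 1%:M; split; last by rewrite scalar_mx_block.
  split; first by split; rewrite ?det1// trmx1 mulmx1.
  by rewrite mulmx1 mul1mx.
by split; rewrite ?det1// trmx1 mulmx1.
Qed.

Lemma coset_mem x g : sval x g -> sval x = [set g *m h | h in H].
Proof.
have [g0 Gg0 ->] := svalP x => -[h0 Hh0 <-].
apply/seteqP; split=> _ [h Hh <-].
  exists (adj h0 *m h); first by apply: isotropyM => //; exact: isotropyV.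
  have e := mulmx1C ((indefinite_OP h0).1 (isotropy_O Hh0)).
  by rewrite -mulmxA (mulmxA h0) e mul1mx.
by exists (h0 *m h); [exact: isotropyM|rewrite mulmxA].
Qed.

Definition coset g (Gg : G g) : M :=
  exist _ [set g *m h | h in H] (ex_intro2 _ _ g Gg erefl).

Lemma coset_eq x y g : sval x g -> sval y g -> x = y.
Proof.
move=> /coset_mem xg /coset_mem yg; case: x y xg yg => [x xP] [y yP] /= xg yg.
have {xg yg} xy : x = y by rewrite xg yg.
by subst y; congr exist; exact: Prop_irrelevance.
Qed.

Lemma mem_coset g (Gg : G g) : sval (coset Gg) g.
Proof. by exists 1%:M; [exact: isotropy1|rewrite mulmx1]. Qed.

Definition rep x : V := s2val (cid2 (svalP x)).

Lemma rep_SO0 x : G (rep x). Proof. by rewrite /rep; case: cid2. Qed.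

Lemma rep_mem x : sval x (rep x).
Proof.
rewrite /rep; case: cid2 => g Gg /= ->.
by exists 1%:M; [exact: isotropy1|rewrite mulmx1].
Qed.

(** The default 0 off [G] is compatible with linear combinations and products; it does not affect
    derivatives along orbit curves, which lie in [G] near t = 0. *)
Definition lift f g : R := if pselect (G g) is left Gg then f (coset Gg) else 0.

Lemma liftE f g x : G g -> sval x g -> lift f g = f x.
Proof.
move=> Gg xg; rewrite /lift; case: pselect => // Gg'.
by congr f; apply: coset_eq xg; exact: mem_coset.
Qed.

Lemma lift_coset f g h x : G g -> G (h *m g) -> sval x g ->
  forall g', sval x g' -> G g' -> G (h *m g') ->
  lift f (h *m g) = lift f (h *m g').
Proof.
move=> Gg Ghg xg g' xg' Gg' Ghg'.
rewrite (liftE f Ghg (mem_coset Ghg)); apply/esym/(liftE f Ghg').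
have := xg'; rewrite (coset_mem xg) => -[k Hk <-] /=.
by exists k; rewrite // mulmxA.
Qed.

Definition local_extension f (U : set V) (F : V -> R) :=
  [/\ open U, Cinfty U F & forall x g, G g -> U g -> sval x g -> F g = f x].

Lemma smooth_local_extension (f : C) g0 : G g0 -> exists U F, U g0 /\ local_extension f U F.
Proof.
move=> Gg0; have /asboolP/(_ g0 Gg0)[U [F [[oU Ug0] sF FE]]] := smooth_funP f.
by exists U, F.
Qed.

Lemma conj_point_coset g g' x : sval x g -> sval x g' -> conj_point g = conj_point g'.
Proof.
move=> xg xg'; have := xg'; rewrite (coset_mem xg) => -[k Hk <-] /=.
rewrite /conj_point adjointmxM ?SS// -!mulmxA; congr (_ *m _).
have e := mulmx1C ((indefinite_OP k).1 (isotropy_O Hk)).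
by rewrite !mulmxA (isotropy_comm Hk) -(mulmxA _ k) e mulmx1.
Qed.

Definition sigma_at x : V := conj_point (rep x).

Lemma sigma_atE x g : sval x g -> sigma_at x = conj_point g.
Proof. by move=> xg; exact: conj_point_coset (rep_mem x) xg. Qed.

Lemma Cinfty_adj (U : set V) : open U -> Cinfty_mx U (fun g : V => adj g).
Proof.
move=> oU; apply: (@Cinfty_mx_eq _ _ _ _ U (fun g : V => S *m g^T *m S)) => //.
  by move=> g _; rewrite adjointmxE.
apply: Cinfty_mxM => //; last exact: Cinfty_mx_cst.
apply: Cinfty_mxM => //; first exact: Cinfty_mx_cst.
by apply: (@Cinfty_mx_tr _ _ _ _ U id) => //; exact: Cinfty_mx_id.
Qed.

Lemma Cinfty_conj_point : Cinfty_mx setT (@conj_point R p q).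
Proof.
have oT : open (setT : set V) by exact: openT.
apply: Cinfty_mxM => //; last exact: Cinfty_adj.
apply: (@Cinfty_mxM _ _ _ _ _ _ id) => //; [exact: Cinfty_mx_id|exact: Cinfty_mx_cst].
Qed.

Lemma smooth_sigma_comp (F : V -> R) : Cinfty setT F ->
  (fun x : M => F (sigma_at x)) \in @smooth R M.
Proof.
move=> sF; apply/asboolP => g0 Gg0; exists setT, (fun g => F (conj_point g)).
split=> [||x g Gg _ xg].
- by split=> //; exact: openT.
- by apply: (@Cinfty_compmx _ _ _ _ setT setT (@conj_point R p q)) => //; [exact: openT|exact: Cinfty_conj_point].
- by rewrite (sigma_atE xg).
Qed.

(** The entries of the map g H |-> g sigma_0 g^-1 from [M] to matrices; they take the place of
    coordinates. *)
Definition sigma_fun i j : C := SmoothFun (smooth_sigma_comp (@Cinfty_coord R _ _ setT i j)).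

Definition skew b : V := 2^-1 *: (b - adj b).

Lemma adj_skew b : adj (skew b) = - skew b.
Proof. by rewrite /skew linearZ/= linearB/= adjointmxK ?SS ?Str// -scalerN opprB. Qed.

(** The expansion cayley B = 1 + 2 B + 2 B^2 (1 - B)^-1 explains the argument t b / 2: the initial
    velocity is then b. *)
Lemma is_derive_cayley b g :
  is_derive (0 : R^o) (1 : R^o) (fun t : R^o => cayley ((t / 2) *: b) *m g) (b *m g).
Proof.
pose iv (t : R^o) : V := invmx (1%:M - (t / 2) *: b).
(* The difference quotient, in a form that makes sense and is continuous at t = 0. *)
pose psi (t : R^o) : V := b *m g + (t / 2) *: (b *m b *m iv t *m g).
pose D := [set t : R^o | \det (1%:M - (t / 2) *: b) != 0].
have oT : open (setT : set R^o) by exact: openT.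
have sb (U : set R^o) : open U -> Cinfty_mx U (fun t : R^o => 1%:M - (t / 2) *: b).
  move=> oU; apply: (@Cinfty_mxD _ _ _ _ U (fun=> 1%:M)) => //; first exact: Cinfty_mx_cst.
  apply: Cinfty_mxN => //; apply: (@Cinfty_mxZ _ _ _ _ U (fun t : R^o => t / 2)) => //; last exact: Cinfty_mx_cst.
  apply: (@CinftyM _ _ _ (fun t : R^o => t : R)) => //; last exact: Cinfty_cst.
  apply: (@Cinfty_linear R R^o U idfun) => t; exact: cvg_id.
have oD : open D.
  rewrite (_ : D = (fun t : R^o => \det (1%:M - (t / 2) *: b)) @^-1` [set u | u != 0])//.
  apply: open_comp; last exact: open_neq.
  move=> t _; apply: (@Cinfty_continuous _ _ setT) => //.
  by apply: Cinfty_det => //; exact: sb.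
have D0 : D 0 by rewrite /D /= mul0r scale0r subr0 det1 oner_neq0.
have spsi : Cinfty_mx D psi.
  apply: Cinfty_mxD => //; first exact: Cinfty_mx_cst.
  apply: (@Cinfty_mxZ _ _ _ _ D (fun t : R^o => t / 2)) => //.
    apply: (@CinftyM _ _ _ (fun t : R^o => t : R)) => //; last exact: Cinfty_cst.
    apply: (@Cinfty_linear R R^o D idfun) => t; exact: cvg_id.
  apply: Cinfty_mxM => //; last exact: Cinfty_mx_cst.
  apply: Cinfty_mxM => //; first exact: Cinfty_mx_cst.
  by apply: Cinfty_invmx => //; exact: sb.
have cpsi : {for (0 : R^o), continuous psi} by exact: Cinfty_mx_continuous spsi D0.
have psi0 : psi 0 = b *m g by rewrite /psi mul0r scale0r addr0.
have cayE t : D t -> cayley ((t / 2) *: b) *m g = g + t *: psi t.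
  move=> Dt; have u : 1%:M - (t / 2) *: b \in unitmx by rewrite unitmxE unitfE.
  set B := (t / 2) *: b in u *.
  have ivE : iv t = 1%:M + B *m iv t.
    by have := mulmxV u; rewrite mulmxBl mul1mx => /eqP; rewrite subr_eq => /eqP.
  have -> : cayley B = 2%:R *: iv t - 1%:M.
    rewrite /cayley -/(iv t); have -> : 1%:M + B = 2%:R *: 1%:M - (1%:M - B).
      by apply/matrixP => i j; rewrite !mxE; case: (i == j); rewrite ?mulr1n ?mulr0n; ring.
    by rewrite mulmxBr -scalemxAr mulmx1 /iv mulVmx.
  have -> : 2%:R *: iv t - 1%:M = 1%:M + 2%:R *: B + 2%:R *: (B *m B *m iv t).
    have {1}-> : iv t = 1%:M + B + B *m B *m iv t.
      by rewrite {1}ivE {1}ivE mulmxDr mulmx1 mulmxA addrA.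
    move: (B *m B *m iv t) => W.
    by apply/matrixP => i j; rewrite !mxE; case: (i == j); rewrite ?mulr1n ?mulr0n; ring.
  rewrite /psi /B -!scalemxAl -!scalemxAr -!scalemxAl !scalerA !mulmxDl mul1mx -!scalemxAl.
  by rewrite scalerDr scalerA addrA; congr (_ + _ *: _ + _ *: _); field.
have H : (fun h : R^o => h^-1 *: (((fun t : R^o => cayley ((t / 2) *: b) *m g) \o shift 0) (h *: (1 : R^o)) - cayley ((0 / 2) *: b) *m g)) @ 0^' --> b *m g.
  rewrite -psi0.
  have cw : psi @ (0 : R^o)^' --> psi 0 by apply: cvg_within_filter; exact: cpsi.
  apply: cvg_trans cw; apply: near_eq_cvg.
  have nD : \forall h \near (0 : R^o)^', D h by apply: nbhs_dnbhs; exact: open_nbhs_nbhs.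
  near=> h.
  have h0 : h != 0 by near: h; exact: nbhs_dnbhs_neq.
  have Dh : D h by near: h.
  rewrite /= addr0 [h *: _]mulr1 cayE// cayE// scale0r addr0 addrC addKr scalerA mulVf// scale1r.
  by [].
apply: DeriveDef; first by apply/cvg_ex; exists (b *m g).
exact: cvg_lim H.
Unshelve. all: by end_near. Qed.

End Cosets.

(** * Fundamental vector fields of the group action *)

Section FundamentalFields.
Variables (R : realType) (p q : nat).
Local Notation V := 'M[R]_(p + p + q).
Local Notation S := (signature_form R (p + p) q).
Local Notation G := (indefinite_SO0 R (p + p) q).
Local Notation H := (isotropy R p q).
Local Notation adj := (adjointmx S).
Local Notation SS := (signature_formK R (p + p) q).
Local Notation M := (period_domain R p q).
Local Notation C := (smoothFun M).
Implicit Types (g h b : V) (x : M) (f : M -> R).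

(* The Cayley transform stands in for the exponential: only the first-order
   behaviour at t = 0 matters. *)
Definition orbit_curve b g (t : R^o) : V := cayley ((t / 2) *: skew b) *m g.

Lemma orbit_curve_SO0 b g : G g -> \forall t \near (0 : R^o), G (orbit_curve b g t).
Proof.
move=> Gg; have [r r0 rP] := cayley_SO0 R (p + p) q.
have : \forall t \near (0 : R^o), `|(t / 2) *: skew b| < r.
  have c : (fun t : R^o => (t / 2) *: skew b) @ (0 : R^o) --> (0 / 2 : R) *: skew b.
    by apply: cvgZr_tmp; apply: cvgM; [exact: cvg_id|exact: cvg_cst].
  rewrite mul0r scale0r in c.
  have : \forall t \near (0 : R^o), ball (0 : V) r ((t / 2) *: skew b).
    by apply: c; exact: nbhsx_ballx.
  apply: filterS => t.
  by rewrite -ball_normE /ball_/= sub0r normrN.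
apply: filterS => t tr; apply: rP => //.
by rewrite linearZ/= adj_skew scalerN.
Qed.

Lemma orbit_curve0 b g : orbit_curve b g 0 = g.
Proof. by rewrite /orbit_curve mul0r scale0r /cayley subr0 addr0 invmx1 !mul1mx. Qed.

Definition orbit_derive b f g : R :=
  'D_(1 : R^o) (fun t : R^o => lift f (orbit_curve b g t) : R^o) (0 : R^o).

Lemma is_derive_orbit b f U F g : G g -> U g -> local_extension f U F ->
  is_derive (0 : R^o) (1 : R^o) (fun t : R^o => lift f (orbit_curve b g t) : R^o)
    ('D_(skew b *m g) F g).
Proof.
move=> Gg Ug [oU sF FE].
have dc : is_derive (0 : R^o) (1 : R^o) (orbit_curve b g) (skew b *m g) by exact: is_derive_cayley.
have dfc : differentiable (orbit_curve b g) (0 : R^o) by apply/derivable1_diffP; have [] := dc.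
have dF : differentiable F (orbit_curve b g 0).
  by rewrite orbit_curve0; exact: Cinfty_differentiable sF Ug.
have nr : \forall t \near (0 : R^o), (F \o orbit_curve b g : R^o -> R^o) t = lift f (orbit_curve b g t).
  have cU : \forall t \near (0 : R^o), U (orbit_curve b g t).
    have c := differentiable_continuous dfc.
    by apply: c; rewrite orbit_curve0; exact: open_nbhs_nbhs.
  apply: filterS (filterI cU (orbit_curve_SO0 b Gg)) => t [Ut Gt] /=.
  rewrite (FE _ _ Gt Ut (mem_coset Gt)).
  by rewrite (liftE f Gt (mem_coset Gt)).
apply: (near_eq_is_derive nr).
apply: DeriveDef; first exact/diff_derivable/differentiable_comp.
rewrite deriveE; last exact/differentiable_comp.
rewrite diff_comp// /=.
have -> : 'd (orbit_curve b g) (0 : R^o) (1 : R^o) = skew b *m g.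
  by rewrite -deriveE//; have [_ ->] := dc.
by rewrite -deriveE// orbit_curve0.
Qed.

Lemma orbit_deriveE b f U F g : G g -> U g -> local_extension f U F ->
  orbit_derive b f g = 'D_(skew b *m g) F g.
Proof. by move=> Gg Ug e; have [_] := is_derive_orbit b Gg Ug e. Qed.

(** Curves move by left multiplication, which commutes with the right action of [H]. Hence the
    arbitrary choice made by [rep] does no harm, and smoothness may be checked with [g] itself as
    the variable. *)
Lemma orbit_derive_coset b f x g g' : G g -> G g' -> sval x g -> sval x g' ->
  orbit_derive b f g = orbit_derive b f g'.
Proof.
move=> Gg Gg' xg xg'; apply: near_eq_derive.
apply: filterS (filterI (orbit_curve_SO0 b Gg) (orbit_curve_SO0 b Gg')) => t [Gt Gt'].
exact: (lift_coset f Gg Gt xg xg' Gg' Gt').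
Qed.

Definition fund_fun b f x : R := orbit_derive b f (rep x).

Lemma fund_funE b f U F x g : G g -> U g -> sval x g -> local_extension f U F ->
  fund_fun b f x = 'D_(skew b *m g) F g.
Proof.
move=> Gg Ug xg e; rewrite -(orbit_deriveE b Gg Ug e).
exact: (orbit_derive_coset b f (rep_SO0 x) Gg (rep_mem x) xg).
Qed.

Lemma fund_smooth b (f : C) : fund_fun b f \in @smooth R M.
Proof.
apply/asboolP => g0 Gg0; have [U [F [Ug0 e]]] := smooth_local_extension f Gg0.
have [oU sF FE] := e.
exists U, (fun g => \sum_(ij : 'I_(p + p + q) * 'I_(p + p + q))
  (skew b *m g) ij.1 ij.2 * 'D_(delta_mx ij.1 ij.2) F g); split=> //.
  apply: Cinfty_sum => // ij; apply: CinftyM => //; last exact: Cinfty_derive.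
  have := @Cinfty_mxM _ _ _ _ _ U (fun=> skew b) id oU (Cinfty_mx_cst _ _) (Cinfty_mx_id _).
  exact.
move=> x g Gg Ug xg; rewrite (fund_funE b Gg Ug xg e) derive_coord ?pair_big//.
exact: Cinfty_differentiable sF Ug.
Qed.

Definition fund b (f : C) : C := SmoothFun (fund_smooth b f).

Lemma is_derive_lift b (f : C) x :
  is_derive (0 : R^o) (1 : R^o) (fun t : R^o => lift f (orbit_curve b (rep x) t) : R^o)
    (fund b f x).
Proof.
have [U [F [Ug e]]] := smooth_local_extension f (rep_SO0 x).
by rewrite /= (fund_funE b (rep_SO0 x) Ug (rep_mem x) e); exact: is_derive_orbit (rep_SO0 x) Ug e.
Qed.

Lemma lift_linear (c : R) (f g : C) h : lift (c *: f + g : C) h = c * lift f h + lift g h.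
Proof. by rewrite /lift; case: pselect => // _; rewrite mulr0 addr0. Qed.

Lemma lift_mul (f g : C) h : lift (f * g : C) h = lift f h * lift g h.
Proof. by rewrite /lift; case: pselect => // _; rewrite mulr0. Qed.

Let path b f x : R^o -> R^o := fun t => lift f (orbit_curve b (rep x) t).

Let is_derive_path b (f : C) x : is_derive (0 : R^o) (1 : R^o) (path b f x) (fund b f x).
Proof. exact: is_derive_lift. Qed.

Let fund_path b (f : C) x (F : R^o -> R^o) d : path b f x = F ->
  is_derive (0 : R^o) (1 : R^o) F d -> fund b f x = d.
Proof.
move=> e [_ <-]; have [_ <-] := is_derive_path b f x.
by rewrite e.
Qed.

Lemma fund_linear b (c : R) (f g : C) x : fund b (c *: f + g) x = c * fund b f x + fund b g x.
Proof.
apply: (fund_path _ (is_deriveD (is_deriveZ c (is_derive_path b f x)) (is_derive_path b g x))).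
by apply/funext => t; exact: lift_linear.
Qed.

Lemma fund_Leibniz b (f g : C) x : fund b (f * g) x = fund b f x * g x + f x * fund b g x.
Proof.
have path0 (k : C) : path b k x 0 = k x.
  by rewrite /path orbit_curve0 (liftE _ (rep_SO0 x) (rep_mem x)).
have := @fund_path b (f * g) x _ _ _ (is_deriveM (is_derive_path b f x) (is_derive_path b g x)).
rewrite !path0 => H; rewrite H; first by rewrite addrC; congr (_ + _); exact: mulrC.
by apply/funext => t; exact: lift_mul.
Qed.

Lemma fund_derivation b : (fund b : C -> C^o) \in @is_derivation R M.
Proof.
apply/asboolP; split=> [c f g|f g]; apply/val_inj/funext => x.
  exact: fund_linear.
exact: fund_Leibniz.
Qed.

Definition fundamental_field b : vectorField M := VectorField (fund_derivation b).

Lemma fundamental_field_sigma b i j x :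
  (fundamental_field b (@sigma_fun R p q i j) : C) x =
  (skew b *m sigma_at x - sigma_at x *m skew b) i j.
Proof.
pose g := rep x; have Gg := rep_SO0 x.
have oT : open (setT : set V) by exact: openT.
have e : local_extension (@sigma_fun R p q i j) setT (fun g => conj_point g i j).
  split=> //; first exact: Cinfty_conj_point.
  by move=> y h Gh _ yh /=; rewrite (sigma_atE yh).
rewrite [LHS](fund_funE b Gg I (rep_mem x) e) /sigma_at -/g.
set v := skew b *m g.
pose L : V := v *m sigma0 R p q *m adj g + g *m sigma0 R p q *m adj v.
have -> : skew b *m conj_point g - conj_point g *m skew b = L.
  by rewrite /L /v adjointmxM ?SS// adj_skew mulmxN mulmxN !mulmxA.
pose Q : V := v *m sigma0 R p q *m adj v.
(* [conj_point] is quadratic, so the expansion stops at t^2. *)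
have E (t : R) : conj_point (t *: v + g) = conj_point g + t *: L + (t * t) *: Q.
  rewrite /conj_point /L /Q linearD/= linearZ/= !mulmxDl !mulmxDr -!scalemxAl -!scalemxAr.
  by apply/matrixP => k l; rewrite !entryE; ring.
apply: cvg_lim => //.
have cw : (fun t : R^o => L i j + t * Q i j) @ (0 : R^o)^' --> L i j.
  have c0 : (fun t : R^o => L i j + t * Q i j) @ (0 : R^o) --> L i j + 0 * Q i j.
    by apply: cvgD; [exact: cvg_cst|apply: cvgM; [exact: cvg_id|exact: cvg_cst]].
  by rewrite mul0r addr0 in c0; exact: cvg_within_filter.
apply: cvg_trans cw; apply: near_eq_cvg; near=> t.
have t0 : t != 0 by near: t; exact: nbhs_dnbhs_neq.
rewrite /= E !entryE /GRing.scale/=; by field.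
Unshelve. all: by end_near. Qed.

End FundamentalFields.

(** * Tangent vectors are determined by sigma *)

Section TangentVectors.
Variables (R : realType) (p q : nat).
Local Notation V := 'M[R]_(p + p + q).
Local Notation S := (signature_form R (p + p) q).
Local Notation O := (indefinite_O R (p + p) q).
Local Notation G := (indefinite_SO0 R (p + p) q).
Local Notation H := (isotropy R p q).
Local Notation adj := (adjointmx S).
Local Notation Str := (signature_form_tr R (p + p) q).
Local Notation SS := (signature_formK R (p + p) q).
Local Notation M := (period_domain R p q).
Local Notation C := (smoothFun M).
Local Notation sigma_at := (@sigma_at R p q).
Local Notation sigma_fun := (@sigma_fun R p q).
Variables (x : M) (v : C -> R).
Hypothesis tv : tangent_at x v.

Let vD f g : v (f + g) = v f + v g.
Proof. by have := tv.1 1 f g; rewrite scale1r mul1r. Qed.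

Let v0 : v 0 = 0.
Proof. by apply: (@addrI _ (v 0)); rewrite -vD !addr0. Qed.

Let vZ c f : v (c *: f) = c * v f.
Proof. by have := tv.1 c f 0; rewrite addr0 v0 addr0. Qed.

Lemma tangent_cst c : v (c *: (1 : C)) = 0.
Proof.
rewrite vZ; have := tv.2 (1 : C) (1 : C); rewrite mul1r /= mulr1 mul1r.
by rewrite -[LHS]addr0 => /addrI <-; rewrite mulr0.
Qed.

Hypothesis v_sigma : forall i j, v (sigma_fun i j) = 0.

(** By Hadamard's lemma at [sigma_at x], the function is a constant plus a sum of products whose
    first factor vanishes at [x] and is killed by [v]. *)
Lemma tangent_sigma_comp (F : V -> R) (sF : Cinfty setT F) :
  v (SmoothFun (smooth_sigma_comp sF)) = 0.
Proof.
have [K [sK KE]] := Hadamard (sigma_at x) sF.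
pose KC i j : C := SmoothFun (smooth_sigma_comp (sK i j)).
have -> : SmoothFun (smooth_sigma_comp sF) = F (sigma_at x) *: (1 : C) +
    \sum_i \sum_j (sigma_fun i j - sigma_at x i j *: (1 : C)) * KC i j.
  apply/val_inj/funext => y; rewrite [RHS]evD evZ ev1 mulr1 ev_sum.
  apply/eqP; rewrite addrC -subr_eq; apply/eqP; rewrite [LHS]KE; apply: eq_bigr => i _.
  by rewrite ev_sum; apply: eq_bigr => j _; rewrite evM evD evN evZ ev1 mulr1.
rewrite vD tangent_cst add0r.
have vsum (I : Type) (r : seq I) (f : I -> C) : v (\sum_(i <- r) f i) = \sum_(i <- r) v (f i).
  by elim: r => [|i r IHr]; rewrite ?big_nil ?v0// !big_cons vD IHr.
rewrite vsum big1// => i _; rewrite vsum big1// => j _.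
have vB : v (sigma_fun i j - sigma_at x i j *: (1 : C)) = 0.
  by rewrite -scaleNr vD tangent_cst v_sigma addr0.
have e0 : (sigma_fun i j - (sigma_at x i j *: (1 : C) : C)) x = 0 :> R.
  by rewrite evD evN evZ ev1 mulr1 subrr.
by rewrite tv.2 vB mul0r add0r [X in X * _]e0 mul0r.
Qed.

(* Near x every smooth function is a smooth function of sigma, by the local
   section; a cutoff makes the latter global and Hadamard's lemma applies. *)
Lemma tangent_eq0 (f : C) : v f = 0.
Proof.
pose g0 := rep x; have Gg0 := rep_SO0 x; pose P0 := sigma_at x.
have P0E : P0 = conj_point g0 by [].
have [U [F [Ug0 [oU sF FE]]]] := smooth_local_extension f Gg0.
have [W [Psi [oW WP0 sPsi Psi0 HPsi]]] := local_section Gg0.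
rewrite -P0E in WP0 Psi0.
have cPsi : {for P0, continuous Psi} by exact: Cinfty_mx_continuous sPsi WP0.
have [r r0 rP] : exists2 r : R, 0 < r & forall P, ball P0 r P ->
    [/\ W P, U (Psi P) & O (Psi P) -> G (Psi P)].
  have n1 : \forall P \near P0, W P by exact: open_nbhs_nbhs.
  have n2 : \forall P \near P0, U (Psi P).
    by apply: cPsi; rewrite Psi0; exact: open_nbhs_nbhs.
  have n3 : \forall P \near P0, O (Psi P) -> G (Psi P).
    by apply: (cPsi [set g | O g -> G g]); rewrite Psi0; exact: SO0_open.
  have /nbhs_ballP[r r0 rP] : nbhs P0 [set P | [/\ W P, U (Psi P) & O (Psi P) -> G (Psi P)]].
    by apply: filterS (filterI n1 (filterI n2 n3)) => P [? []].
  by exists r => // P /rP.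
have oB : open (ball P0 r) by exact: ball_open.
have sF2 : Cinfty (ball P0 r) (fun P => F (Psi P)).
  apply: (@Cinfty_compmx _ _ _ _ (ball P0 r) U Psi) => //; last by move=> P /rP[].
  move=> i j; apply: (@Cinfty_subset _ _ W) (sPsi i j).
  by move=> P /rP[].
have [chi [schi chi1 schiF chi0]] := Cinfty_cutoff r0 sF2.
pose chiC : C := SmoothFun (smooth_sigma_comp schi).
pose EC : C := SmoothFun (smooth_sigma_comp schiF).
(* [EC] and [chiC] are smooth functions of sigma, hence killed by [v], and the cutoff is 1 at [x]:
   the Leibniz rule then leaves exactly [v f]. *)
have EE : EC = chiC * f.
  apply/val_inj/funext => y /=; rewrite !fctE /=.
  have [By|nBy] := pselect (ball P0 r (sigma_at y)); last by rewrite (chi0 _ nBy) !mul0r.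
  congr (_ * _); have [Wy Uy OGy] := rP _ By.
  set g := rep y; have Gg := rep_SO0 y; have Og := SO0_O Gg.
  have [Os sE] := HPsi _ Wy (conj_point_order3 Og).
  have Gs := OGy Os; set s := Psi _ in Uy Os sE Gs *.
  apply: FE => //.
  have ag := (indefinite_OP g).1 Og; have ga := mulmx1C ag.
  (* [g] and [s] conjugate sigma_0 to the same matrix, so they differ by an element of its
     centralizer. *)
  have Hh : H (adj g *m s).
    apply: isotropy_centralizer.
    - apply: indefinite_OM => //; apply/indefinite_OP.
      by rewrite adjointmxK ?SS ?Str.
    - have := congr1 determinant ga; rewrite det_mulmx (det_SO0 Gg) mul1r det1 => da.
      by rewrite det_mulmx da (det_SO0 Gs) mulr1.
    - rewrite -mulmxA -sE /sigma_at /conj_point -/g !mulmxA ag mul1mx.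
      by [].
  have := rep_mem y; rewrite -/g => yg; rewrite (coset_mem yg).
  by exists (adj g *m s); rewrite // mulmxA ga mul1mx.
have := tangent_sigma_comp schiF; rewrite -/EC EE tv.2.
rewrite (tangent_sigma_comp schi) mul0r add0r => H0.
by rewrite -[LHS]mul1r -chi1.
Qed.

End TangentVectors.

(** * Algebra of an element of order three *)

Section OrderThree.
Variables (C : comPzRingType) (n : nat) (S sigma : 'M[C]_n) (k : C).
Hypotheses (Str : S^T = S) (SS : S *m S = 1%:M).
Hypotheses (sigma3 : sigma *m sigma *m sigma = 1%:M) (k3 : 3 * (k * k) = 1).
Local Notation adj := (adjointmx S).
Hypothesis adj_sigma : adj sigma = sigma *m sigma.
Local Notation V := 'M[C]_n.
Implicit Types (A B x y z : V).

(** The inverse of sigma is written as its square, so that everything makes sense over a commutative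
    ring: the section is applied over [C^oo(M)] and again over R at a point. *)
Definition rot B : V := sigma *m B *m (sigma *m sigma).

(* Operations defined through an opaque specification are sealed: conversion
   tests would otherwise unfold products of matrices of smooth functions. *)
Fact mpart_sig : {f : V -> V | forall B, f B = (k * k) *: (2 *: B - rot B - rot (rot B))}.
Proof. by eexists. Qed.
Definition mpart := sval mpart_sig.
Lemma mpartE B : mpart B = (k * k) *: (2 *: B - rot B - rot (rot B)).
Proof. exact: svalP mpart_sig B. Qed.

Fact jop_sig : {f : V -> V | forall B, f B = k *: (rot B - rot (rot B))}.
Proof. by eexists. Qed.
Definition jop := sval jop_sig.
Lemma jopE B : jop B = k *: (rot B - rot (rot B)).
Proof. exact: svalP jop_sig B. Qed.
Fact bra_sig : {f : V -> V -> V | forall A B, f A B = A *m B - B *m A}.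
Proof. by eexists. Qed.
Definition bra := sval bra_sig.
Lemma braE A B : bra A B = A *m B - B *m A.
Proof. exact: svalP bra_sig A B. Qed.
Definition horizontal B := B + rot B + rot (rot B) = 0.

(** [ring] does not know that 3 k^2 = 1; inserting this factor on one side turns the identities into
    polynomial ones. *)
Let k3Z B : B = (3 * (k * k)) *: B. Proof. by rewrite k3 scale1r. Qed.

Lemma rot_is_linear : linear rot.
Proof. by move=> a A B; rewrite /rot mulmxDr mulmxDl -scalemxAr -scalemxAl. Qed.
HB.instance Definition _ := GRing.isLinear.Build C V V _ rot rot_is_linear.

Lemma rotD A B : rot (A + B) = rot A + rot B. Proof. exact: linearD. Qed.
Lemma rotN A : rot (- A) = - rot A. Proof. exact: linearN. Qed.
Lemma rotZ a A : rot (a *: A) = a *: rot A. Proof. exact: linearZ. Qed.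
Definition rotE := (rotD, rotN, rotZ).

Lemma mpart_is_linear : linear mpart.
Proof.
move=> a A B; rewrite !mpartE !linearP; apply/matrixP => i j; rewrite !entryE; ring.
Qed.
HB.instance Definition _ := GRing.isLinear.Build C V V _ mpart mpart_is_linear.

Lemma jop_is_linear : linear jop.
Proof.
move=> a A B; rewrite !jopE !linearP; apply/matrixP => i j; rewrite !entryE; ring.
Qed.
HB.instance Definition _ := GRing.isLinear.Build C V V _ jop jop_is_linear.

Lemma mpartN A : mpart (- A) = - mpart A. Proof. exact: linearN. Qed.
Lemma jopN A : jop (- A) = - jop A. Proof. exact: linearN. Qed.
Lemma jopD A B : jop (A + B) = jop A + jop B. Proof. exact: linearD. Qed.

Lemma braDl A B x : bra (A + B) x = bra A x + bra B x.
Proof. by rewrite !braE mulmxDl mulmxDr opprD addrACA. Qed.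
Lemma braC A B : bra A B = - bra B A.
Proof. by rewrite !braE opprB. Qed.
Lemma braDr A B x : bra x (A + B) = bra x A + bra x B.
Proof. by rewrite braC braDl opprD -!(braC x). Qed.
Lemma braZl a A x : bra (a *: A) x = a *: bra A x.
Proof. by rewrite !braE -scalemxAl -scalemxAr -scalerBr. Qed.
Lemma braZr a A x : bra x (a *: A) = a *: bra x A.
Proof. by rewrite !braE -scalemxAl -scalemxAr -scalerBr. Qed.
Lemma braNl A x : bra (- A) x = - bra A x.
Proof. by rewrite -scaleN1r braZl scaleN1r. Qed.
Lemma braNr A x : bra x (- A) = - bra x A.
Proof. by rewrite -scaleN1r braZr scaleN1r. Qed.

Lemma sigma3A : sigma *m (sigma *m sigma) = 1%:M. Proof. by rewrite mulmxA. Qed.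

Lemma sigma3K m (X : 'M[C]_(n, m)) : sigma *m (sigma *m (sigma *m X)) = X.
Proof. by rewrite !mulmxA sigma3 mul1mx. Qed.

Lemma rotM A B : rot (A *m B) = rot A *m rot B.
Proof.
by rewrite /rot -!mulmxA sigma3K. Qed.

Lemma rot3K B : rot (rot (rot B)) = B.
Proof. by rewrite /rot -!mulmxA !sigma3K sigma3A mulmx1. Qed.

Lemma rot_bra A B : rot (bra A B) = bra (rot A) (rot B).
Proof. by rewrite !braE linearB/= !rotM. Qed.

Lemma mxtrace_rot B : \tr (rot B) = \tr B.
Proof. by rewrite /rot mxtrace_mulC mulmxA sigma3 mul1mx. Qed.

Lemma adjD A B : adj (A + B) = adj A + adj B. Proof. exact: linearD. Qed.
Lemma adjN A : adj (- A) = - adj A. Proof. exact: linearN. Qed.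
Lemma adjZ a A : adj (a *: A) = a *: adj A. Proof. exact: linearZ. Qed.
Definition adjE := (adjD, adjN, adjZ).

Lemma adj_rot B : adj (rot B) = rot (adj B).
Proof. by rewrite /rot !adjointmxM// adj_sigma !mulmxA sigma3 mul1mx. Qed.

Lemma horizontal_rot2 B : horizontal B -> rot (rot B) = - B - rot B.
Proof. by move=> /eqP; rewrite addrC addr_eq0 opprD => /eqP. Qed.

Lemma horizontalZD c A B : horizontal A -> horizontal B -> horizontal (c *: A + B).
Proof.
rewrite /horizontal !rotE => hA hB.
have -> : 0 = c *: (A + rot A + rot (rot A)) + (B + rot B + rot (rot B)).
  by rewrite hA hB scaler0 addr0.
by apply/matrixP => i j; rewrite !entryE; ring.
Qed.

Lemma horizontalB A B : horizontal A -> horizontal B -> horizontal (A - B).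
Proof. by move=> hA hB; rewrite -[- B]scaleN1r addrC; exact: horizontalZD. Qed.

Lemma horizontal_mpart B : horizontal (mpart B).
Proof.
rewrite /horizontal !mpartE !rotE !rot3K.
by apply/matrixP => i j; rewrite !(entryE, mxE); ring.
Qed.

Lemma horizontal_jop B : horizontal (jop B).
Proof.
rewrite /horizontal !jopE !rotE !rot3K.
by apply/matrixP => i j; rewrite !entryE; ring.
Qed.

Lemma mpart_id B : horizontal B -> mpart B = B.
Proof.
move=> hB; rewrite !mpartE horizontal_rot2// [RHS]k3Z.
by apply/matrixP => i j; rewrite !entryE; ring.
Qed.

Lemma jop_mpart B : jop (mpart B) = jop B.
Proof.
rewrite !jopE !mpartE !rotE !rot3K [X in _ = k *: X]k3Z.
by apply/matrixP => i j; rewrite !entryE; ring.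
Qed.

Lemma jop_jop B : jop (jop B) = - mpart B.
Proof.
rewrite !jopE !mpartE !rotE !rot3K.
by apply/matrixP => i j; rewrite !entryE; ring.
Qed.

Lemma rot_vertical B : rot (B - mpart B) = B - mpart B.
Proof.
have e : B - mpart B = (k * k) *: (B + rot B + rot (rot B)).
  rewrite {1}[B]k3Z !mpartE.
  by apply/matrixP => i j; rewrite !entryE; ring.
rewrite e !rotE rot3K; congr (_ *: _).
by rewrite addrC addrA.
Qed.

Lemma rot_fixed_comm B : rot B = B -> B *m sigma = sigma *m B.
Proof.
move=> {1}<-; rewrite /rot -!mulmxA (mulmxA sigma sigma sigma) sigma3.
by rewrite mulmx1.
Qed.

Lemma comm_rot_fixed B : B *m sigma = sigma *m B -> rot B = B.
Proof. by move=> e; rewrite /rot -e -mulmxA sigma3A mulmx1. Qed.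

Lemma horizontal_inj B : horizontal B -> bra B sigma = 0 -> B = 0.
Proof.
move=> hB /eqP; rewrite braE subr_eq0 => /eqP/comm_rot_fixed rB.
move: hB; rewrite /horizontal !rB => e; rewrite [LHS]k3Z.
have -> : (3 * (k * k)) *: B = (k * k) *: (B + B + B).
  by apply/matrixP => i j; rewrite !entryE; ring.
by rewrite e scaler0.
Qed.

(** The test by which values of theta are identified: a difference commuting with sigma is fixed by
    rot, and if it is also horizontal, three times it is 0. *)
Lemma horizontal_ext A B : horizontal A -> horizontal B ->
  bra A sigma = bra B sigma -> A = B.
Proof.
move=> hA hB e; apply/eqP; rewrite -subr_eq0; apply/eqP.
by apply: horizontal_inj; [exact: horizontalB|rewrite braDl braNl e subrr].
Qed.

(* The (1,0)-part of m is abelian modulo the (0,1)-part: on an eigenspace of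
   rot the bracket multiplies the cube roots of unity, and zeta^2 = zeta^-1. *)
Lemma mpart_bra_jop x y : horizontal x -> horizontal y ->
  mpart (bra (jop x) y) = - jop (bra x y).
Proof.
move=> hx hy.
have rx := horizontal_rot2 hx; have ry := horizontal_rot2 hy.
have jx : jop x = k *: (2 *: rot x + x).
  by rewrite !jopE rx; apply/matrixP => i j; rewrite !entryE; ring.
have rjx : rot (jop x) = - k *: (2 *: x + rot x).
  rewrite jx !rotE rx.
  by apply/matrixP => i j; rewrite !entryE; ring.
have rrjx : rot (rot (jop x)) = k *: (x - rot x).
  rewrite rjx !rotE rx.
  by apply/matrixP => i j; rewrite !entryE; ring.
set J := jop x in jx rjx rrjx *.
rewrite !mpartE !jopE !rot_bra rx ry rrjx rjx jx.
rewrite !braE !(mulmxDl, mulmxDr, mulNmx, mulmxN) -!scalemxAl -!scalemxAr.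
rewrite !(mulmxDl, mulmxDr, mulNmx, mulmxN) -!scalemxAl -!scalemxAr.
move: (rot x) (rot y) => x1 y1.
set w1 := x *m y; set w2 := x1 *m y; set w3 := x *m y1; set w4 := x1 *m y1.
set w5 := y *m x; set w6 := y *m x1; set w7 := y1 *m x; set w8 := y1 *m x1.
rewrite [X in _ = - (k *: X)]k3Z.
by apply/matrixP => i j; rewrite !entryE; ring.
Qed.

Definition cpxop : V := k *: (sigma - sigma *m sigma).

Lemma rot_cpxop : rot cpxop = cpxop.
Proof.
apply: comm_rot_fixed; rewrite /cpxop -scalemxAl -scalemxAr; congr (_ *: _).
by rewrite mulmxBl mulmxBr mulmxA.
Qed.

Lemma mxtrace_cpx_rot B : \tr (cpxop *m rot B) = \tr (cpxop *m B).
Proof. by rewrite -{1}rot_cpxop -rotM mxtrace_rot. Qed.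

(** As [cpxop] is fixed by rot, the trace against it is the same for B and its rotations, so it sees
    only the isotropy part. *)
Lemma mxtrace_cpx_mpart B : \tr (cpxop *m mpart B) = 0.
Proof.
rewrite mpartE -scalemxAr mxtraceZ !mulmxBr !raddfB /= !mxtrace_cpx_rot.
by rewrite -scalemxAr mxtraceZ; ring.
Qed.

Lemma mxtrace_bra_l A B z : \tr (A *m bra B z) = \tr (bra A B *m z).
Proof.
rewrite !braE mulmxBr mulmxBl !raddfB /= !mulmxA; congr (_ - _).
by rewrite mxtrace_mulC mulmxA.
Qed.

(** [cpxop] is a polynomial in sigma, hence commutes with A. This is why a bracket may be replaced
    by its m-part inside the pairing. *)
Lemma mxtrace_cpx_vertical A z : rot A = A -> \tr (cpxop *m bra A z) = 0.
Proof.
move=> /rot_fixed_comm e; rewrite mxtrace_bra_l !braE.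
suff -> : cpxop *m A = A *m cpxop by rewrite subrr mul0mx linear0.
rewrite /cpxop -scalemxAl -scalemxAr; congr (_ *: _).
by rewrite mulmxBl mulmxBr -(mulmxA sigma) -e !mulmxA e.
Qed.

(** The form t is invariant under rot, and 1 + rot + rot^2 = 0 gives t (x, rot y) + t (rot x, y) = -
    t (x, y). Expanding jop z = k (2 rot z + z) then yields k^2 (5 - 2) t (x, y). *)
Lemma mxtrace_cpx_jop x y : horizontal x -> horizontal y ->
  \tr (cpxop *m bra (jop x) (jop y)) = \tr (cpxop *m bra x y).
Proof.
move=> hx hy.
have rx := horizontal_rot2 hx; have ry := horizontal_rot2 hy.
have jj z : horizontal z -> jop z = k *: (2 *: rot z + z).
  move=> hz; rewrite !jopE horizontal_rot2//.
  by apply/matrixP => i j; rewrite !entryE; ring.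
pose t a b := \tr (cpxop *m bra a b).
have tDl a b c : t (a + b) c = t a c + t b c by rewrite /t braDl mulmxDr raddfD.
have tDr a b c : t a (b + c) = t a b + t a c by rewrite /t braDr mulmxDr raddfD.
have tZl c a b : t (c *: a) b = c * t a b by rewrite /t braZl -scalemxAr mxtraceZ.
have tZr c a b : t a (c *: b) = c * t a b by rewrite /t braZr -scalemxAr mxtraceZ.
have tN a b : t (- a) b = - t a b by rewrite -scaleN1r tZl mulN1r.
have tr a b : t (rot a) (rot b) = t a b.
  by rewrite /t -rot_bra mxtrace_cpx_rot.
rewrite -/(t _ _) -[RHS]/(t x y) !jj// !(tDl, tDr, tZl, tZr) tr.
have e : t x (rot y) = - t x y - t (rot x) y.
  by rewrite -[in LHS](rot3K x) tr rx !(tDl, tN).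
rewrite e; transitivity ((3 * (k * k)) * t x y); last by rewrite k3 mul1r.
ring.
Qed.

Lemma cyclic_trace x y z : \tr (cpxop *m bra (bra x y) z) +
  \tr (cpxop *m bra (bra y z) x) + \tr (cpxop *m bra (bra z x) y) = 0.
Proof.
rewrite -!mxtraceD -!mulmxDr.
suff -> : bra (bra x y) z + bra (bra y z) x + bra (bra z x) y = 0.
  by rewrite mulmx0 linear0.
rewrite !braE !(mulmxBl, mulmxBr) !mulmxA.
by apply/matrixP => i j; rewrite !entryE; ring.
Qed.

Lemma adj_bra A B : adj (bra A B) = - bra (adj A) (adj B).
Proof. by rewrite !braE linearB/= !adjointmxM// opprB. Qed.

Lemma adj_mpart B : adj (mpart B) = mpart (adj B).
Proof. by rewrite !mpartE !(adjE, adj_rot). Qed.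

Lemma adj_jop B : adj (jop B) = jop (adj B).
Proof. by rewrite !jopE !(adjE, adj_rot). Qed.

(* The solution in m of the equation [theta, sigma] = d. *)
Definition theta_of d : V :=
  let eta := d *m (sigma *m sigma) in (k * k) *: (2 *: eta + rot eta).

Lemma theta_of_linear c d d' : theta_of (c *: d + d') = c *: theta_of d + theta_of d'.
Proof.
rewrite /theta_of mulmxDl -scalemxAl !rotE.
by apply/matrixP => i j; rewrite !entryE; ring.
Qed.

Section Differential.
Variable d : V.
Hypothesis d_sigma3 : d *m (sigma *m sigma) + sigma *m d *m sigma + sigma *m sigma *m d = 0.

Let eta := d *m (sigma *m sigma).

(** [d_sigma3] is the derivative of sigma^3 = 1; its three terms are eta and its two rotations. *)
Let heta : horizontal eta.
Proof.
have e1 : rot eta = sigma *m d *m sigma by rewrite /rot /eta -!mulmxA sigma3K.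
have e2 : rot (sigma *m d *m sigma) = sigma *m sigma *m d.
  by rewrite /rot -!mulmxA sigma3A mulmx1.
by rewrite /horizontal e1 e2.
Qed.

Lemma horizontal_theta_of : horizontal (theta_of d).
Proof.
rewrite /horizontal /theta_of -/eta !rotE horizontal_rot2// !rotE horizontal_rot2//.
by apply/matrixP => i j; rewrite !entryE; ring.
Qed.

(** The equation reads (1 - rot) theta = eta, and on m the inverse of 1 - rot is (2 + rot) / 3,
    because (1 - rot) (2 + rot) = 2 - rot - rot^2 = 3. *)
Lemma bra_theta_of : bra (theta_of d) sigma = d.
Proof.
have e B : B *m sigma - sigma *m B = (B - rot B) *m sigma.
  rewrite /rot mulmxBl -(mulmxA _ (sigma *m sigma)) sigma3 mulmx1.
  by [].
rewrite !braE e /theta_of -/eta !rotE horizontal_rot2//.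
set D := (X in X *m sigma = _); have -> : D = eta.
  by rewrite /D [RHS]k3Z; apply/matrixP => i j; rewrite !entryE; ring.
by rewrite /eta -mulmxA sigma3 mulmx1.
Qed.

(** The hypothesis is the derivative of [adj sigma = sigma *m sigma]. *)
Lemma adj_theta_of : adj d = d *m sigma + sigma *m d -> adj (theta_of d) = - theta_of d.
Proof.
move=> ad; have aeta : adj eta = - eta.
  rewrite /eta !adjointmxM// adj_sigma ad.
  have e4 : sigma *m sigma *m (sigma *m sigma) = sigma by rewrite mulmxA sigma3 mul1mx.
  rewrite e4 mulmxDr !mulmxA; apply/eqP; rewrite -addr_eq0 addrC; apply/eqP.
  by rewrite -[RHS]d_sigma3 !mulmxA addrA.
rewrite /theta_of -/eta !adjE adj_rot aeta !rotE.
by apply/matrixP => i j; rewrite !entryE; ring.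
Qed.

End Differential.

End OrderThree.

(** * Traces of endomorphisms of a matrix space *)

Section LinearTrace.
Variables (C : comPzRingType) (n : nat).
Local Notation V := 'M[C]_n.

Definition ltrace (f : V -> V) : C := \sum_a \sum_b f (delta_mx a b) a b.

Lemma ltraceD (f g : V -> V) : ltrace (fun B => f B + g B) = ltrace f + ltrace g.
Proof.
rewrite /ltrace -big_split; apply: eq_bigr => a _ /=; rewrite -big_split.
by apply: eq_bigr => b _ /=; rewrite mxE.
Qed.

Lemma ltraceZ c (f : V -> V) : ltrace (fun B => c *: f B) = c * ltrace f.
Proof.
rewrite /ltrace mulr_sumr; apply: eq_bigr => a _ /=; rewrite mulr_sumr.
by apply: eq_bigr => b _ /=; rewrite mxE.
Qed.

Lemma ltraceN (f : V -> V) : ltrace (fun B => - f B) = - ltrace f.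
Proof.
rewrite -mulN1r -ltraceZ /ltrace; apply: eq_bigr => a _; apply: eq_bigr => b _.
by rewrite scaleN1r.
Qed.

Lemma eq_ltrace (f g : V -> V) : f =1 g -> ltrace f = ltrace g.
Proof. by move=> fg; apply: eq_bigr => a _; apply: eq_bigr => b _; rewrite fg. Qed.

Lemma mul_delta_entry (P Q : V) a b c d :
  (P *m delta_mx a b *m Q) c d = P c a * Q b d.
Proof.
rewrite mxE (bigD1 b)//= big1 ?addr0; last first.
  move=> i ib; rewrite mxE big1 ?mul0r// => j _.
  by rewrite mxE (negPf ib) andbF mulr0.
rewrite mxE (bigD1 a)//= big1 ?addr0; last first.
  by move=> i ia; rewrite mxE (negPf ia) mulr0.
by rewrite mxE !eqxx mulr1.
Qed.

Lemma ltrace_mul (P Q : V) : ltrace (fun B => P *m B *m Q) = \tr P * \tr Q.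
Proof.
rewrite /ltrace /mxtrace mulr_suml; apply: eq_bigr => a _; rewrite mulr_sumr.
by apply: eq_bigr => b _; rewrite mul_delta_entry.
Qed.

(** The transposition in the adjoint contracts the two outer factors with each other: one trace
    arises instead of a product of two. *)
Lemma ltrace_adj (S P Q : V) : S^T = S ->
  ltrace (fun B => P *m adjointmx S B *m Q) = \tr (adjointmx S P *m Q).
Proof.
move=> Str; rewrite /ltrace.
have e a b : (P *m adjointmx S (delta_mx a b) *m Q) a b = (P *m S) a b * (S *m Q) a b.
  rewrite adjointmxE trmx_delta !mulmxA -(mulmxA (P *m S *m delta_mx b a)).
  exact: mul_delta_entry.
under eq_bigr do under eq_bigr do rewrite e.
have -> : adjointmx S P *m Q = (P *m S)^T *m (S *m Q).
  by rewrite adjointmxE trmx_mul Str !mulmxA.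
rewrite exchange_big /mxtrace; apply: eq_bigr => b _; rewrite [RHS]mxE.
by apply: eq_bigr => a _; rewrite [in RHS]mxE.
Qed.

End LinearTrace.

Section TraceFormula.
Variables (C : comPzRingType) (n : nat) (S sigma : 'M[C]_n) (k half : C).
Hypotheses (Str : S^T = S) (SS : S *m S = 1%:M).
Hypotheses (sigma3 : sigma *m sigma *m sigma = 1%:M) (hh : 2 * half = 1).
Local Notation adj := (adjointmx S).
Hypothesis adj_sigma : adj sigma = sigma *m sigma.

(** The skew part restricts the trace to the Lie algebra, and [jop] kills the brackets of Z with
    isotropy elements, so this is the trace over m. The terms without [adj] are products of traces
    and give [\tr sigma]; those with [adj] are single traces and give the 1. *)
Lemma ltrace_jop_bra Z : adj Z = - Z -> Z *m sigma = sigma *m Z ->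
  ltrace (fun B => jop sigma k (bra Z (half *: (B - adj B)))) =
  (\tr sigma + 1) * \tr (cpxop sigma k *m Z).
Proof.
move=> aZ Zs.
have s3A : sigma *m (sigma *m sigma) = 1%:M by rewrite mulmxA.
have s3K (X : 'M[C]_n) : sigma *m (sigma *m (sigma *m X)) = X.
  by rewrite !mulmxA sigma3 mul1mx.
have tss : \tr (sigma *m sigma) = \tr sigma by rewrite -adj_sigma mxtrace_adjoint.
(* Up to sign [tau] is the only trace involving Z: [adj] negates Z and exchanges sigma with its
   square. *)
pose tau := \tr (sigma *m Z).
have tau1 : \tr (Z *m sigma) = tau by rewrite mxtrace_mulC.
have tau2 : \tr (Z *m (sigma *m sigma)) = - tau.
  rewrite -(mxtrace_adjoint SS) adjointmxM// adjointmxM// adj_sigma aZ mulmxN -!mulmxA s3K.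
  by rewrite raddfN.
have tau3 : \tr (sigma *m sigma *m Z) = - tau by rewrite mxtrace_mulC.
have trA : \tr (cpxop sigma k *m Z) = k * (2 * tau).
  rewrite /cpxop -scalemxAl mxtraceZ mulmxBl raddfB /= tau3 opprK -/tau; congr (_ * _).
  by ring.
pose ff (X : 'M[C]_n -> 'M[C]_n) B := sigma *m Z *m X B *m (sigma *m sigma)
  + - (sigma *m X B *m (Z *m (sigma *m sigma)))
  + - (sigma *m sigma *m Z *m X B *m sigma) + sigma *m sigma *m X B *m (Z *m sigma).
have fE B : jop sigma k (bra Z (half *: (B - adj B))) = (k * half) *: (ff id B + - ff adj B).
  rewrite !jopE /rot !braE -!scalemxAl -!scalemxAr -scalerBr -!scalemxAr -!scalemxAl -!scalemxAr.
  rewrite -scalemxAl -scalerBr scalerA /ff; congr (_ *: _).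
  rewrite !(mulmxDl, mulmxDr, mulmxN, mulNmx) -!mulmxA !s3K.
  by apply/matrixP => i j; rewrite !entryE; ring.
rewrite (eq_ltrace fE) ltraceZ ltraceD ltraceN /ff !(ltraceD, ltraceN).
rewrite !ltrace_mul !ltrace_adj// tss tau1 tau2 tau3 -/tau trA.
rewrite !adjointmxM// adj_sigma aZ !mulNmx !raddfN /=.
have e1 : \tr (Z *m (sigma *m sigma) *m (sigma *m sigma)) = tau.
  by rewrite -!mulmxA s3K.
have e2 : \tr (sigma *m sigma *m (Z *m (sigma *m sigma))) = tau.
  by rewrite mxtrace_mulC -!mulmxA s3K.
have e3 : \tr (Z *m (sigma *m sigma *m (sigma *m sigma)) *m sigma) = - tau.
  by rewrite -!mulmxA s3K.
have e4 : \tr (sigma *m sigma *m (sigma *m sigma) *m (Z *m sigma)) = - tau.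
  by rewrite -!mulmxA s3K mxtrace_mulC -mulmxA.
rewrite e1 e2 e3 e4.
transitivity ((\tr sigma + 1) * (k * (2 * tau)) * (2 * half)); last by rewrite hh mulr1.
ring.
Qed.

End TraceFormula.

(** * Positivity of the form at the base point *)

Section Positivity.
Variables (R : realType) (p q : nat).
Local Notation S := (signature_form R (p + p) q).
Local Notation J := (standard_J R p).
Local Notation adj := (adjointmx S).
Local Notation k := ((sqrt3 R)^-1).
Local Notation sigma0 := (sigma0 R p q).

Lemma mxtrace_tr_mul_ge0 m n (A : 'M[R]_(m, n)) : 0 <= \tr (A^T *m A).
Proof.
rewrite /mxtrace sumr_ge0// => i _; rewrite mxE sumr_ge0// => j _.
by rewrite mxE -expr2 sqr_ge0.
Qed.

Lemma mxtrace_tr_mul_eq0 m n (A : 'M[R]_(m, n)) : \tr (A^T *m A) = 0 -> A = 0.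
Proof.
move=> H; apply/matrixP => i j; rewrite [RHS]mxE.
have H1 l : true -> 0 <= (A^T *m A) l l.
  by move=> _; rewrite mxE sumr_ge0// => i' _; rewrite mxE -expr2 sqr_ge0.
have : (A^T *m A) j j = 0 by exact: (psumr_eq0P H1 H).
rewrite mxE => H2.
have H3 l : true -> 0 <= A^T j l * A l j by move=> _; rewrite mxE -expr2 sqr_ge0.
have : A^T j i * A i j = 0 by exact: (psumr_eq0P H3 H2).
by rewrite mxE => /eqP; rewrite -expr2 sqrf_eq0 => /eqP.
Qed.

(** Such an x has blocks P, Q, Q^T, 0 with P skew and anticommuting with J, and the form is 2 (|P|^2
    + |Q|^2). On Q, [jop] is left multiplication by J, but on P it is minus that; this reversal on
    the compact directions is what makes both terms positive. *)
Lemma cpx_form_pos0 x : adj x = - x -> horizontal sigma0 x -> x != 0 ->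
  0 < \tr (cpxop sigma0 k *m bra x (jop sigma0 k x)).
Proof.
rewrite -[x]submxK; move: (ulsubmx x) (ursubmx x) (dlsubmx x) (drsubmx x) => {x} P Q Q' D.
set x := block_mx _ _ _ _ => ax hx x0.
have [PT QT] : P^T = - P /\ Q' = Q^T.
  move: ax; rewrite /x adjointmxE /signature_form tr_block_mx !mulmx_block opp_block_mx.
  rewrite !(mul0mx, mulmx0, addr0, add0r, mul1mx, mulmx1, mulmxN, mulNmx).
  by move=> /eq_block_mx[-> _ /oppr_inj <- _].
have rr := rot3_sqr R p.
have ss : sigma0 *m sigma0 = block_mx (rot3 R p)^T 0 0 1%:M.
  by rewrite /sigma0 mulmx_block !(mul0mx, mulmx0, addr0, add0r, mul1mx, mulmx1) rr.
have rotE X Y Z W : rot sigma0 (block_mx X Y Z W) =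
    block_mx (rot3 R p *m X *m (rot3 R p)^T) (rot3 R p *m Y) (Z *m (rot3 R p)^T) W.
  by rewrite /rot ss /sigma0 !mulmx_block !(mul0mx, mulmx0, addr0, add0r, mul1mx, mulmx1).
have rtt : (rot3 R p)^T *m (rot3 R p)^T = rot3 R p by rewrite -trmx_mul rr trmxK.
have rot2E X Y Z W : rot sigma0 (rot sigma0 (block_mx X Y Z W)) =
    block_mx ((rot3 R p)^T *m X *m rot3 R p) ((rot3 R p)^T *m Y) (Z *m rot3 R p) W.
  by rewrite !rotE !mulmxA rr -!mulmxA rtt.
have [D0 PJ] : D = 0 /\ J *m P *m J = P.
  move: hx; rewrite /horizontal rot2E rotE !add_block_mx -[0]block_mx0.
  move=> /eq_block_mx[hP _ _ hD]; split.
    have : 3%:R *: D = 0 by rewrite -hD scaler_nat !mulrS mulr0n addr0 addrA.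
    by move=> /eqP; rewrite scaler_eq0 pnatr_eq0 => /eqP.
  apply/eqP; rewrite eq_sym -subr_eq0; apply/eqP.
  have : (3 / 2) *: (P - J *m P *m J) = 0.
    rewrite -hP rot3_tr /rot3 !(mulmxDl, mulmxDr, mulmxN, mulNmx).
    rewrite !(mul_scalar_mx, mul_mx_scalar) -!scalemxAl -!scalemxAr -?scalemxAl.
    have := sqrt3_sqr R; move: (sqrt3 R) => s s2; set w1 := J *m P; set w2 := P *m J; set w3 := _ *m J.
    have tt : s / 2 * (s / 2) = 3 / 4 by rewrite mulrACA s2; field.
    rewrite !scalerA !tt.
    by apply/matrixP => i j; rewrite !entryE; field.
  by move=> /eqP; rewrite scaler_eq0 mulf_eq0 invr_eq0 !pnatr_eq0 => /eqP.
have JP : J *m P = - (P *m J).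
  by rewrite -{2}PJ -!mulmxA standard_J_sqr mulmxN mulmx1 mulmxN opprK.
have kd : k *: (rot3 R p - (rot3 R p)^T) = J.
  rewrite rot3_tr /rot3 opprB addrC addrA addrNK -scalerDl -splitr scalerA mulVf ?scale1r//.
  exact: sqrt3_neq0.
have rP : rot3 R p *m P = P *m (rot3 R p)^T.
  by rewrite rot3_tr /rot3 mulmxDl mulmxBr mul_scalar_mx mul_mx_scalar -scalemxAl -scalemxAr JP scalerN.
have rtP : (rot3 R p)^T *m P = P *m rot3 R p.
  by rewrite rot3_tr /rot3 mulmxBl mulmxDr mul_scalar_mx mul_mx_scalar -scalemxAl -scalemxAr JP scalerN opprK.
have jE : jop sigma0 k x = block_mx (P *m J) (J *m Q) (- (Q' *m J)) 0.
  rewrite !jopE rot2E rotE opp_block_mx add_block_mx scale_block_mx D0; congr block_mx.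
  - by rewrite rP rtP -!mulmxA rtt rr -mulmxBr scalemxAr kd.
  - by rewrite -mulmxBl scalemxAl kd.
  - by rewrite -mulmxBr scalemxAr -mulmxN -kd -scalerN opprB.
  - by rewrite subrr scaler0.
have cE : cpxop sigma0 k = block_mx J 0 0 0 by rewrite -cpx_sigma0.
have -> : \tr (cpxop sigma0 k *m bra x (jop sigma0 k x)) = 2 * (\tr (P^T *m P) + \tr (Q^T *m Q)).
  rewrite cE jE !braE /x D0 !mulmx_block opp_block_mx add_block_mx mulmx_block mxtrace_block.
  rewrite !(mul0mx, mulmx0, addr0, add0r, mxtrace0).
  rewrite PT QT.
  rewrite !(mulmxDr, mulmxN, mulNmx, opprD, opprK) !mulmxA.
  have JJ := standard_J_sqr R p.
  rewrite PJ JJ mulNmx mul1mx !(raddfD, raddfN) /= mulNmx !raddfN /=.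
  have -> : \tr (J *m P *m P *m J) = - \tr (P *m P).
    by rewrite mxtrace_mulC !mulmxA JJ mulNmx mul1mx mulNmx raddfN.
  have -> : \tr (J *m Q *m Q^T *m J) = - \tr (Q^T *m Q).
    by rewrite mxtrace_mulC !mulmxA JJ mulNmx mul1mx mulNmx raddfN /= mxtrace_mulC.
  rewrite [\tr (Q *m Q^T)]mxtrace_mulC; ring.
rewrite mulr_gt0// lt_neqAle addr_ge0 ?mxtrace_tr_mul_ge0// andbT eq_sym.
apply: contraNneq x0 => /eqP; rewrite paddr_eq0 ?mxtrace_tr_mul_ge0// => /andP[/eqP P0 /eqP Q0].
rewrite /x QT D0 (mxtrace_tr_mul_eq0 P0) (mxtrace_tr_mul_eq0 Q0) trmx0.
by rewrite block_mx0.
Qed.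

End Positivity.

(** * The reductive model of vector fields *)

Section VectorFields.
Variables (R : realType) (M : smoothSpace R).
Local Notation C := (smoothFun M).
Implicit Types (X Y : vectorField M) (f g : C).

Lemma vf_linear X c f g : X (c *: f + g) = c *: X f + X g :> C.
Proof. by have /asboolP[+ _] := derivationP X; apply. Qed.

Lemma vfM X f g : X (f * g) = X f * g + f * X g :> C.
Proof. by have /asboolP[_] := derivationP X; apply. Qed.

Lemma vfD X f g : X (f + g) = X f + X g :> C.
Proof. by have := vf_linear X 1 f g; rewrite !scale1r. Qed.

Lemma vf0 X : X 0 = 0 :> C.
Proof. by apply: (@addrI _ (X 0 : C)); rewrite -vfD !addr0. Qed.

Lemma vfZ X c f : X (c *: f) = c *: X f :> C.
Proof. by have := vf_linear X c f 0; rewrite addr0 vf0 addr0. Qed.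

Lemma vfN X f : X (- f) = - X f :> C.
Proof. by rewrite -scaleN1r vfZ scaleN1r. Qed.

Lemma vf_sum X (I : Type) (r : seq I) (P : pred I) (F : I -> C) :
  X (\sum_(i <- r | P i) F i) = \sum_(i <- r | P i) X (F i) :> C.
Proof. by apply: (@big_morph C C _ 0 +%R 0 +%R); [exact: vfD|exact: vf0]. Qed.

Lemma vf_cst X c : X (c *: (1 : C)) = 0 :> C.
Proof.
rewrite vfZ; have := vfM X 1 1; rewrite !mul1r mulr1 => /eqP.
by rewrite -subr_eq subrr => /eqP <-; rewrite scaler0.
Qed.

Lemma vf_scaleE g X f : (g *: X) f = g * X f :> C. Proof. by []. Qed.
Lemma vf_sumE (I : Type) (r : seq I) (P : pred I) (F : I -> vectorField M) f :
  (\sum_(i <- r | P i) F i) f = \sum_(i <- r | P i) F i f :> C.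
Proof. by apply: (big_morph (fun X : vectorField M => (X f : C))). Qed.

Lemma tangent_at_vf X x : tangent_at x (fun f => (X f : C) x).
Proof.
split=> [c f g|f g]; first by rewrite vf_linear.
by rewrite vfM evD !evM.
Qed.

Lemma tangent_atB x (v w : C -> R) : tangent_at x v -> tangent_at x w ->
  tangent_at x (fun f => v f - w f).
Proof.
move=> [lv Lv] [lw Lw]; split=> [c f g|f g].
  by rewrite lv lw /=; ring.
by rewrite Lv Lw; ring.
Qed.

Lemma vf_eqP X Y : (forall f x, (X f : C) x = (Y f : C) x) -> X = Y.
Proof. by move=> e; apply/val_inj/funext => f; apply/val_inj/funext => x; exact: e. Qed.

Section Matrices.
Variable n : nat.
Local Notation MC := 'M[C]_n.
Implicit Types (A B : MC).

Definition evm (x : M) A : 'M[R]_n := map_mx (fun f : C => f x) A.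

Lemma evmD x A B : evm x (A + B) = evm x A + evm x B.
Proof. by apply/matrixP => i j; rewrite !mxE. Qed.
Lemma evmN x A : evm x (- A) = - evm x A.
Proof. by apply/matrixP => i j; rewrite !mxE. Qed.
Lemma evmZ x f A : evm x (f *: A) = f x *: evm x A.
Proof. by apply/matrixP => i j; rewrite !mxE. Qed.
Lemma evmM x A B : evm x (A *m B) = evm x A *m evm x B.
Proof.
by apply/matrixP => i j; rewrite !mxE ev_sum; apply: eq_bigr => k _; rewrite !mxE.
Qed.
Lemma evm_tr x A : evm x A^T = (evm x A)^T.
Proof. by apply/matrixP => i j; rewrite !mxE. Qed.
Lemma evm1 x : evm x 1%:M = 1%:M.
Proof. by apply/matrixP => i j; rewrite !mxE; case: (i == j). Qed.
Lemma evm_trace x A : (\tr A) x = \tr (evm x A).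
Proof. by rewrite /mxtrace ev_sum; apply: eq_bigr => i _; rewrite mxE. Qed.

Lemma evm_inj A B : (forall x, evm x A = evm x B) -> A = B.
Proof.
move=> e; apply/matrixP => i j; apply/val_inj/funext => x.
by have := congr1 (fun T : 'M[R]_n => T i j) (e x); rewrite !mxE.
Qed.

Definition dm X A : MC := map_mx (X : C -> C) A.

Lemma dmD X A B : dm X (A + B) = dm X A + dm X B.
Proof. by apply/matrixP => i j; rewrite !mxE; exact: vfD. Qed.
Lemma dmN X A : dm X (- A) = - dm X A.
Proof. by apply/matrixP => i j; rewrite !mxE; exact: vfN. Qed.
Lemma dmM X A B : dm X (A *m B) = dm X A *m B + A *m dm X B.
Proof.
apply/matrixP => i j; rewrite !mxE vf_sum -big_split; apply: eq_bigr => l _.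
by rewrite !mxE; exact: vfM.
Qed.
Lemma dm_cst X (A : 'M[R]_n) : dm X (map_mx (fun r => r *: (1 : C)) A) = 0.
Proof. by apply/matrixP => i j; rewrite !mxE; exact: vf_cst. Qed.
Lemma dmZ X f A : dm X (f *: A) = (X f : C) *: A + f *: dm X A.
Proof. by apply/matrixP => i j; rewrite !mxE; exact: vfM. Qed.
Lemma dmZ_cst X c A : dm X ((c *: (1 : C)) *: A) = (c *: (1 : C)) *: dm X A.
Proof. by rewrite dmZ vf_cst scale0r add0r. Qed.
Lemma dm_tr X A : dm X A^T = (dm X A)^T.
Proof. by apply/matrixP => i j; rewrite !mxE. Qed.
Lemma dm_trace X A : X (\tr A) = \tr (dm X A) :> C.
Proof. by rewrite /mxtrace vf_sum; apply: eq_bigr => i _; rewrite mxE. Qed.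
Lemma dm1 X : dm X 1%:M = 0.
Proof.
apply/matrixP => i j; rewrite !mxE; case: (i == j); rewrite ?mulr1n ?mulr0n; last exact: vf0.
by have := vf_cst X 1; rewrite scale1r.
Qed.
Lemma dmDl X Y A : dm (X + Y) A = dm X A + dm Y A.
Proof. by apply/matrixP => i j; rewrite !mxE. Qed.
Lemma dmZl f X A : dm (f *: X) A = f *: dm X A.
Proof. by apply/matrixP => i j; rewrite !mxE. Qed.
Lemma dm_bracket X Y A : dm (bracket X Y) A = dm X (dm Y A) - dm Y (dm X A).
Proof. by apply/matrixP => i j; rewrite !mxE. Qed.

End Matrices.

End VectorFields.

Section ReductiveModel.
Variables (R : realType) (p q : nat).
Local Notation n := (p + p + q)%N.
Local Notation V := 'M[R]_n.
Local Notation S := (signature_form R (p + p) q).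
Local Notation adj := (adjointmx S).
Local Notation SS := (signature_formK R (p + p) q).
Local Notation M := (period_domain R p q).
Local Notation C := (smoothFun M).
Local Notation vf := (vectorField M).
Local Notation MC := 'M[C]_n.
Local Notation kR := ((sqrt3 R)^-1).
Implicit Types (X Y : vf) (A Theta : MC) (B : V) (x : M).

Definition constC (c : R) : C := c *: (1 : C).
Lemma ev_constC c x : constC c x = c. Proof. by rewrite evZ ev1 mulr1. Qed.

Definition formC : MC := map_mx constC S.
Definition sigmaC : MC := \matrix_(i, j) @sigma_fun R p q i j.
Definition kC : C := constC kR.
Definition halfC : C := constC 2^-1.
Local Notation adjC := (adjointmx formC).
Local Notation s := sigmaC.

Lemma evm_form x : evm x formC = S.
Proof. by apply/matrixP => i j; rewrite !mxE ev_constC. Qed.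
Lemma evm_sigma x : evm x s = sigma_at x.
Proof. by apply/matrixP => i j; rewrite 2!mxE. Qed.
Lemma evm_adj x A : evm x (adjC A) = adj (evm x A).
Proof. by rewrite !adjointmxE !evmM evm_tr evm_form. Qed.

Lemma formCK : formC *m formC = 1%:M.
Proof. by apply: evm_inj => x; rewrite evmM evm_form SS evm1. Qed.

Lemma sigma_at_order3 x : order3_unitary (sigma_at x).
Proof. exact/conj_point_order3/SO0_O/rep_SO0. Qed.

Lemma sigmaC3 : s *m s *m s = 1%:M.
Proof. by apply: evm_inj => x; rewrite !evmM evm_sigma evm1; have [] := sigma_at_order3 x. Qed.
Lemma adj_sigmaC : adjC s = s *m s.
Proof. by apply: evm_inj => x; rewrite evm_adj evmM evm_sigma; have [] := sigma_at_order3 x. Qed.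

Lemma kR3 : 3 * (kR * kR) = 1.
Proof. by rewrite -invfM sqrt3_sqr divff. Qed.
Lemma kC3 : 3 * (kC * kC) = 1.
Proof.
apply/val_inj/funext => x.
by rewrite -[LHS]/((3 * (kC * kC) : C) x) !evM ev_nat !ev_constC kR3.
Qed.
Local Notation hor := (horizontal s).

Lemma dm_adj X A : dm X (adjC A) = adjC (dm X A).
Proof.
have d0 : dm X formC = 0 by exact: dm_cst.
by rewrite !adjointmxE !dmM d0 dm_tr mul0mx add0r mulmx0 addr0.
Qed.

Fact theta_sig : {f : vf -> MC | forall X, f X = theta_of s kC (dm X s)}.
Proof. by eexists. Qed.
Definition theta := sval theta_sig.
Let thetaE X : theta X = theta_of s kC (dm X s).
Proof. exact: svalP theta_sig X. Qed.

Lemma dm_sigma3 X : dm X s *m (s *m s) + s *m dm X s *m s + s *m s *m dm X s = 0.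
Proof.
have := @dm1 _ _ n X; rewrite -sigmaC3 !dmM mulmxDl => <-.
by rewrite mulmxA.
Qed.

Lemma theta_horizontal X : hor (theta X).
Proof. by rewrite thetaE; exact: (horizontal_theta_of kC sigmaC3 (dm_sigma3 X)). Qed.

Lemma bra_theta X : bra (theta X) s = dm X s.
Proof. by rewrite thetaE; exact: (bra_theta_of sigmaC3 kC3 (dm_sigma3 X)). Qed.

Lemma adj_theta X : adjC (theta X) = - theta X.
Proof.
rewrite thetaE; apply: (adj_theta_of kC formCK sigmaC3 adj_sigmaC (dm_sigma3 X)).
by rewrite -dm_adj adj_sigmaC dmM.
Qed.

Lemma theta_linear f X Y : theta (f *: X + Y) = f *: theta X + theta Y.
Proof.
by rewrite !thetaE dmDl dmZl theta_of_linear. Qed.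

(** Fundamental fields are global derivations whose values span every tangent space, so combining
    them with smooth coefficients turns matrices of functions into vector fields. It will invert
    theta. *)
Fact vec_sig : {f : MC -> vf | forall Theta, f Theta =
  \sum_(ij : 'I_n * 'I_n) Theta ij.1 ij.2 *: fundamental_field (delta_mx ij.1 ij.2)}.
Proof. by eexists. Qed.
Definition vec := sval vec_sig.

Definition vec_at x (B : V) (f : C) : R :=
  \sum_(ij : 'I_n * 'I_n) B ij.1 ij.2 * (fundamental_field (delta_mx ij.1 ij.2 : V) f : C) x.

Lemma ev_vec Theta f x : (vec Theta f : C) x = vec_at x (evm x Theta) f.
Proof.
rewrite [vec Theta](svalP vec_sig Theta) vf_sumE ev_sum; apply: eq_bigr => ij _.
by rewrite vf_scaleE evM mxE.
Qed.

Lemma tangent_vec_at x B : tangent_at x (vec_at x B).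
Proof.
split=> [c f g|f g]; rewrite /vec_at.
  rewrite [in RHS]mulr_sumr -big_split; apply: eq_bigr => ij _.
  by rewrite vf_linear evD evZ mulrDr mulrCA.
rewrite mulr_suml mulr_sumr -big_split; apply: eq_bigr => ij _.
by rewrite vfM evD !evM mulrDr mulrA [X in _ + X]mulrCA.
Qed.

Lemma skew_sum (B : V) :
  \sum_(ij : 'I_n * 'I_n) B ij.1 ij.2 *: skew (delta_mx ij.1 ij.2 : V) = skew B.
Proof.
have -> : skew B = skew (\sum_(ij : 'I_n * 'I_n) B ij.1 ij.2 *: delta_mx ij.1 ij.2 : V).
  by congr skew; rewrite [LHS]matrix_sum_delta pair_big.
have sl : linear (@skew R p q : V -> V).
  move=> c u w; rewrite /skew linearP /=.
  by apply/matrixP => i j; rewrite !entryE; ring.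
pose sm := GRing.isLinear.Build R V V _ (@skew R p q) sl.
pose sk : {linear V -> V} := HB.pack (@skew R p q) sm.
rewrite -[RHS]/(sk _) linear_sum; apply: eq_bigr => ij _.
by rewrite [RHS]linearZ.
Qed.

Lemma vec_at_sigma x B i j :
  vec_at x B (@sigma_fun R p q i j) = bra (skew B) (sigma_at x) i j.
Proof.
rewrite /vec_at -skew_sum !braE mulmx_suml mulmx_sumr -sumrB summxE.
apply: eq_bigr => ij _.
by rewrite fundamental_field_sigma -[in RHS]scalemxAl -[in RHS]scalemxAr -[in RHS]scalerBr entryZ.
Qed.

Lemma skew_id (B : V) : adj B = - B -> skew B = B.
Proof. by move=> aB; rewrite /skew aB opprK; apply/matrixP => i j; rewrite !entryE; field. Qed.

(** Defined for arbitrary tangent vectors because [frame_at] quantifies over them; that each is the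
    value of a vector field comes out only in [tangent_vec]. *)
Definition theta_at x (v : C -> R) : V :=
  theta_of (sigma_at x) kR (\matrix_(i, j) v (@sigma_fun R p q i j)).

Section Pointwise.
Variables (x : M) (v : C -> R).
Hypothesis tv : tangent_at x v.
Let d : V := \matrix_(i, j) v (@sigma_fun R p q i j).

Let vM A (B : MC) : map_mx v (A *m B) = map_mx v A *m evm x B + evm x A *m map_mx v B.
Proof.
have vD f g : v (f + g) = v f + v g by have := tv.1 1 f g; rewrite scale1r mul1r.
have v0 : v 0 = 0 by apply: (@addrI _ (v 0)); rewrite -vD !addr0.
apply/matrixP => i j; rewrite !mxE (@big_morph R C v 0 +%R 0 +%R)// -big_split.
by apply: eq_bigr => l _; rewrite !mxE tv.2.
Qed.

Let dE : map_mx v s = d. Proof. by apply/matrixP => i j; rewrite !mxE. Qed.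

Let v1 c : map_mx v (map_mx constC (c : V)) = 0.
Proof. by apply/matrixP => i j; rewrite !mxE (tangent_cst tv). Qed.

Let v1M : map_mx v (1%:M : MC) = 0.
Proof.
rewrite -(v1 1%:M); congr (map_mx v _); apply: evm_inj => y.
by rewrite evm1; apply/matrixP => i j; rewrite !mxE ev_constC.
Qed.

Let d3 : d *m (sigma_at x *m sigma_at x) + sigma_at x *m d *m sigma_at x +
  sigma_at x *m sigma_at x *m d = 0.
Proof.
by rewrite -v1M -sigmaC3 !vM evmM dE evm_sigma mulmxDl mulmxA.
Qed.

Let s3 : sigma_at x *m sigma_at x *m sigma_at x = 1%:M.
Proof. by have [] := sigma_at_order3 x. Qed.

Let as3 : adj (sigma_at x) = sigma_at x *m sigma_at x.
Proof. by have [] := sigma_at_order3 x. Qed.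

Lemma theta_at_horizontal : horizontal (sigma_at x) (theta_at x v).
Proof. exact: (horizontal_theta_of kR s3 d3). Qed.

Lemma bra_theta_at : bra (theta_at x v) (sigma_at x) = d.
Proof. exact: (bra_theta_of s3 kR3 d3). Qed.

Lemma adj_theta_at : adj (theta_at x v) = - theta_at x v.
Proof.
apply: (adj_theta_of kR SS s3 as3 d3).
have : map_mx v (adjC s) = map_mx v (s *m s) by rewrite adj_sigmaC.
rewrite vM dE evm_sigma => <-.
have vS : map_mx v formC = 0 by exact: v1.
rewrite !adjointmxE !vM vS mul0mx add0r mulmx0 addr0 evm_form; congr (_ *m _ *m _).
by apply/matrixP => i j; rewrite !mxE.
Qed.

(** The two tangent vectors agree on the entries of sigma, so their difference is zero by
    [tangent_eq0]. *)
Lemma tangent_vec f : v f = vec_at x (theta_at x v) f.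
Proof.
apply/eqP; rewrite -subr_eq0; apply/eqP.
apply: (tangent_eq0 (tangent_atB tv (tangent_vec_at x (theta_at x v)))) => i j.
by rewrite vec_at_sigma skew_id ?adj_theta_at// bra_theta_at mxE subrr.
Qed.

End Pointwise.

Lemma evm_theta X x : evm x (theta X) = theta_at x (fun f => (X f : C) x).
Proof.
rewrite thetaE /theta_at /theta_of /rot !(evmZ, evmD, evmM) evm_sigma.
have -> : evm x (dm X s) = \matrix_(i, j) (X (@sigma_fun R p q i j) : C) x.
  by apply/matrixP => i j; rewrite !mxE.
by rewrite evM ev_constC ev_nat.
Qed.

Lemma vec_theta X : vec (theta X) = X.
Proof.
apply: vf_eqP => f x; rewrite ev_vec evm_theta; apply/esym.
exact: (tangent_vec (tangent_at_vf X x)).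
Qed.

Lemma theta_inj X Y : theta X = theta Y -> X = Y.
Proof. by move=> e; rewrite -(vec_theta X) e vec_theta. Qed.

(** With [vec_theta] this identifies vector fields with the skew horizontal matrices of functions,
    so that J and nabla can be prescribed through theta. *)
Lemma theta_vec Theta : hor Theta -> adjC Theta = - Theta -> theta (vec Theta) = Theta.
Proof.
move=> hT aT; apply/eqP; rewrite -subr_eq0; apply/eqP.
apply: (horizontal_inj sigmaC3 kC3).
  exact: (horizontalB (theta_horizontal (vec Theta)) hT).
rewrite braDl braNl bra_theta; apply: evm_inj => x.
have -> : evm x (0 : MC) = 0 by apply/matrixP => i j; rewrite !mxE.
rewrite evmD evmN (braE Theta) evmD evmN !evmM evm_sigma.
have -> : evm x (dm (vec Theta) s) = bra (skew (evm x Theta)) (sigma_at x).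
  by apply/matrixP => i j; rewrite [LHS]mxE mxE mxE ev_vec vec_at_sigma.
by rewrite skew_id ?braE ?subrr// -evm_adj aT evmN.
Qed.

End ReductiveModel.

Section LieIdentities.
Variables (C : comPzRingType) (n : nat).
Implicit Types (a b u v w x y A : 'M[C]_n).

Lemma bra_Jacobi a b A : bra a (bra b A) - bra b (bra a A) = bra (bra a b) A.
Proof.
rewrite !braE !(mulmxBl, mulmxBr) !mulmxA.
by apply/matrixP => i j; rewrite !entryE; ring.
Qed.

Lemma bra_mulr a A B : bra a (A *m B) = bra a A *m B + A *m bra a B.
Proof. by rewrite !braE mulmxBl mulmxBr !mulmxA addrA subrK. Qed.

Lemma mxtrace_bra a A : \tr (bra a A) = 0.
Proof. by rewrite !braE raddfB /= mxtrace_mulC subrr. Qed.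

Lemma bra_Leibniz a b u v :
  u *m b + a *m v - (v *m a + b *m u) = bra u b + bra a v.
Proof.
by rewrite !braE [v *m a + _]addrC opprD addrACA. Qed.

Lemma bra_commutator a b c d A :
  bra c A + bra b (bra a A) - (bra d A + bra a (bra b A)) =
  bra (c - d) A - bra (bra a b) A.
Proof.
rewrite -bra_Jacobi braDl braNl.
move: (bra c A) (bra d A) (bra a (bra _ _)) (bra b (bra _ _)) => x1 x2 x3 x4.
by rewrite !opprD opprK addrACA (addrC x4).
Qed.

Lemma bra_sub_twice c u A : bra (c + u + u) A - bra u A = bra c A + bra u A.
Proof. by rewrite [bra (c + u + u) A]braDl addrK braDl. Qed.

End LieIdentities.

Section ConjugatePositivity.
Variables (R : realType) (p q : nat).
Local Notation V := 'M[R]_(p + p + q).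
Local Notation S := (signature_form R (p + p) q).
Local Notation adj := (adjointmx S).
Local Notation Str := (signature_form_tr R (p + p) q).
Local Notation SS := (signature_formK R (p + p) q).
Local Notation k := ((sqrt3 R)^-1).

(** All ingredients are equivariant under conjugation by [g], which reduces the claim to sigma_0. *)
Lemma cpx_form_pos (g x : V) : indefinite_O R (p + p) q g -> adj x = - x ->
  horizontal (conj_point g) x -> x != 0 ->
  0 < \tr (cpxop (conj_point g) k *m bra x (jop (conj_point g) k x)).
Proof.
move=> Og; have ag := (indefinite_OP g).1 Og; have ga := mulmx1C ag.
pose c (B : V) := g *m B *m adj g.
have cM A B : c (A *m B) = c A *m c B by rewrite /c conj_pointM.
have cD A B : c (A + B) = c A + c B by rewrite /c mulmxDr mulmxDl.
have cN A : c (- A) = - c A by rewrite /c mulmxN mulNmx.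
have cZ t A : c (t *: A) = t *: c A by rewrite /c -scalemxAr -scalemxAl.
have [y ->] : exists y, x = c y.
  by exists (adj g *m x *m g); rewrite /c !mulmxA ga mul1mx -mulmxA ga mulmx1.
have cadj A : adj (c A) = c (adj A).
  by rewrite /c !adjointmxM ?SS// adjointmxK ?SS ?Str// mulmxA.
have trc A : \tr (c A) = \tr A by rewrite /c mxtrace_mulC mulmxA ag mul1mx.
have cinj A B : c A = c B -> A = B.
  move=> /(congr1 (fun T => adj g *m T *m g)); rewrite /c !mulmxA ag !mul1mx.
  by rewrite -!mulmxA ag !mulmx1.
have rotc A : rot (conj_point g) (c A) = c (rot (sigma0 R p q) A).
  by rewrite /rot !cM.
rewrite cadj => ay hy cy0.
have y0 : y != 0 by apply: contraNneq cy0 => ->; rewrite /c mulmx0 mul0mx.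
have {}ay : adj y = - y by apply: cinj; rewrite ay cN.
have {}hy : horizontal (sigma0 R p q) y.
  apply: cinj; move: hy; rewrite /horizontal !rotc -!cD => ->.
  by rewrite /c mulmx0 mul0mx.
have := cpx_form_pos0 ay hy y0; congr (0 < _).
rewrite !braE !jopE /cpxop !rotc -[conj_point g]/(c _).
rewrite -!(cM, cN, cD, cZ).
by rewrite trc.
Qed.

End ConjugatePositivity.

Section ChernUniqueness.
Variables (R : realType) (M : smoothSpace R).
Local Notation C := (smoothFun M).
Local Notation vf := (vectorField M).

(* Koszul: the difference of two metric connections with equal torsion is
   symmetric in its first two arguments and skew in the last two. *)
Lemma chern_unique (w : vf -> vf -> C) (J : vf -> vf) (nabla nabla' : vf -> vf -> vf) :
  two_form w -> almost_complex J -> compatible w J ->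
  chern_connection w J nabla -> chern_connection w J nabla' ->
  forall X Y, nabla X Y = nabla' X Y.
Proof.
move=> [wA wl] [Jl JJ] [wJ wpos] [_ gn tn] [_ gn' tn'].
have wD X Y Z : w X (Y + Z) = w X Y + w X Z by have := wl X 1 Y Z; rewrite scale1r mul1r.
have w0 X : w X 0 = 0 by apply: (@addrI _ (w X 0)); rewrite -wD !addr0.
have wN X Y : w X (- Y) = - w X Y.
  by apply/eqP; rewrite -addr_eq0 -wD addNr w0.
have wDl X Y Z : w (X + Y) Z = w X Z + w Y Z by rewrite wA wD opprD -!wA.
have wNl X Z : w (- X) Z = - w X Z by rewrite wA wN -wA.
pose g := metric w J.
have gC X Y : g X Y = g Y X.
  by rewrite /g /metric -[LHS]wJ JJ wN -wA.
have gBl X Y Z : g (X - Y) Z = g X Z - g Y Z by rewrite /g /metric wDl wNl.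
pose d X Y := nabla X Y - nabla' X Y.
have dC X Y : d X Y = d Y X.
  apply/eqP; rewrite -subr_eq0 /d; apply/eqP.
  have e := etrans (tn X Y) (esym (tn' X Y)).
  move: e; rewrite /torsion => /addIr e.
  by rewrite opprD opprK addrACA e addrACA subrr addNr addr0.
have gd X Y Z : g (d X Y) Z = - g (d X Z) Y.
  have := etrans (esym (gn X Y Z)) (gn' X Y Z).
  rewrite -/g (gC Y) (gC Y (nabla' X Z)) /d !gBl => e.
  apply/eqP; rewrite -subr_eq0 opprK addrACA e -opprD subrr.
  by [].
have gd0 X Y Z : g (d X Y) Z = 0.
  (* Using each of the two symmetries three times returns to the same term with the opposite
     sign. *)
  have e : g (d X Y) Z = - g (d X Y) Z.
    by rewrite {1}dC gd dC gd opprK dC gd.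
  apply/val_inj/funext => x; have := congr1 (fun f : C => f x) e.
  move=> /eqP; rewrite evN -addr_eq0 -mulr2n mulrn_eq0 /= => /eqP ->.
  by [].
move=> X Y; apply/eqP; rewrite -subr_eq0; apply/eqP.
apply: vf_eqP => f x; apply: contrapT => /eqP n0.
have := wpos (d X Y) x (ex_intro _ f n0).
by rewrite -[w _ _]/(g _ _) gd0 ltxx.
Qed.

End ChernUniqueness.

(** * The symplectic form and the Chern connection *)

Section Geometry.
Variables (R : realType) (p q : nat).
Local Notation n := (p + p + q)%N.
Local Notation M := (period_domain R p q).
Local Notation C := (smoothFun M).
Local Notation vf := (vectorField M).
Local Notation MC := 'M[C]_n.
Local Notation s := (sigmaC R p q).
Local Notation kC := (kC R p q).
Local Notation halfC := (halfC R p q).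
Local Notation adjC := (adjointmx (formC R p q)).
Local Notation s3 := (sigmaC3 R p q).
Local Notation k3 := (kC3 R p q).
Local Notation SSC := (formCK R p q).
Local Notation asC := (adj_sigmaC R p q).
Local Notation rotC := (rot s).
Local Notation mC := (mpart s kC).
Local Notation jC := (jop s kC).
Local Notation hor := (horizontal s).
Local Notation JC := (cpxop s kC).
Implicit Types (X Y Z : vf) (A B : MC) (x : M).

Definition tangential A := hor A /\ adjC A = - A.

Lemma tangential_theta X : tangential (theta X).
Proof. by split; [exact: theta_horizontal|exact: adj_theta]. Qed.

Lemma theta_vecT A : tangential A -> theta (vec A) = A.
Proof. by case; exact: theta_vec. Qed.

Lemma tangential_jop A : tangential A -> tangential (jC A).
Proof.
move=> [_ aA]; split; first exact: (horizontal_jop kC s3).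
by rewrite (adj_jop kC SSC s3 asC) aA linearN.
Qed.

(** The covariant derivative d - ad theta on all matrix functions. It is a derivation for the
    product and kills sigma, hence commutes with every operation built from sigma. *)
Fact cov_sig : {f : vf -> MC -> MC | forall X A, f X A = dm X A - bra (theta X) A}.
Proof. by eexists. Qed.
Definition cov := sval cov_sig.
Lemma covE X A : cov X A = dm X A - bra (theta X) A.
Proof. exact: svalP cov_sig X A. Qed.

Lemma covD X A B : cov X (A + B) = cov X A + cov X B.
Proof. by rewrite !covE dmD braDr; move: (bra _ A) (bra _ B) => a b; rewrite opprD addrACA. Qed.
Lemma covN X A : cov X (- A) = - cov X A.
Proof. by rewrite !covE dmN braNr [RHS]opprD. Qed.
Lemma covZ X c A : cov X (constC p q c *: A) = constC p q c *: cov X A.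
Proof. by rewrite !covE [dm X _]dmZ_cst braZr [RHS]scalerBr. Qed.
Lemma covM X A B : cov X (A *m B) = cov X A *m B + A *m cov X B.
Proof.
rewrite !covE dmM bra_mulr; move: (bra _ A) (bra _ B) => a b.
by rewrite mulmxBl mulmxBr opprD addrACA.
Qed.
Lemma cov_sigma X : cov X s = 0.
Proof. by rewrite !covE bra_theta subrr. Qed.
Lemma cov_rot X A : cov X (rotC A) = rotC (cov X A).
Proof. by rewrite /rot !covM cov_sigma !(mul0mx, mulmx0, add0r, addr0). Qed.
Lemma cov_jop X A : cov X (jC A) = jC (cov X A).
Proof. by rewrite !jopE covZ covD covN !cov_rot. Qed.
Lemma cov_cpx X : cov X JC = 0.
Proof. by rewrite /cpxop covZ covD covN covM cov_sigma mul0mx mulmx0 addr0 oppr0 addr0 scaler0. Qed.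
Lemma cov_bra X A B : cov X (bra A B) = bra (cov X A) B + bra A (cov X B).
Proof. by rewrite [in LHS]braE covD covN !covM bra_Leibniz. Qed.
Lemma cov_trace X A : X (\tr A) = \tr (cov X A) :> C.
Proof. by rewrite dm_trace !covE raddfB /= mxtrace_bra subr0. Qed.

Lemma tangential_cov X A : tangential A -> tangential (cov X A).
Proof.
move=> [hA aA]; split.
  rewrite /horizontal -!cov_rot -!covD hA !covE !braE mulmx0 mul0mx subr0 subr0.
  by apply/matrixP => i j; rewrite !mxE; exact: vf0.
rewrite !covE linearB /= -dm_adj (adj_bra SSC) aA adj_theta dmN braNl braNr.
by move: (dm X A) (bra _ A) => a b; rewrite !opprK opprB addrC.
Qed.

Fact Jst_sig : {J : vf -> vf | forall X, theta (J X) = jC (theta X)}.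
Proof.
exists (fun X => vec (jC (theta X))) => X.
exact/theta_vecT/tangential_jop/tangential_theta.
Qed.
Definition Jst := sval Jst_sig.
Lemma theta_Jst X : theta (Jst X) = jC (theta X).
Proof. exact: svalP Jst_sig X. Qed.

Fact nab_sig : {f : vf -> vf -> vf | forall X Y, theta (f X Y) = cov X (theta Y)}.
Proof.
exists (fun X Y => vec (cov X (theta Y))) => X Y.
exact/theta_vecT/tangential_cov/tangential_theta.
Qed.
Definition nab := sval nab_sig.
Lemma theta_nab X Y : theta (nab X Y) = cov X (theta Y).
Proof. exact: svalP nab_sig X Y. Qed.

Fact pairing_sig : {f : MC -> MC -> C | forall A B, f A B = \tr (JC *m bra A B)}.
Proof. by eexists. Qed.
Definition pairing := sval pairing_sig.
Lemma pairingE A B : pairing A B = \tr (JC *m bra A B).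
Proof. exact: svalP pairing_sig A B. Qed.

Fact omega_sig :
  {f : vf -> vf -> C | forall X Y, f X Y = halfC * pairing (theta X) (theta Y)}.
Proof. by eexists. Qed.
Definition omega := sval omega_sig.
Lemma omegaE X Y : omega X Y = halfC * pairing (theta X) (theta Y).
Proof. exact: svalP omega_sig X Y. Qed.

Lemma theta0 : theta (0 : vf) = 0.
Proof.
have := theta_linear 1 (0 : vf) 0; rewrite !scale1r addr0 => e.
by apply: (@addrI _ (theta (0 : vf))); rewrite -e addr0.
Qed.
Lemma thetaD X Y : theta (X + Y) = theta X + theta Y.
Proof. by have := theta_linear 1 X Y; rewrite !scale1r. Qed.
Lemma thetaZ f X : theta (f *: X) = f *: theta X.
Proof. by have := theta_linear f X 0; rewrite theta0 !addr0. Qed.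
Lemma thetaN X : theta (- X) = - theta X.
Proof. by apply/eqP; rewrite -addr_eq0 -thetaD addNr theta0. Qed.
Lemma dm_bra X A B : dm X (bra A B) = bra (dm X A) B + bra A (dm X B).
Proof. by rewrite [in LHS]braE dmD dmN !dmM bra_Leibniz. Qed.

Let sub_twice (a b u : MC) : a - b = a - u - (b + u) + u + u.
Proof. by rewrite opprD -!addrA; congr (_ + _); rewrite addKr addrCA addNr addr0. Qed.

Lemma dm_theta_sub X Y : dm X (theta Y) - dm Y (theta X) =
  cov X (theta Y) - cov Y (theta X) + bra (theta X) (theta Y) + bra (theta X) (theta Y).
Proof.
by rewrite !covE (braC (theta Y)) opprK; exact: sub_twice.
Qed.

Lemma bra_mpart_sigma A : bra (mC A) s = bra A s.
Proof.
have e : bra (A - mC A) s = 0.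
  rewrite !braE (rot_fixed_comm s3 (rot_vertical s3 k3 A)).
  by rewrite subrr.
apply/eqP; rewrite eq_sym -subr_eq0 -braNl -braDl; apply/eqP; exact: e.
Qed.

(** Apply X Y - Y X to sigma and replace each derivative of sigma by its bracket with theta. *)
Lemma bra_theta_bracket X Y : bra (theta (bracket X Y)) s =
  bra (dm X (theta Y) - dm Y (theta X)) s - bra (bra (theta X) (theta Y)) s.
Proof.
have e U W : dm U (dm W s) =
    bra (dm U (theta W)) s + bra (theta W) (bra (theta U) s).
  apply: etrans (congr1 (dm U) (esym (bra_theta W))) _.
  apply: etrans (dm_bra _ _ _) _; congr (_ + bra _ _); exact/esym/bra_theta.
apply: etrans (bra_theta _) _; apply: etrans (dm_bracket _ _ _) _.
by rewrite (e X Y) (e Y X); exact: bra_commutator.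
Qed.

(** The structure equation, from which the torsion of nabla is read off. Passing from d to nabla
    produces [theta X, theta Y] twice, one copy cancels, and the test against sigma retains only the
    m-part of the other. *)
Lemma theta_bracket X Y : theta (bracket X Y) =
  cov X (theta Y) - cov Y (theta X) + mC (bra (theta X) (theta Y)).
Proof.
have tX := tangential_theta X; have tY := tangential_theta Y.
have h : hor (cov X (theta Y) - cov Y (theta X) + mC (bra (theta X) (theta Y))).
  have [h1 _] := tangential_cov X tY; have [h2 _] := tangential_cov Y tX.
  have h3 := horizontal_mpart kC s3 (bra (theta X) (theta Y)).
  by have := horizontalZD 1 (horizontalB h1 h2) h3; rewrite scale1r.
apply: (horizontal_ext s3 k3 (theta_horizontal _) h).
apply: etrans (bra_theta_bracket X Y) _; rewrite dm_theta_sub.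
apply: etrans (bra_sub_twice _ _ _) _; apply/esym.
by apply: etrans (braDl _ _ _) _; rewrite [bra (mC _) _]bra_mpart_sigma.
Qed.

Lemma pairingC A B : pairing A B = - pairing B A.
Proof. by rewrite !pairingE [bra A B]braC mulmxN raddfN. Qed.
Lemma pairingDl A B A' : pairing (A + A') B = pairing A B + pairing A' B.
Proof. by rewrite !pairingE [bra (A + A') B]braDl mulmxDr raddfD. Qed.
Lemma pairingNl A B : pairing (- A) B = - pairing A B.
Proof. by rewrite !pairingE [bra (- A) B]braNl mulmxN raddfN. Qed.
Lemma pairingZl c A B : pairing (c *: A) B = c * pairing A B.
Proof. by rewrite !pairingE [bra (c *: A) B]braZl -scalemxAr mxtraceZ. Qed.

Lemma pairing_mpart A B : pairing (mC A) B = pairing A B.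
Proof.
apply/eqP; rewrite eq_sym -subr_eq0 -pairingNl -pairingDl; apply/eqP.
by rewrite pairingE; exact: (mxtrace_cpx_vertical kC s3 B (rot_vertical s3 k3 A)).
Qed.

Lemma vf_halfC X (f : C) : X (halfC * f) = halfC * X f :> C.
Proof. by rewrite vfM vf_cst mul0r add0r. Qed.

Lemma vf_pairing X A B :
  X (pairing A B) = pairing (cov X A) B + pairing A (cov X B) :> C.
Proof.
rewrite !pairingE; apply: etrans (cov_trace _ _) _.
rewrite covM cov_cpx mul0mx add0r.
rewrite (congr1 (fun T => \tr (JC *m T)) (cov_bra X A B)).
by rewrite mulmxDr raddfD.
Qed.

Lemma two_form_omega : two_form omega.
Proof.
have wC X Y : omega X Y = - omega Y X.
  rewrite !omegaE (pairingC (theta X)).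
  by move: halfC (pairing _ _) => h u; rewrite mulrN.
split=> // X c Y Z; rewrite (wC X) (wC X Y) (wC X Z) !omegaE.
rewrite theta_linear pairingDl pairingZl.
move: (pairing _ _) (pairing _ _) halfC => a b h.
rewrite -[LHS]/(- (h * (c * b + a))) -[RHS]/(c * - (h * b) - h * a).
by ring.
Qed.

Lemma theta_bracket_pairing X Y A : pairing (theta (bracket X Y)) A =
  pairing (cov X (theta Y)) A - pairing (cov Y (theta X)) A + pairing (bra (theta X) (theta Y)) A.
Proof.
rewrite theta_bracket (pairingDl _ A (mC _)) (pairing_mpart (bra _ _)).
by rewrite (pairingDl (cov X _)) (pairingNl (cov Y _)).
Qed.

(** Since the pairing is parallel, derivatives of omega cancel against the covariant terms of the
    brackets; the cyclic sum of tr (I [[x, y], z]) remains, and it vanishes by the Jacobi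
    identity. *)
Lemma closed_omega : closed_form omega.
Proof.
move=> X Y Z; rewrite !omegaE !vf_halfC !vf_pairing !theta_bracket_pairing.
have := cyclic_trace s kC (theta X) (theta Y) (theta Z).
rewrite -(pairingE (bra (theta X) (theta Y)) (theta Z)).
rewrite -(pairingE (bra (theta Y) (theta Z)) (theta X)).
rewrite -(pairingE (bra (theta Z) (theta X)) (theta Y)).
rewrite (pairingC (theta X) (cov _ _)) (pairingC (theta Y) (cov _ _)).
rewrite (pairingC (theta Z) (cov _ _)).
move: (pairing (bra _ _) _) (pairing (bra _ _) _) (pairing (bra _ _) _) => u v w.
move: (pairing _ _) (pairing _ _) (pairing _ _) => a b c.
move: (pairing _ _) (pairing _ _) (pairing _ _) halfC => d e f h uvw.
have -> : u = - v - w by apply: (addrI (w + v)); rewrite uvw; ring.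
ring.
Qed.

Lemma cpx_jop_pairing A B : tangential A -> tangential B ->
  pairing (jC A) (jC B) = pairing A B.
Proof. by move=> [hA _] [hB _]; rewrite !pairingE; exact: (mxtrace_cpx_jop s3 k3 hA hB). Qed.

Lemma jop_jop_tangential A : tangential A -> jC (jC A) = - A.
Proof. by move=> [hA _]; rewrite (jop_jop kC s3) (mpart_id k3 hA). Qed.

Lemma almost_complex_Jst : almost_complex Jst.
Proof.
split=> [f X Y|X]; apply: theta_inj; last first.
  by rewrite !theta_Jst jop_jop_tangential ?thetaN//; exact: tangential_theta.
have jl A B : jC (f *: A + B) = f *: jC A + jC B by exact: jop_is_linear.
by rewrite theta_Jst (theta_linear f X) jl (theta_linear f (Jst X)) !theta_Jst.
Qed.

Lemma omega_Jst X Y : omega (Jst X) (Jst Y) = omega X Y.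
Proof. by rewrite !omegaE !theta_Jst cpx_jop_pairing//; exact: tangential_theta. Qed.

Lemma omega_pos X x : nonzero_at X x -> 0 < omega X (Jst X) x.
Proof.
move=> [f f0]; rewrite omegaE evM ev_constC pairingE theta_Jst mulr_gt0 ?invr_gt0//.
pose v (g : C) := (X g : C) x.
have tv : tangent_at x v := tangent_at_vf X x.
(* A tangent vector is recovered from its [theta_at], so the latter cannot vanish when X is nonzero
   at x. *)
have y0 : theta_at x v != 0.
  apply: contraNneq f0 => y0.
  have -> : (X f : C) x = v f by [].
  rewrite (tangent_vec tv) y0 /vec_at.
  by rewrite big1// => ij _; rewrite mxE mul0r.
have := cpx_form_pos (SO0_O (rep_SO0 x)) (adj_theta_at tv) (theta_at_horizontal tv) y0.
congr (0 < _); rewrite evm_trace; congr (\tr _).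
rewrite /cpxop !braE !jopE /rot.
by rewrite !(evmM, evmD, evmN, evmZ, evm_sigma, evm_theta) ev_constC.
Qed.

Lemma compatible_omega : compatible omega Jst.
Proof. by split; [exact: omega_Jst|exact: omega_pos]. Qed.

Lemma symplectic_omega : symplectic omega.
Proof.
split; [exact: two_form_omega|exact: closed_omega|] => X x X0.
by exists (Jst X); rewrite gt_eqF// omega_pos.
Qed.

Lemma mpart_bra_jopl A B : tangential A -> tangential B ->
  mC (bra (jC A) B) = - jC (bra A B).
Proof. by move=> [hA _] [hB _]; exact: (mpart_bra_jop s3 k3 hA hB). Qed.

Lemma mpart_bra_jopr A B : tangential A -> tangential B ->
  mC (bra A (jC B)) = - jC (bra A B).
Proof.
move=> tA tB; rewrite (braC A (jC B)) [LHS]mpartN (braC A B) [in RHS]jopN.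
by rewrite mpart_bra_jopl.
Qed.

Lemma mpart_bra_jopjop A B : tangential A -> tangential B ->
  mC (bra (jC A) (jC B)) = - mC (bra A B).
Proof.
move=> tA tB; rewrite mpart_bra_jopl//; last exact: tangential_jop.
rewrite -(jop_mpart s3 k3 (bra A _)) mpart_bra_jopr// jopN opprK.
exact: (jop_jop kC s3).
Qed.

Let nijenhuis_sum (u v d e m : MC) :
  u - v - m - (u + e + m) - (- d - v + m) - (d - e + m) = - (4 *: m).
Proof. by apply/matrixP => i j; rewrite !entryE; ring. Qed.

(** J is parallel with square -1, so the derivative terms cancel; each of the four brackets
    contributes minus the m-part of [theta X, theta Y], which accounts for the factor 4. *)
Lemma theta_nijenhuis X Y : theta (nijenhuis Jst X Y) = - mC (bra (theta X) (theta Y)).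
Proof.
have tX := tangential_theta X; have tY := tangential_theta Y.
have tcX Z W := tangential_cov Z (tangential_theta W).
have c4 : (4^-1 *: (1 : C)) * 4 = 1.
  apply/val_inj/funext => x.
  by rewrite -[LHS]/((4^-1 *: (1 : C) * 4 : C) x) evM evZ ev_nat mulr1 mulVf.
rewrite /nijenhuis thetaZ !thetaD !thetaN !theta_Jst !theta_bracket !theta_Jst !cov_jop.
rewrite mpart_bra_jopjop// mpart_bra_jopl// mpart_bra_jopr//.
have jB A B D : jC (A - B + D) = jC A - jC B + jC D.
  by rewrite !jopD jopN.
rewrite !jB !(jop_jop_tangential (tcX _ _)) !jopN (jop_jop kC s3) !opprK.
set u := jC (cov _ _); set v := jC (cov _ _); set m := mC _.
set d := cov X _; set e := cov Y _.
by rewrite nijenhuis_sum scalerN scalerA c4 scale1r.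
Qed.

Lemma torsion_nab X Y : torsion nab X Y = nijenhuis Jst X Y.
Proof.
apply: theta_inj; rewrite theta_nijenhuis /torsion !thetaD !thetaN !theta_nab theta_bracket.
by rewrite opprD addrA subrr sub0r.
Qed.

Lemma cov_linear f X Y A : cov (f *: X + Y) A = f *: cov X A + cov Y A.
Proof.
rewrite !covE dmDl dmZl (theta_linear f X) braDl braZl scalerBr.
by rewrite opprD addrACA.
Qed.

Lemma covZ_fun X f A : cov X (f *: A) = (X f : C) *: A + f *: cov X A.
Proof. by rewrite !covE dmZ braZr scalerBr addrA. Qed.

Lemma connection_nab : connection nab.
Proof.
split=> [Y f X X'|X Y Z|X f Y]; apply: theta_inj.
- by rewrite theta_nab cov_linear (theta_linear f (nab X Y)) !theta_nab.
- by rewrite theta_nab !thetaD !theta_nab covD.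
- by rewrite theta_nab !thetaD !thetaZ !theta_nab covZ_fun.
Qed.

Lemma metric_nab : preserves_metric (metric omega Jst) nab.
Proof.
move=> X Y Z; rewrite /metric !omegaE vf_halfC vf_pairing !theta_Jst !theta_nab cov_jop.
by rewrite mulrDr.
Qed.

Lemma chern_connection_nab : chern_connection omega Jst nab.
Proof. split; [exact: connection_nab|exact: metric_nab|exact: torsion_nab]. Qed.

Definition vert A : MC := A - mC A.

Let curvature_sum (P Q u u' r t v v' c g b : MC) : u - u' = c + b + b -> v - v' = b ->
  (P - u - r - t + v) - (Q - u' - t - r + v') - (P - Q - (c + g)) = - (b - g).
Proof.
move=> /(canRL (subrK _)) -> /(canRL (subrK _)) ->.
by apply/matrixP => i j; rewrite !entryE; ring.
Qed.

(** [dm] is flat, so only brackets with expressions in theta are left. The m-part of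
    [theta X, theta Y] is absorbed by the derivative along [bracket X Y]; the isotropy part
    remains. *)
Lemma cov_commutator X Y A : cov X (cov Y A) - cov Y (cov X A) - cov (bracket X Y) A =
  - bra (vert (bra (theta X) (theta Y))) A.
Proof.
have cc U W : cov U (cov W A) = dm U (dm W A) - bra (dm U (theta W)) A
    - bra (theta W) (dm U A) - bra (theta U) (dm W A) + bra (theta U) (bra (theta W) A).
  rewrite !covE dmD dmN dm_bra braDr braNr !opprD opprK !addrA.
  by congr (_ + _); rewrite addrAC.
have e : bra (dm X (theta Y)) A - bra (dm Y (theta X)) A =
    bra (cov X (theta Y) - cov Y (theta X)) A + bra (bra (theta X) (theta Y)) A
    + bra (bra (theta X) (theta Y)) A.
  by rewrite -braNl -!braDl dm_theta_sub.
rewrite !cc covE dm_bracket theta_bracket (braDl _ (mC _)) /vert (braDl (bra _ _)) braNl.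
by apply: curvature_sum e _; exact: bra_Jacobi.
Qed.

Lemma theta_curvature X Y Z : theta (curvature nab X Y Z) =
  - bra (vert (bra (theta X) (theta Y))) (theta Z).
Proof. by rewrite /curvature !thetaD !thetaN !theta_nab cov_commutator. Qed.

End Geometry.

(** * The trace of a restriction to an invariant subspace *)

Section TraceOnSubspace.
Variables (F : fieldType) (d : nat) (P L : 'M[F]_d).
Hypotheses (PP : P *m P = P) (LP : P *m L *m P = P *m L).
Local Notation B := (row_base P).

Lemma row_base_idem : B *m P = B.
Proof.
have /submxP[D e] : (B <= P)%MS by rewrite eq_row_base.
by rewrite {1}e -mulmxA PP -e.
Qed.

(** In the row-vector convention, the matrix of the restriction of [L] to the image of [P], in the
    basis [row_base P]. *)
Definition base_mx : 'M[F]_(\rank P) := B *m L *m col_base P.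

Lemma base_mxE : base_mx *m B = B *m L.
Proof.
have e : B *m P *m L = B *m L by rewrite row_base_idem.
by rewrite /base_mx -mulmxA mulmx_base -e -!mulmxA (mulmxA P L P) LP.
Qed.

Lemma base_mx_trace : \tr base_mx = \tr (P *m L).
Proof. by rewrite mxtrace_mulC mulmxA mulmx_base. Qed.

End TraceOnSubspace.

Lemma trace_lin_mx (F : fieldType) n (f : {linear 'M[F]_n -> 'M[F]_n}) :
  \tr (lin_mx f) = ltrace f.
Proof.
rewrite /ltrace pair_big /mxtrace.
rewrite (reindex _ (curry_mxvec_bij _ _)) /=.
by apply: eq_bigr => -[i j] _; rewrite !mxE /= vec_mx_delta mxvecE.
Qed.

(** * The Chern-Ricci form *)

Section ChernRicci.
Variables (R : realType) (p q : nat).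
Local Notation n := (p + p + q)%N.
Local Notation V := 'M[R]_n.
Local Notation M := (period_domain R p q).
Local Notation C := (smoothFun M).
Local Notation vf := (vectorField M).
Local Notation MC := 'M[C]_n.
Local Notation s := (sigmaC R p q).
Local Notation kC := (kC R p q).
Local Notation adjC := (adjointmx (formC R p q)).
Local Notation s3 := (sigmaC3 R p q).
Local Notation k3 := (kC3 R p q).
Local Notation SSC := (formCK R p q).
Local Notation asC := (adj_sigmaC R p q).
Local Notation rotC := (rot s).
Local Notation jC := (jop s kC).
Local Notation JC := (cpxop s kC).
Implicit Types (X Y Z : vf) (A B : V) (x : M).

Local Notation omega := (@omega R p q).
Local Notation Jst := (@Jst R p q).
Local Notation nab := (@nab R p q).
Local Notation vert := (@vert R p q).

Section AtPoint.
Variable x : M.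
Local Notation sx := (sigma_at x).
Local Notation kR := ((sqrt3 R)^-1).
Local Notation adj := (adjointmx (signature_form R (p + p) q)).
Local Notation SS := (signature_formK R (p + p) q).
Local Notation k3R := (kR3 R).
Let sx3 : sx *m sx *m sx = 1%:M. Proof. by have [] := sigma_at_order3 x. Qed.
Let asx : adj sx = sx *m sx. Proof. by have [] := sigma_at_order3 x. Qed.

Definition tangential_at (B : V) := horizontal sx B /\ adj B = - B.

Lemma tangential_theta_at v : tangent_at x v -> tangential_at (theta_at x v).
Proof. by move=> tv; split; [exact: theta_at_horizontal|exact: adj_theta_at]. Qed.

Lemma theta_at_vec_at B : tangential_at B -> theta_at x (vec_at x B) = B.
Proof.
move=> [hB aB]; have tv := tangent_vec_at x B.
apply: (horizontal_ext sx3 k3R (theta_at_horizontal tv) hB).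
rewrite (bra_theta_at tv) -[in RHS](skew_id aB).
by apply/matrixP => i j; rewrite mxE vec_at_sigma.
Qed.

Lemma vec_at_inj B B' : tangential_at B -> tangential_at B' ->
  vec_at x B =1 vec_at x B' -> B = B'.
Proof.
move=> tB tB' e; rewrite -(theta_at_vec_at tB) -(theta_at_vec_at tB').
by congr theta_at; apply/funext.
Qed.

Lemma vec_at_sum m (c : 'I_m -> R) (b : 'I_m -> V) f :
  vec_at x (\sum_i c i *: b i) f = \sum_i c i * vec_at x (b i) f.
Proof.
rewrite /vec_at.
under [RHS]eq_bigr do rewrite mulr_sumr.
rewrite exchange_big; apply: eq_bigr => ij _; rewrite summxE mulr_suml.
by apply: eq_bigr => l _; rewrite mxE mulrA.
Qed.

(** Composing with this projection extends an endomorphism of the tangent space to all matrices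
    without changing its trace, which can then be summed over elementary matrices. *)
Definition tangent_proj (B : V) : V := mpart sx kR (skew B).

Lemma tangent_proj_is_linear : linear tangent_proj.
Proof.
move=> c A B; rewrite /tangent_proj.
have -> : skew (c *: A + B) = c *: skew A + skew B.
  by rewrite /skew linearP; apply/matrixP => i j; rewrite !entryE; ring.
exact: mpart_is_linear.
Qed.
HB.instance Definition _ := GRing.isLinear.Build R V V _ tangent_proj tangent_proj_is_linear.

Lemma tangent_proj_id B : tangential_at B -> tangent_proj B = B.
Proof. by move=> [hB aB]; rewrite /tangent_proj skew_id// (mpart_id k3R hB). Qed.

Lemma tangential_proj B : tangential_at (tangent_proj B).
Proof.
split; first exact: (horizontal_mpart kR sx3).
by rewrite (adj_mpart kR SS sx3 asx) adj_skew mpartN.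
Qed.

Local Notation P := (lin_mx tangent_proj).
Local Notation Bs := (row_base P).
Definition base_vec i : V := vec_mx (row i Bs).
(** The constant matrix need not be tangential away from [x]; only the value at [x] matters, where
    theta of this field is [base_vec i]. *)
Definition base_field i : vf := vec (map_mx (constC p q) (base_vec i)).

Lemma proj_idem : P *m P = P.
Proof.
apply/row_matrixP => i; rewrite !rowE mulmxA !mul_rV_lin /=.
by rewrite mxvecK (tangent_proj_id (tangential_proj _)).
Qed.

Lemma tangential_row_base (c : 'rV[R]_(\rank P)) : tangential_at (vec_mx (c *m Bs)).
Proof.
have := mul_rV_lin tangent_proj (c *m Bs).
rewrite -mulmxA (row_base_idem proj_idem) => ->.
by rewrite mxvecK; exact: tangential_proj.
Qed.

Lemma tangential_base i : tangential_at (base_vec i).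
Proof. by rewrite /base_vec rowE; exact: tangential_row_base. Qed.

Lemma base_field_at i f : (base_field i f : C) x = vec_at x (base_vec i) f.
Proof.
rewrite ev_vec; congr vec_at; apply/matrixP => a b; rewrite !mxE.
exact: ev_constC.
Qed.

Lemma evm_theta_base i : evm x (theta (base_field i)) = base_vec i.
Proof.
rewrite evm_theta -[RHS]theta_at_vec_at; last exact: tangential_base.
by congr theta_at; apply/funext => f; exact: base_field_at.
Qed.

Lemma base_sum (c : 'rV[R]_(\rank P)) : \sum_i c 0 i *: base_vec i = vec_mx (c *m Bs).
Proof.
rewrite mulmx_sum_row linear_sum; apply: eq_bigr => i _.
by rewrite linearZ.
Qed.

Lemma base_field_sum (c : 'rV[R]_(\rank P)) f :
  \sum_i c 0 i * (base_field i f : C) x = vec_at x (vec_mx (c *m Bs)) f.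
Proof.
rewrite -base_sum vec_at_sum; apply: eq_bigr => i _.
by rewrite base_field_at.
Qed.

Lemma frame_base_field : frame_at x base_field.
Proof.
move=> v tv; have tth := tangential_theta_at tv.
(* [theta_at x v] lies in the image of [P], and [P] is the product of [col_base P] and [row_base P],
   so this factor gives its coordinates. *)
pose c := mxvec (theta_at x v) *m col_base P.
have e : vec_mx (c *m Bs) = theta_at x v.
  by rewrite /c -mulmxA mulmx_base mul_vec_lin mxvecK /= tangent_proj_id.
exists c; split=> [f|c' e'].
  by rewrite base_field_sum e; exact: tangent_vec.
apply: (row_free_inj (row_base_free P)); apply: (can_inj vec_mxK).
rewrite e; apply: vec_at_inj => //.
  exact: tangential_row_base.
by move=> f; rewrite -base_field_sum -e' (tangent_vec tv).
Qed.

Section Endomorphism.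
Variables (T : vf -> vf) (L : {linear V -> V}).
Hypothesis TL : forall Z, evm x (theta (T Z)) = L (evm x (theta Z)).
Hypothesis L_tangential : forall B, tangential_at B -> tangential_at (L B).

Lemma trace_at_ltrace : trace_at x T (ltrace (fun B => L (tangent_proj B))).
Proof.
pose Lm := lin_mx L.
have LP : P *m Lm *m P = P *m Lm.
  apply/row_matrixP => i; rewrite !rowE !mulmxA !mul_rV_lin /= !mxvecK.
  by rewrite tangent_proj_id//; exact/L_tangential/tangential_proj.
(* Transposed, because [base_mx] acts on row vectors while [trace_at] expands images along
   columns. *)
exists (\rank P), base_field, (base_mx P Lm)^T; split.
- exact: frame_base_field.
- move=> j f; rewrite -[T _]vec_theta ev_vec TL evm_theta_base.
  have -> : L (base_vec j) = vec_mx (row j (base_mx P Lm) *m Bs).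
    rewrite -row_mul base_mxE ?proj_idem//.
    by rewrite row_mul mul_rV_lin mxvecK.
  rewrite -base_field_sum; apply: eq_bigr => i _.
  by rewrite !mxE.
- rewrite mxtrace_tr base_mx_trace.
  have -> : P *m Lm = lin_mx (L \o tangent_proj).
    by apply/row_matrixP => i; rewrite !rowE mulmxA !mul_rV_lin /= mxvecK.
  by rewrite trace_lin_mx.
Qed.

End Endomorphism.

End AtPoint.

Lemma evm_bra m x (A B : 'M[C]_m) : evm x (bra A B) = bra (evm x A) (evm x B).
Proof. by rewrite !braE evmD evmN !evmM. Qed.

Lemma evm_rot x (A : MC) : evm x (rotC A) = rot (sigma_at x) (evm x A).
Proof. by rewrite /rot !evmM evm_sigma. Qed.

Lemma evm_jop x (A : MC) : evm x (jC A) = jop (sigma_at x) (sqrt3 R)^-1 (evm x A).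
Proof. by rewrite !jopE evmZ evmD evmN !evm_rot ev_constC. Qed.

Lemma evm_cpxop x : evm x JC = cpxop (sigma_at x) (sqrt3 R)^-1.
Proof. by rewrite /cpxop evmZ evmD evmN evmM evm_sigma ev_constC. Qed.

Lemma mxtrace_sigma_at x : \tr (sigma_at x : V) = q%:R - p%:R.
Proof.
rewrite -tr_sigma0 /sigma_at /conj_point mxtrace_mulC mulmxA.
by have /indefinite_OP -> := SO0_O (rep_SO0 x); rewrite mul1mx.
Qed.

Lemma adj_vert (A : MC) : adjC A = - A -> adjC (vert A) = - vert A.
Proof.
move=> aA; rewrite /vert linearB /= aA (adj_mpart kC SSC s3 asC) aA mpartN.
by rewrite opprD.
Qed.

Lemma chern_ricci_nab : chern_ricci_form Jst nab
  (fun X Y => (2 * p%:R - 2 * q%:R - 2 : R) *: omega X Y).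
Proof.
move=> X Y x; pose sx := sigma_at x : V; pose k := (sqrt3 R)^-1.
have [aX aY] := (adj_theta X, adj_theta Y).
pose w := bra (theta X) (theta Y); pose h := evm x (vert w).
have sx3 : sx *m sx *m sx = 1%:M by have [] := sigma_at_order3 x.
have asx : adjointmx (signature_form R (p + p) q) sx = sx *m sx.
  by have [] := sigma_at_order3 x.
have ah : adjointmx (signature_form R (p + p) q) h = - h.
  rewrite -evm_adj adj_vert ?evmN// /w (adj_bra SSC) aX aY.
  by rewrite braNl braNr opprK.
have rvw : rotC (vert w) = vert w by exact: (rot_vertical s3 k3 w).
have hs : h *m sx = sx *m h.
  by rewrite /sx -evm_sigma -!evmM (rot_fixed_comm s3 rvw).
have rh : rot sx h = h by rewrite /h -evm_rot rvw.
pose L (B : V) := jop sx k (- bra h B).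
have L_lin : linear L.
  by move=> c A B; rewrite /L braDr braZr opprD -scalerN; exact: jop_is_linear.
pose Lm := GRing.isLinear.Build R V V _ L L_lin.
pose Ll : {linear V -> V} := HB.pack L Lm.
have TL Z : evm x (theta (Jst (curvature nab X Y Z))) = Ll (evm x (theta Z)).
  by rewrite theta_Jst theta_curvature evm_jop evmN evm_bra.
have LT B : tangential_at x B -> tangential_at x (Ll B).
  move=> [_ aB]; split; first exact: (horizontal_jop k sx3).
  rewrite /= /L (adj_jop k (signature_formK R (p + p) q) sx3 asx).
  rewrite linearN /= (adj_bra (signature_formK R (p + p) q)) ah aB.
  by rewrite braNl braNr !opprK jopN opprK.
have := trace_at_ltrace TL LT; congr trace_at.
transitivity (- ltrace (fun B =>
    jop sx k (bra h (2^-1 *: (B - adjointmx (signature_form R (p + p) q) B))))).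
  rewrite -ltraceN; apply: eq_ltrace => B.
  rewrite /= /L jopN; congr (- _).
  rewrite -[bra h _](_ : mpart sx k (bra h (skew B)) = _) ?(jop_mpart sx3 (kR3 R))//.
  rewrite /tangent_proj !mpartE !(rot_bra sx3) !rh braZr !braDr !braNr braZr.
  by [].
rewrite (ltrace_jop_bra k (signature_form_tr R (p + p) q)
  (signature_formK R (p + p) q) sx3 _ asx ah hs); last by rewrite divff.
rewrite mxtrace_sigma_at omegaE evZ evM ev_constC pairingE evm_trace evmM evm_cpxop -/w.
(* The m-part of the bracket has zero trace against [cpxop], so [h] may be replaced by the whole
   bracket, whose trace is twice omega. *)
have -> : \tr (cpxop sx k *m h) = \tr (cpxop sx k *m evm x w).
  rewrite -evm_cpxop -!evmM -!evm_trace; congr (_ x).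
  by rewrite /vert mulmxBr raddfB /= (mxtrace_cpx_mpart kC s3) subr0.
by move: (\tr _) => t; field.
Qed.

End ChernRicci.

Theorem theorem5 (R : realType) (p q : nat) (hp : (0 < p)%N) (hq : (0 < q)%N) :
  let M := period_domain R p q in
  exists (omega : vectorField M -> vectorField M -> smoothFun M)
         (J : vectorField M -> vectorField M),
    [/\ symplectic omega,
        almost_complex J,
        compatible omega J,
        exists nabla, chern_connection omega J nabla &
        forall nabla, chern_connection omega J nabla ->
          chern_ricci_form J nabla
            (fun X Y => (2 * p%:R - 2 * q%:R - 2 : R) *: omega X Y)].
Proof.
exists (@omega R p q), (@Jst R p q).
have aJ := almost_complex_Jst R p q; have cJ := compatible_omega R p q.
have cn := chern_connection_nab R p q; have sw := symplectic_omega R p q.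
split=> //; first by exists (@nab R p q).
move=> nabla cnabla; have [tw _ _] := sw.
have -> : nabla = @nab R p q.
  by apply/funext => X; apply/funext => Y; exact: chern_unique tw aJ cJ cnabla cn X Y.
exact: chern_ricci_nab.
Qed.
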